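(* If $\mathcal I$ is not a building, then the topologies $\mathscr T_+$ and $\mathscr T_-$ on $\mathcal I$ are different.
   Context: **Vectorial data.** $I$ is a finite set and $C=(c_{i,j})_{i,j\in I}$ is a Kac--Moody matrix: $c_{i,j}\in\mathbb Z$, $c_{i,i}=2$, $c_{i,j}\le 0$ for $i\neq j$, and $c_{i,j}=0\iff c_{j,i}=0$. $X,Y$ are dual free $\mathbb Z$-modules of finite rank with $\mathbb Z$-linearly independent families $(\alpha_i)_{i\in I}$ in $X$ and $(\alpha_i^\vee)_{i\in I}$ in $Y$ such that $\alpha_j(\alpha_i^\vee)=c_{i,j}$. $\mathbb A=Y\otimes\mathbb R$, with its usual topology; elements of $X$ are linear forms on $\mathbb A$. $r_i(v)=v-\alpha_i(v)\alpha_i^\vee$, and $W^v=\langle r_i\mid i\in I\rangle\subset \mathrm{GL}(\mathbb A)$ (Weyl group), acting on $\mathbb A^*$ by $(w.\alpha)(x)=\alpha(w^{-1}x)$. $\Phi=\{w.\alpha_i\}$ is the set of real roots; for $\alpha=w.\alpha_i\in\Phi$, $\alpha^\vee=w.\alpha_i^\vee$. $Q^\vee=\bigoplus_i\mathbb Z\alpha_i^\vee$ and $W^a=Q^\vee\rtimes W^v$. $\Delta\subset\bigoplus_i\mathbb Z\alpha_i\subset\mathbb A^*$ is the set of all (real and imaginary) roots of the Kac--Moody algebra of $C$. For $\alpha\in\mathbb A^*$, $k\in\mathbb R$: $D(\alpha,k)=\{\alpha(x)+k\ge0\}$, $D^\circ(\alpha,k)=\{\alpha(x)+k>0\}$, $M(\alpha,k)=\{\alpha(x)+k=0\}$,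 and $D(\alpha,+\infty)=D^\circ(\alpha,+\infty)=\mathbb A$. Walls (resp. half-apartments) are the $M(\alpha,k)$ (resp. $D(\alpha,k)$), $\alpha\in\Phi$, $k\in\mathbb Z$. $C^v_f=\{v\mid\alpha_i(v)>0\ \forall i\}$; for $J\subset I$, $F^v(J)=\{v\mid \alpha_i(v)=0\ (i\in J),\ \alpha_i(v)>0\ (i\notin J)\}$. Positive (resp. negative) vectorial faces are the $w.F^v(J)$ (resp. $-w.F^v(J)$), $w\in W^v$; vectorial chambers are the $\pm w.C^v_f$. Tits cone: $\mathcal T=\bigcup_{w}w.\overline{C^v_f}$. A vectorial face is spherical if it meets $\pm\mathring{\mathcal T}$. $x\le y$ means $y-x\in\mathcal T$. A ray or segment through $x\ne y$ from $x$ is preordered if $x\le y$ or $y\le x$, generic if $y-x\in\pm\mathring{\mathcal T}$. **Filters.** A filter lies in a set $Z$ if $Z$ is an element of it; a set (e.g. an apartment) contains a filter if it contains an element of it; a map fixes a filter if it fixes pointwise some element of it. The support of a filter is the smallest affine subspace containing it. $\mathcal F\Cup\mathcal F'=\{E\cup E'\mid E\in\mathcal F,E'\in\mathcal F'\}$. The enclosure $\mathrm{cl}(\mathcal F)$ of a filter on $\mathbb A$ is the filter of sets $E$ containing some $\bigcap_{\alpha\in\Delta}D(\alpha,k_\alpha)\in\mathcal F$ with $k_\alpha\in\mathbb Z\cup\{+\infty\}$ (a set is treated as its principal filter). A sector-face is $f=x+F^v$ ($F^v$ a vectorial face); its germ at infinity is the filter of sets containing $x+u+F^v$ for some $u\in\overline{F^v}$.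 If $F^v$ is a vectorial chamber, $f$ is a sector and its germ is a sector-germ, with the sign of $F^v$; $\pm\infty$ is the germ of $\pm C^v_f$. The face $F(x,F^v)$ is the filter of sets $E$ for which there are $k_\alpha,k'_\alpha\in\mathbb Z\cup\{+\infty\}$ $(\alpha\in\Delta)$ and a neighbourhood $\Omega$ of $x$ with $E\supset\bigcap_{\alpha}(D(\alpha,k_\alpha)\cap D^\circ(\alpha,k'_\alpha))\supset\Omega\cap(x+F^v)$. A chamber (resp. panel) is a face with support $\mathbb A$ (resp. a wall). A chimney is $\mathfrak r(F,F^v)=\mathrm{cl}(F+F^v)$, $F$ a face, $F^v$ a vectorial face; it is splayed if $F^v$ is spherical, solid if the pointwise stabilizer in $W^v$ of the direction of its support is finite. Its germ is the filter of sets belonging to some $\mathfrak r(F+u,F^v)$, $u\in\overline{F^v}$. **Apartments.** $\mathrm{Aut}(\mathbb A)$ is the group of affine bijections of $\mathbb A$ stabilizing $\{(M(\alpha,k),\alpha^\vee)\mid\alpha\in\Phi,k\in\mathbb Z\}$. An apartment of type $\mathbb A$ is a set $A$ with a nonempty set $\mathrm{Isom}^w(\mathbb A,A)$ of bijections $\mathbb A\to A$ forming one orbit $f_0\circ W^a$. A bijection $\phi:A\to A'$ is a Weyl isomorphism (resp. an isomorphism, which here always means vectorially Weyl isomorphism) if $f'^{-1}\circ\phi\circ f\in W^a$ (resp. $\in(W^v\ltimes\mathbb A)\cap\mathrm{Aut}(\mathbb A)$) for $f\in\mathrm{Isom}^w(\mathbb A,A)$, $f'\in\mathrm{Isom}^w(\mathbb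 A,A')$. All above notions, the affine structure and the affine topology are transported to every apartment. **Masure.** A masure of type $\mathbb A$ is a set $\mathcal I$ covered by a family of subsets called apartments such that: (MA1) each apartment has a structure of apartment of type $\mathbb A$. (MA2) If $F$ is a point, a germ of a preordered interval, a generic ray or a solid chimney in an apartment $A$, and $A'$ is another apartment containing $F$, then $A\cap A'$ contains $\mathrm{cl}_A(F)$ and there is a Weyl isomorphism $A\to A'$ fixing $\mathrm{cl}_A(F)$. (MA3) If $\mathfrak R$ is the germ of a splayed chimney and $F$ is a face or a germ of a solid chimney, some apartment contains $\mathfrak R$ and $F$. (MA4) If apartments $A,A'$ contain $\mathfrak R$ and $F$ as in (MA3), there is a Weyl isomorphism $A\to A'$ fixing $\mathrm{cl}_A(\mathfrak R\Cup F)$. (MAO) If $x,y\in A\cap A'$ and $x\le_A y$ then $[x,y]_A=[x,y]_{A'}$. Standing assumptions: $\mathcal I$ is such a masure; each panel lies in the closure of finitely many, and more than $2$, chambers; a group $G$ acts strongly transitively on $\mathcal I$ (it permutes apartments, each $g:A\to g.A$ is an isomorphism of apartments, and all isomorphisms in the axioms are induced by elements of $G$); $\mathbb A$ is identified with a fixed apartment of $\mathcal I$, and the stabilizer of $\mathbb A$ in $G$ induces on $\mathbb A$ the group $W^v\ltimes Y$. $\mathcal I$ is a building if and only if $W^v$ is finite. Sector-germs of $\mathcal I$ are sector-germs of its apartments (a sector-germ contained in an apartment $B$ is a sector-germ of $B$, of the same sign). **Distances.** Let $\mathfrak s$ be a sector-germ of sign $\mathrm{sgn}(\mathfrak s)\in\{+,-\}$,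 $x\in\mathcal I$, $u\in\overline{C^v_f}$. Choose an apartment $A_1$ containing $x$ and $\mathfrak s$ and an isomorphism $\psi:\mathbb A\to A_1$ with $\psi(\mathrm{sgn}(\mathfrak s)\infty)=\mathfrak s$; then $x+_{\mathfrak s}u:=\psi(\psi^{-1}(x)+\mathrm{sgn}(\mathfrak s)u)$ is independent of choices. $U_{\mathfrak s}(x,x')=\{(u,u')\in\overline{C^v_f}^2\mid x+_{\mathfrak s}u=x'+_{\mathfrak s}u'\}$, which is nonempty. $\Theta_+$ (resp. $\Theta_-$) is the set of pairs $\theta=(|\cdot|,\mathfrak s)$ with $|\cdot|$ a norm on $\mathbb A$ and $\mathfrak s$ a positive (resp. negative) sector-germ of $\mathcal I$. For such $\theta$, $d_\theta(x,x')=\inf\{|u|+|u'|\mid(u,u')\in U_{\mathfrak s}(x,x')\}$ is a distance on $\mathcal I$. For each sign, all $d_\theta$ with $\theta\in\Theta_\pm$ are equivalent (bounded above and below by positive multiples of one another); $\mathscr T_\pm$ is the topology on $\mathcal I$ induced by $d_\theta$ for any $\theta\in\Theta_\pm$. *)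

(* Defs.v *)
From HB Require Import structures.
From mathcomp Require Import all_boot all_order all_algebra.
From mathcomp Require Import complex.
From mathcomp Require Import all_classical all_reals topology normedtype.

Set Implicit Arguments.
Unset Strict Implicit.
Unset Printing Implicit Defensive.

Import Order.TTheory GRing.Theory Num.Theory.
Import numFieldNormedType.Exports.

Local Open Scope classical_set_scope.
Local Open Scope ring_scope.

(* A linear form is a column vector, acting on row vectors. *)
Definition pairing (K : nzRingType) (n : nat) (a : 'cV[K]_n) (v : 'rV[K]_n) : K :=
  (v *m a) 0 0.

Definition lin_indep (K : nzRingType) (E : lmodType K) (I : finType)
    (x : I -> E) : Prop :=
  forall a : I -> K, \sum_i a i *: x i = 0 -> forall i, a i = 0.

Definition lin_subspace (K : nzRingType) (E : lmodType K) (S : set E) : Prop :=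
  S 0 /\ forall a x y, S x -> S y -> S (a *: x + y).

Definition kac_moody_matrix (I : finType) (c : I -> I -> int) : Prop :=
  [/\ forall i, c i i = 2,
      forall i j, i != j -> c i j <= 0
    & forall i j, c i j = 0 <-> c j i = 0].

(* The dual free modules Y and X are given in dual bases: Y = Z^n (rows) and
   X = Z^n (columns). *)
Record vectorial_data := VectorialData {
  vd_index : finType;
  vd_matrix : vd_index -> vd_index -> int;
  vd_rank : nat;
  vd_root : vd_index -> 'cV[int]_vd_rank;
  vd_coroot : vd_index -> 'rV[int]_vd_rank;
  vd_matrixP : kac_moody_matrix vd_matrix;
  vd_root_free : lin_indep vd_root;
  vd_coroot_free : lin_indep vd_coroot;
  vd_pairing : forall i j, pairing (vd_root j) (vd_coroot i) = vd_matrix i j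
}.

Definition matrix_rank (K : fieldType) (I : finType) (c : I -> I -> int) : nat :=
  \rank (\matrix_(i < #|I|, j < #|I|)
            ((c (enum_val i) (enum_val j))%:~R : K)).

(* The dimension of a minimal realization. *)
Definition realization_dim (K : fieldType) (I : finType) (c : I -> I -> int) : nat :=
  (2 * #|I| - matrix_rank K c)%N.

(* The Kac-Moody algebra g(c) = g~(c)/tau (tau the largest ideal meeting the
   Cartan subalgebra trivially), pinned down up to isomorphism as in V. Kac,
   Infinite dimensional Lie algebras, Prop. 1.4. The Cartan subalgebra is the
   image of K^d, d = realization_dim K c, under the injection km_cartan, and
   (K^d, km_root, km_coroot) is a minimal realization of c. *)
Record kac_moody_algebra (K : fieldType) (I : finType) (c : I -> I -> int) :=
  KacMoodyAlgebra {
  km_alg :> lmodType K;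
  km_bracket : km_alg -> km_alg -> km_alg;
  km_bracket_linear_l : forall y, linear (fun x => km_bracket x y);
  km_bracket_linear_r : forall x, linear (km_bracket x);
  km_bracket_alt : forall x, km_bracket x x = 0;
  km_jacobi : forall x y z,
    km_bracket x (km_bracket y z) + km_bracket y (km_bracket z x)
      + km_bracket z (km_bracket x y) = 0;
  km_root : I -> 'cV[K]_(realization_dim K c);
  km_coroot : I -> 'rV[K]_(realization_dim K c);
  km_root_free : lin_indep km_root;
  km_coroot_free : lin_indep km_coroot;
  km_pairing : forall i j, pairing (km_root j) (km_coroot i) = (c i j)%:~R;
  km_cartan : 'rV[K]_(realization_dim K c) -> km_alg;
  km_cartan_linear : linear km_cartan;
  km_cartan_inj : injective km_cartan;
  km_e : I -> km_alg;
  km_f : I -> km_alg;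
  km_cartan_abelian : forall h h', km_bracket (km_cartan h) (km_cartan h') = 0;
  km_ef : forall i j,
    km_bracket (km_e i) (km_f j) = if i == j then km_cartan (km_coroot i) else 0;
  km_he : forall h i,
    km_bracket (km_cartan h) (km_e i) = pairing (km_root i) h *: km_e i;
  km_hf : forall h i,
    km_bracket (km_cartan h) (km_f i) = - (pairing (km_root i) h *: km_f i);
  km_generated : forall S : set km_alg,
    lin_subspace S -> (forall x y, S x -> S y -> S (km_bracket x y)) ->
    (forall h, S (km_cartan h)) -> (forall i, S (km_e i)) ->
    (forall i, S (km_f i)) -> S = setT;
  km_no_ideal : forall J : set km_alg,
    lin_subspace J -> (forall x y, J x -> J (km_bracket x y)) ->
    J `&` range km_cartan = [set 0] -> J = [set 0]
}.

(* The root \sum_i m_i alpha_i is encoded by its coordinates m. *)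
Definition km_is_root (K : fieldType) (I : finType) (c : I -> I -> int)
    (g : kac_moody_algebra K c) (m : I -> int) : Prop :=
  (exists i, m i != 0) /\
  exists2 x : g, x != 0 &
    forall h, km_bracket (km_cartan g h) x
              = (\sum_i (m i)%:~R * pairing (km_root g i) h) *: x.

(** * The model apartment *)

Section Model.
Variables (R : realType) (D : vectorial_data).
Variable g : kac_moody_algebra R[i] (@vd_matrix D).

Local Notation I := (vd_index D).
Local Notation V := 'rV[R]_(vd_rank D).
Local Notation Vdual := 'cV[R]_(vd_rank D).

Definition aroot (i : I) : Vdual := map_mx intr (vd_root i).
Definition acoroot (i : I) : V := map_mx intr (vd_coroot i).

Definition reflection (i : I) (v : V) : V :=
  v - pairing (aroot i) v *: acoroot i.

(* The reflections are involutions, so the group they generate is the monoid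
   they generate. *)
Inductive weyl : set (V -> V) :=
| weyl_id : weyl id
| weyl_refl i w : weyl w -> weyl (reflection i \o w).

(* (a, av) = (w.alpha_i, w.alpha_i^vee), where (w.alpha)(x) = alpha(w^-1 x). *)
Definition real_root_pair (a : Vdual) (av : V) : Prop :=
  exists i w, [/\ weyl w, forall x, pairing a (w x) = pairing (aroot i) x
                & av = w (acoroot i)].

Definition real_root (a : Vdual) : Prop := exists av, real_root_pair a av.

Definition all_roots : set Vdual :=
  [set a | exists2 m, km_is_root g m & a = \sum_i (m i)%:~R *: aroot i].

Definition lattice : set V :=
  range (fun y : 'rV[int]_(vd_rank D) => map_mx intr y : V).
Definition coroot_lattice : set V :=
  range (fun m : I -> int => \sum_i (m i)%:~R *: acoroot i).

(* The group of maps x |-> w x + t, with w in W^v and t in T. *)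
Definition semidirect (T : set V) : set (V -> V) :=
  [set h | exists w t, [/\ weyl w, T t & h = (fun x => w x + t)]].

Definition affine_weyl : set (V -> V) := semidirect coroot_lattice.

Definition wall (a : Vdual) (k : R) : set V := [set x | pairing a x + k = 0].
Definition is_wall (M : set V) : Prop :=
  exists a (k : int), real_root a /\ M = wall a k%:~R.

(* [None] stands for the parameter +oo. *)
Definition half_space (a : Vdual) (k : option int) : set V :=
  if k is Some m then [set x | 0 <= pairing a x + m%:~R] else setT.
Definition open_half_space (a : Vdual) (k : option int) : set V :=
  if k is Some m then [set x | 0 < pairing a x + m%:~R] else setT.

Definition linear_part (h : V -> V) (v : V) : V := h v - h 0.

Definition walls_with_coroots : set (set V * V) :=
  [set p | exists a av (k : int),
             real_root_pair a av /\ p = (wall a k%:~R, av)].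

Definition aut_model : set (V -> V) :=
  [set h : V -> V | [/\ bijective h, linear (linear_part h)
             & [set (h @` p.1, linear_part h p.2) | p in walls_with_coroots]
               = walls_with_coroots]].

Definition vweyl_aut : set (V -> V) := semidirect setT `&` aut_model.

(** ** Vectorial faces and the Tits cone *)

Definition sgn (b : bool) (v : V) : V := if b then v else - v.

Definition fund_face (J : {set I}) : set V :=
  [set v | forall i, if i \in J then pairing (aroot i) v = 0
                     else 0 < pairing (aroot i) v].
Definition fund_chamber : set V :=
  [set v | forall i, 0 < pairing (aroot i) v].

Definition vface (b : bool) (F : set V) : Prop :=
  exists w J, weyl w /\ F = [set sgn b (w v) | v in fund_face J].
Definition is_vface (F : set V) : Prop := exists b, vface b F.

Definition vchamber (b : bool) (C : set V) : Prop :=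
  exists2 w, weyl w & C = [set sgn b (w v) | v in fund_chamber].

Definition tits_cone : set V :=
  [set w v | w in weyl & v in closure fund_chamber].

Definition generic (v : V) : Prop := tits_cone° v \/ tits_cone° (- v).
Definition spherical (F : set V) : Prop := exists2 v, F v & generic v.

Definition tits_le (x y : V) : Prop := tits_cone (y - x).

Definition segment (x y : V) : set V :=
  [set x + t *: (y - x) | t in [set t : R | 0 <= t <= 1]].
Definition ray (x y : V) : set V :=
  [set x + t *: (y - x) | t in [set t : R | 0 <= t]].

(** ** Filters on the model apartment

    The filter of a set is its principal filter [globally]. *)

Definition segment_germ (x y : V) : set_system V :=
  [set E | exists2 O, nbhs x O & O `&` segment x y `<=` E].

Definition affine_subspace (Z : set V) : Prop :=
  exists x (U : {vspace V}), Z = [set y | y - x \in U].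
Definition is_support (F : set_system V) (Z : set V) : Prop :=
  [/\ affine_subspace Z, F Z
    & forall Z', affine_subspace Z' -> F Z' -> Z `<=` Z'].
Definition direction (Z : set V) : set V := [set x - y | x in Z & y in Z].

Definition enclosure (F : set_system V) : set_system V :=
  [set E | exists k : Vdual -> option int,
     let P := \bigcap_(a in all_roots) half_space a (k a) in F P /\ P `<=` E].

Definition face (x : V) (Fv : set V) : set_system V :=
  [set E | exists (k k' : Vdual -> option int) (O : set V),
     let P := \bigcap_(a in all_roots)
                (half_space a (k a) `&` open_half_space a (k' a)) in
     [/\ nbhs x O, P `<=` E & O `&` [set x + v | v in Fv] `<=` P]].

Definition is_face (F : set_system V) : Prop :=
  exists x Fv, is_vface Fv /\ F = face x Fv.
Definition is_chamber (F : set_system V) : Prop :=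
  is_face F /\ is_support F setT.
Definition is_panel (F : set_system V) : Prop :=
  is_face F /\ exists2 Z, is_support F Z & is_wall Z.

Definition filter_plus (F : set_system V) (S : set V) : set_system V :=
  [set E | exists2 E', F E' & [set x + v | x in E' & v in S] `<=` E].
Definition filter_translate (F : set_system V) (u : V) : set_system V :=
  fmap (fun x => x + u) F.

Definition chimney (F : set_system V) (Fv : set V) : set_system V :=
  enclosure (filter_plus F Fv).
Definition chimney_germ (F : set_system V) (Fv : set V) : set_system V :=
  [set E | exists2 u, closure Fv u & chimney (filter_translate F u) Fv E].

Definition solid (F : set_system V) : Prop :=
  exists2 Z, is_support F Z &
    finite_set [set w | weyl w /\ forall v, direction Z v -> w v = v].

Definition is_solid_chimney (C : set_system V) : Prop :=
  exists F Fv, [/\ is_face F, is_vface Fv, C = chimney F Fv & solid C].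
Definition is_solid_chimney_germ (C : set_system V) : Prop :=
  exists F Fv, [/\ is_face F, is_vface Fv, solid (chimney F Fv)
                 & C = chimney_germ F Fv].
Definition is_splayed_chimney_germ (C : set_system V) : Prop :=
  exists F Fv, [/\ is_face F, is_vface Fv, spherical Fv
                 & C = chimney_germ F Fv].

Definition sector_face_germ (x : V) (Fv : set V) : set_system V :=
  [set E | exists2 u, closure Fv u & [set x + u + v | v in Fv] `<=` E].
Definition is_sector_germ (b : bool) (s : set_system V) : Prop :=
  exists x C, vchamber b C /\ s = sector_face_germ x C.
Definition sector_infty (b : bool) : set_system V :=
  sector_face_germ 0 [set sgn b v | v in fund_chamber].

(* The filters to which (MA2) applies. *)
Definition ma2_filter (F : set_system V) : Prop :=
  [\/ exists x, F = globally [set x],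
      exists x y, [/\ x <> y, tits_le x y \/ tits_le y x
                    & F = segment_germ x y],
      exists x y, [/\ x <> y, generic (y - x) & F = globally (ray x y)]
    | is_solid_chimney F].

Definition is_norm (N : V -> R) : Prop :=
  [/\ forall x, 0 <= N x, forall x, N x = 0 -> x = 0,
      forall a x, N (a *: x) = `|a| * N x
    & forall x y, N (x + y) <= N x + N y].

End Model.

(** * Masures *)

(* [charts A] is Isom^w(AA, A); charts are total maps from the model apartment
   to the set of points, with range A. *)
Record apartment_system (R : realType) (D : vectorial_data) :=
  ApartmentSystem {
  mpoint :> Type;
  apartment : set (set mpoint);
  charts : set mpoint -> set ('rV[R]_(vd_rank D) -> mpoint)
}.

Definition filter_cup (T : Type) (F F' : set_system T) : set_system T :=
  [set E `|` E' | E in F & E' in F'].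

Definition pullback (T U : Type) (f : T -> U) (F : set_system U) : set_system T :=
  [set E | F (f @` E)].

Section Masure.
Variables (R : realType) (D : vectorial_data).
Variable g : kac_moody_algebra R[i] (@vd_matrix D).
Variable M : apartment_system R D.

Local Notation V := 'rV[R]_(vd_rank D).

(* An apartment A contains a filter F on M iff A belongs to F. *)

Definition apartment_filter (P : set_system V -> Prop) (A : set M)
    (F : set_system M) : Prop :=
  exists f F0, [/\ charts A f, P F0 & F = fmap f F0].
Definition masure_filter (P : set_system V -> Prop) (F : set_system M) : Prop :=
  exists2 A, apartment A & apartment_filter P A F.

Definition enclosure_in (A : set M) (F : set_system M) : set_system M :=
  [set E | exists2 f, charts A f & enclosure g (pullback f F) (f @^-1` E)].

(* Only the restriction of phi to A matters; it is then a bijection onto A'. *)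
Definition apartment_iso (H : set (V -> V)) (A A' : set M) (phi : M -> M) : Prop :=
  forall f f', charts A f -> charts A' f' ->
    exists2 h, H h & forall v, phi (f v) = f' (h v).
Definition weyl_iso := apartment_iso (affine_weyl (R := R) (D := D)).
Definition vweyl_iso := apartment_iso (vweyl_aut (R := R) (D := D)).

Definition fixes (A : set M) (phi : M -> M) (F : set_system M) : Prop :=
  exists2 E, F E & forall x, A x -> E x -> phi x = x.

Definition ma2_premise (A A' : set M) (F : set_system M) : Prop :=
  [/\ apartment A, apartment A', apartment_filter (ma2_filter g) A F & F A'].

Definition face_or_solid_germ (F : set_system V) : Prop :=
  is_face g F \/ is_solid_chimney_germ g F.

Definition ma34_premise (Rg F : set_system M) : Prop :=
  masure_filter (is_splayed_chimney_germ g) Rg /\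
  masure_filter face_or_solid_germ F.

Definition ma4_premise (A A' : set M) (Rg F : set_system M) : Prop :=
  [/\ ma34_premise Rg F, apartment A /\ apartment A', Rg A /\ F A
    & Rg A' /\ F A'].

Record is_masure : Prop := {
  masure_cover : forall x : M, exists2 A, apartment A & A x;
  masure_MA1 : forall A : set M, apartment A ->
    exists f0 : V -> M,
      [/\ injective f0, range f0 = A
        & charts A = [set f0 \o w | w in @affine_weyl R D]];
  masure_MA2 : forall A A' F, ma2_premise A A' F ->
    enclosure_in A F (A `&` A') /\
    exists2 phi, weyl_iso A A' phi & fixes A phi (enclosure_in A F);
  masure_MA3 : forall Rg F, ma34_premise Rg F ->
    exists A : set M, [/\ apartment A, Rg A & F A];
  masure_MA4 : forall A A' Rg F, ma4_premise A A' Rg F ->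
    exists2 phi, weyl_iso A A' phi
               & fixes A phi (enclosure_in A (filter_cup Rg F));
  masure_MAO : forall (A A' : set M) f f' x y x' y',
    apartment A -> apartment A' -> charts A f -> charts A' f' ->
    f x = f' x' -> f y = f' y' -> tits_le x y ->
    f @` segment x y = f' @` segment x' y'
}.

(* P lies in the closure of C: every closure of an element of C, taken in an
   apartment containing C, belongs to P. *)
Definition in_closure (P C : set_system M) : Prop :=
  exists A f C0,
    [/\ apartment A, charts A f, is_chamber g C0, C = fmap f C0
      & forall E, C0 E -> P (f @` closure E)].

Definition thick_locally_finite : Prop :=
  forall P, masure_filter (is_panel g) P ->
    finite_set [set C | in_closure P C] /\
    (`I_3 #<= [set C | in_closure P C])%card.

Record strongly_transitive (G : groupType) (act : G -> M -> M) : Prop := {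
  st_act1 : forall x, act 1%g x = x;
  st_actM : forall a b x, act (a * b)%g x = act a (act b x);
  st_apartment : forall a A, apartment A -> apartment (act a @` A);
  st_iso : forall a A, apartment A -> vweyl_iso A (act a @` A) (act a);
  st_MA2 : forall A A' F phi, ma2_premise A A' F ->
    weyl_iso A A' phi -> fixes A phi (enclosure_in A F) ->
    exists a, forall x, A x -> act a x = phi x;
  st_MA4 : forall A A' Rg F phi, ma4_premise A A' Rg F ->
    weyl_iso A A' phi -> fixes A phi (enclosure_in A (filter_cup Rg F)) ->
    exists a, forall x, A x -> act a x = phi x
}.

(* The group induced on the model apartment, identified with the apartment
   [range iota], by its stabilizer. *)
Definition stabilizer_action (G : groupType) (act : G -> M -> M)
    (iota : V -> M) : set (V -> V) :=
  [set tau | exists2 a, act a @` range iota = range iota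
                      & forall v, act a (iota v) = iota (tau v)].

(* A masure of type AA is a building iff the vectorial Weyl group of AA is finite,
   so that this depends on M through its type only. *)
Definition is_building (_ : apartment_system R D) : Prop := finite_set (@weyl R D).

(** ** Distances *)

Definition model_iso (A : set M) (psi : V -> M) : Prop :=
  exists f h, [/\ charts A f, @vweyl_aut R D h & psi = f \o h].

(* y = x +_s u, as a relation; in a masure y does not depend on A and psi. *)
Definition sector_add (b : bool) (s : set_system M) (x : M) (u : V) (y : M) : Prop :=
  exists A psi v,
    [/\ apartment A, A x & s A] /\
    [/\ model_iso A psi, fmap psi (@sector_infty R D b) = s,
        psi v = x & y = psi (v + sgn b u)].

Definition sector_meet (b : bool) (s : set_system M) (x x' : M) : set (V * V) :=
  [set p | [/\ closure (@fund_chamber R D) p.1, closure (@fund_chamber R D) p.2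
             & exists y, sector_add b s x p.1 y /\ sector_add b s x' p.2 y]].

(* The set Theta_+ (b = true), resp. Theta_- (b = false). *)
Record theta (b : bool) := Theta {
  theta_norm : V -> R;
  theta_germ : set_system M;
  theta_normP : is_norm theta_norm;
  theta_germP : masure_filter (is_sector_germ b) theta_germ
}.

Definition theta_dist (b : bool) (th : theta b) (x x' : M) : R :=
  inf [set theta_norm th p.1 + theta_norm th p.2
      | p in sector_meet b (theta_germ th) x x'].

Definition theta_topology (b : bool) (th : theta b) : set_system M :=
  [set O | forall x, O x ->
     exists2 e, 0 < e & forall y, theta_dist th x y < e -> O y].

End Masure.

(* Main.v *)
Require Import Defs.
From HB Require Import structures.
From mathcomp Require Import all_boot all_order all_algebra.
From mathcomp Require Import complex.
From mathcomp Require Import all_classical all_reals topology normedtype derive.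
From mathcomp Require Import ring lra zify.

Set Implicit Arguments.
Unset Strict Implicit.
Unset Printing Implicit Defensive.

Import Order.TTheory GRing.Theory Num.Theory.
Import numFieldNormedType.Exports.

Local Open Scope classical_set_scope.
Local Open Scope ring_scope.

(* Since the Weyl group is infinite, there are real roots alpha of arbitrarily
   large height.  Put the two sector-germs in one apartment A, with chart f, so
   that s_+ is the germ of the directions C and s_- that of the directions - w C;
   alpha can be chosen positive on both C and w C.  By thickness A branches along
   the wall alpha = 1: there are apartments with charts b and e such that b = f
   where alpha >= 1, e = f where alpha <= 1, and b(0) = e(alpha^vee).  From
   x = f(0) and x' = b(0) the translations by rho / alpha(rho) towards s_+ lead
   to the same point of the wall, so x' tends to x for T_+ as alpha(rho) grows.
   The retraction onto A centred at s_- is 1-Lipschitz for d_-, fixes x and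
   sends x' to f(alpha^vee), which is a nonzero lattice translate of x; hence x'
   stays away from x for T_-. *)

(** * Weights of Kac-Moody algebras *)

(** The wall alpha = 1 misses 0, and its reflection moves 0 by alpha^vee, a nonzero lattice vector
    that no choice of alpha makes small, while the step from 0 to the wall along rho has length of
    order 1 / alpha(rho). Positivity of alpha on C puts a subsector towards s_+ into alpha >= 1,
    where b = f; positivity on w C puts one towards s_- into alpha <= 1, where e = f. The main
    obstacle is that enclosures and faces are cut out by all roots, imaginary ones included:
    belonging to a face can involve infinitely many half-spaces, so the chambers at a panel cannot
    be recognised by local finiteness. What replaces it are properties of the root set: the
    coefficients of a root have one sign, roots are stable under W and under opposition, and the
    only multiples of alpha_i among them are alpha_i and its opposite. The algebra is given only
    through generation and the absence of ideals, so these properties are derived from there. *)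

Lemma pairingD (K : nzRingType) n (a : 'cV[K]_n) u v :
  pairing a (u + v) = pairing a u + pairing a v.
Proof. by rewrite /pairing mulmxDl mxE. Qed.

Lemma pairingN (K : nzRingType) n (a : 'cV[K]_n) v : pairing a (- v) = - pairing a v.
Proof. by rewrite /pairing mulNmx mxE. Qed.

Lemma pairingB (K : nzRingType) n (a : 'cV[K]_n) u v :
  pairing a (u - v) = pairing a u - pairing a v.
Proof. by rewrite pairingD pairingN. Qed.

Lemma pairingZ (K : nzRingType) n (a : 'cV[K]_n) k v : pairing a (k *: v) = k * pairing a v.
Proof. by rewrite /pairing -scalemxAl mxE. Qed.

Lemma pairing0 (K : nzRingType) n (a : 'cV[K]_n) : pairing a 0 = 0.
Proof. by rewrite /pairing mul0mx mxE. Qed.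

Lemma pairing_sum (K : nzRingType) n (a : 'cV[K]_n) (J : finType) (F : J -> 'rV[K]_n) :
  pairing a (\sum_i F i) = \sum_i pairing a (F i).
Proof. by rewrite /pairing mulmx_suml summxE. Qed.

Lemma pairing_suml (K : comNzRingType) n (J : finType) (b : J -> K) (F : J -> 'cV[K]_n) v :
  pairing (\sum_i b i *: F i) v = \sum_i b i * pairing (F i) v.
Proof.
rewrite /pairing mulmx_sumr summxE; apply: eq_bigr => i _.
by rewrite -scalemxAr mxE.
Qed.

Lemma linear_map0 (K : nzRingType) (E E' : lmodType K) (phi : E -> E') :
  linear phi -> phi 0 = 0.
Proof. by move=> lin; have := lin (-1) 0 0; rewrite scaler0 addr0 scaleN1r addNr. Qed.

(** * Linear spans without finite bases *)

Section Span.
Variables (K : fieldType) (E : lmodType K).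

(** Inductive because the algebra may be infinite-dimensional: a linear property of the span is
    proved by induction on a finite combination. *)
Inductive lin_span (B : E -> Prop) : E -> Prop :=
| span_zero : lin_span B 0
| span_comb a x y : B x -> lin_span B y -> lin_span B (a *: x + y).

Lemma span_in (B : E -> Prop) x : B x -> lin_span B x.
Proof. by move=> Bx; rewrite -[x]scale1r -[_ *: x]addr0; apply: span_comb => //; exact: span_zero. Qed.

Lemma span_lin (B : E -> Prop) a x y : lin_span B x -> lin_span B y -> lin_span B (a *: x + y).
Proof.
elim=> [|b u v Bu _ IH] Sy; first by rewrite scaler0 add0r.
by rewrite scalerDr scalerA -addrA; apply: span_comb => //; exact: IH.
Qed.

Lemma spanD (B : E -> Prop) x y : lin_span B x -> lin_span B y -> lin_span B (x + y).
Proof. by move=> Sx Sy; rewrite -[x]scale1r; exact: span_lin. Qed.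

Lemma spanZ (B : E -> Prop) a x : lin_span B x -> lin_span B (a *: x).
Proof. by move=> Sx; rewrite -[_ *: x]addr0; apply: span_lin => //; exact: span_zero. Qed.

Lemma span_sub (B : E -> Prop) (S : set E) :
  lin_subspace S -> (forall x, B x -> S x) -> forall x, lin_span B x -> S x.
Proof. by case=> S0 SL BS x; elim=> // a u v Bu _ Sv; apply: SL => //; exact: BS. Qed.

Lemma span_map (B B' : E -> Prop) (phi : E -> E) :
  linear phi -> (forall x, B x -> lin_span B' (phi x)) ->
  forall x, lin_span B x -> lin_span B' (phi x).
Proof.
move=> lin BB' x; elim=> [|a u v Bu _ IH]; last by rewrite lin; apply: span_lin => //; exact: BB'.
rewrite linear_map0 //; exact: span_zero.
Qed.

End Span.

(* The relations of a Kac-Moody algebra without the generation and maximality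
   axioms, so that products of such algebras are instances. *)
Record chevalley_algebra (K : fieldType) (I : finType) (c : I -> I -> int) (d : nat) :=
  ChevalleyAlgebra {
  ch_alg :> lmodType K;
  br : ch_alg -> ch_alg -> ch_alg;
  br_linl : forall y, linear (fun x => br x y);
  br_linr : forall x, linear (br x);
  br_alt : forall x, br x x = 0;
  br_jacobi : forall x y z, br x (br y z) + br y (br z x) + br z (br x y) = 0;
  ch_root : I -> 'cV[K]_d;
  ch_coroot : I -> 'rV[K]_d;
  ch_root_free : lin_indep ch_root;
  ch_pairing : forall i j, pairing (ch_root j) (ch_coroot i) = (c i j)%:~R;
  ch_cartan : 'rV[K]_d -> ch_alg;
  ch_cartan_linear : linear ch_cartan;
  ch_e : I -> ch_alg;
  ch_f : I -> ch_alg;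
  ch_abelian : forall h h', br (ch_cartan h) (ch_cartan h') = 0;
  ch_ef : forall i j, br (ch_e i) (ch_f j) = if i == j then ch_cartan (ch_coroot i) else 0;
  ch_he : forall h i, br (ch_cartan h) (ch_e i) = pairing (ch_root i) h *: ch_e i;
  ch_hf : forall h i, br (ch_cartan h) (ch_f i) = - (pairing (ch_root i) h *: ch_f i)
}.

(** * Weight vectors and the triangular decomposition *)

Section Weights.
Variables (K : numFieldType) (I : finType) (c : I -> I -> int) (d : nat).
Variable L : chevalley_algebra K c d.
Local Notation cartan := (@ch_cartan _ _ _ _ L).
Local Notation br := (@br _ _ _ _ L).

Lemma brDl x y z : br (x + y) z = br x z + br y z.
Proof. by have := br_linl z 1 x y; rewrite !scale1r. Qed.
Lemma brDr x y z : br z (x + y) = br z x + br z y.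
Proof. by have := br_linr z 1 x y; rewrite !scale1r. Qed.
Lemma br0l z : br 0 z = 0.
Proof. by apply: (@addrI _ (br 0 z)); rewrite -brDl !addr0. Qed.
Lemma br0r z : br z 0 = 0.
Proof. by apply: (@addrI _ (br z 0)); rewrite -brDr !addr0. Qed.
Lemma brZl a x z : br (a *: x) z = a *: br x z.
Proof. by have := br_linl z a x 0; rewrite !addr0 br0l addr0. Qed.
Lemma brZr a x z : br z (a *: x) = a *: br z x.
Proof. by have := br_linr z a x 0; rewrite !addr0 br0r addr0. Qed.
Lemma brNl x z : br (- x) z = - br x z.
Proof. by rewrite -scaleN1r brZl scaleN1r. Qed.
Lemma brNr x z : br z (- x) = - br z x.
Proof. by rewrite -scaleN1r brZr scaleN1r. Qed.
Lemma brC x y : br x y = - br y x.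
Proof.
apply/eqP; rewrite -addr_eq0; apply/eqP.
by have := br_alt (x + y); rewrite brDl !brDr !br_alt add0r addr0.
Qed.
Lemma br_leibniz x y z : br x (br y z) = br (br x y) z + br y (br x z).
Proof.
have := br_jacobi x y z; rewrite (brC z (br x y)) (brC z x) brNr => /eqP.
by rewrite subr_eq0 subr_eq addrC => /eqP ->.
Qed.

Lemma cartan0 : cartan 0 = 0.
Proof. by apply: linear_map0; exact: ch_cartan_linear. Qed.
Lemma cartanZ a h : cartan (a *: h) = a *: cartan h.
Proof. by have := ch_cartan_linear L a h 0; rewrite cartan0 !addr0. Qed.
Lemma cartanD h h' : cartan (h + h') = cartan h + cartan h'.
Proof. by have := ch_cartan_linear L 1 h h'; rewrite !scale1r. Qed.

Definition weight_val (m : I -> int) (h : 'rV[K]_d) : K :=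
  \sum_i (m i)%:~R * pairing (ch_root L i) h.

Definition has_weight (m : I -> int) (x : L) : Prop :=
  forall h, br (cartan h) x = weight_val m h *: x.

Definition is_root (m : I -> int) : Prop :=
  (exists i, m i != 0) /\ exists2 x : L, x != 0 & has_weight m x.

(** Otherwise the difference is a vanishing combination of the free simple roots with integral
    coefficients, one of them nonzero in characteristic 0. *)
Lemma weight_val_sep (m m' : I -> int) : (exists i, m i != m' i) ->
  exists h, weight_val m h != weight_val m' h.
Proof.
move=> [i ne]; apply: contrapT => H.
have E h : weight_val m h = weight_val m' h.
  by apply: contrapT => /eqP ?; apply: H; exists h.
have Z : \sum_i ((m i)%:~R - (m' i)%:~R : K) *: ch_root L i = 0.
  apply/matrixP => k l; rewrite (ord1 l) [RHS]mxE.
  have := E (delta_mx 0 k); rewrite /weight_val => /eqP; rewrite -subr_eq0 -sumrB => /eqP <-.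
  rewrite summxE; apply: eq_bigr => j _.
  by rewrite mxE /pairing -rowE mxE mulrBl.
have := ch_root_free Z i; rewrite -intrB => /eqP; rewrite intr_eq0 subr_eq0 => /eqP e.
by rewrite e eqxx in ne.
Qed.

Definition kill_step (p : 'rV[K]_d * K) (z : L) : L := br (cartan p.1) z - p.2 *: z.

Definition kill (s : seq ('rV[K]_d * K)) (z : L) : L := foldr kill_step z s.

Lemma kill_step_lin p : linear (kill_step p).
Proof.
move=> a x y; rewrite /kill_step brDr brZr !scalerDr scalerN opprD !scalerA.
by rewrite [p.2 * a]mulrC -!addrA; congr (_ + _); rewrite addrCA.
Qed.

Lemma kill_lin s : linear (kill s).
Proof.
elim: s => // p s IH a x y.
by rewrite -[LHS]/(kill_step p (kill s (a *: x + y))) IH kill_step_lin.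
Qed.

Lemma kill0 s : kill s 0 = 0.
Proof. exact/linear_map0/kill_lin. Qed.

Lemma kill_stepC p q z : kill_step p (kill_step q z) = kill_step q (kill_step p z).
Proof.
rewrite /kill_step !brDr !brNr !brZr !scalerDr !scalerN.
have -> : br (cartan p.1) (br (cartan q.1) z) = br (cartan q.1) (br (cartan p.1) z).
  by rewrite br_leibniz ch_abelian br0l add0r.
rewrite -!addrA; congr (_ + _); rewrite !opprD !opprK !scalerA [p.2 * q.2]mulrC.
by rewrite addrCA.
Qed.

Lemma kill_step_kill p s z : kill_step p (kill s z) = kill s (kill_step p z).
Proof.
elim: s => // q s IH.
by rewrite -[LHS]/(kill_step p (kill_step q (kill s z))) kill_stepC IH.
Qed.

Lemma killC s t z : kill s (kill t z) = kill t (kill s z).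
Proof.
elim: s => // p s IH.
by rewrite -[LHS]/(kill_step p (kill s (kill t z))) IH kill_step_kill.
Qed.

(* Sums of weight vectors of weights other than [m] are annihilated by a
   product of operators [ad h - a] acting invertibly on the weight space of [m]. *)
Definition off_weight (m : I -> int) (x : L) : Prop :=
  exists s, all (fun p => weight_val m p.1 != p.2) s /\ kill s x = 0.

Lemma off_weight_subspace m : lin_subspace (off_weight m).
Proof.
split=> [|a x y [s [sm sx]] [t [tm ty]]]; first by exists [::].
exists (s ++ t); rewrite all_cat sm tm; split=> //.
have -> z : kill (s ++ t) z = kill s (kill t z) by rewrite /kill foldr_cat.
by rewrite !kill_lin ty kill0 addr0 killC sx kill0 scaler0.
Qed.

Lemma has_weight_off m m' x : has_weight m' x -> (exists i, m' i != m i) -> off_weight m x.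
Proof.
move=> wx ne; have [h hne] := weight_val_sep ne.
exists [:: (h, weight_val m' h)]; rewrite /= andbT eq_sym hne; split=> //.
by rewrite /kill_step /= wx subrr.
Qed.

Lemma off_weight_eq0 m x : has_weight m x -> off_weight m x -> x = 0.
Proof.
move=> wx [s [sm sx]].
have : exists2 b, b != 0 & kill s x = b *: x.
  elim: s sm {sx} => [|p s IH] /=; first by exists 1; rewrite ?oner_eq0 ?scale1r.
  case/andP=> pm /IH[b b0 ->]; exists ((weight_val m p.1 - p.2) * b).
    by rewrite mulf_neq0 // subr_eq0.
  by rewrite /kill_step brZr wx !scalerA -scalerBl mulrBl [b * _]mulrC.
by move=> [b b0 e]; move/eqP: sx; rewrite e scaler_eq0 (negPf b0) => /eqP.
Qed.

Lemma has_weight_lin m : lin_subspace (has_weight m).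
Proof.
split=> [h|a x y wx wy h]; first by rewrite br0r scaler0.
by rewrite brDr brZr wx wy scalerDr !scalerA mulrC.
Qed.

Lemma weight_valD m m' h :
  weight_val (fun k => m k + m' k) h = weight_val m h + weight_val m' h.
Proof. by rewrite /weight_val -big_split; apply: eq_bigr => i _; rewrite intrD mulrDl. Qed.

Lemma weight_valN m h : weight_val (fun k => - m k) h = - weight_val m h.
Proof. by rewrite /weight_val -sumrN; apply: eq_bigr => i _; rewrite intrN mulNr. Qed.

Lemma weight_val_delta i n h :
  weight_val (fun k => n * (k == i)%:Z) h = n%:~R * pairing (ch_root L i) h.
Proof.
rewrite /weight_val (bigD1 i) //= eqxx mulr1 big1 ?addr0 // => j /negPf ->.
by rewrite mulr0 mul0r.
Qed.

Lemma has_weight_br m m' x y : has_weight m x -> has_weight m' y ->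
  has_weight (fun k => m k + m' k) (br x y).
Proof.
by move=> wx wy h; rewrite br_leibniz wx wy brZl brZr -scalerDl weight_valD.
Qed.

Lemma has_weight_ext m m' x : m =1 m' -> has_weight m x -> has_weight m' x.
Proof. by move=> /funext ->. Qed.

Lemma has_weight_e i : has_weight (fun k => (k == i)%:Z) (ch_e L i).
Proof.
move=> h; rewrite ch_he; have := weight_val_delta i 1 h; rewrite mul1r => <-.
by congr (weight_val _ _ *: _); apply/funext => k; rewrite mul1r.
Qed.

Lemma has_weight_f i : has_weight (fun k => - (k == i)%:Z) (ch_f L i).
Proof.
move=> h; rewrite ch_hf weight_valN scaleNr; have := weight_val_delta i 1 h; rewrite mul1r => <-.
by congr (- (weight_val _ _ *: _)); apply/funext => k; rewrite mul1r.
Qed.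

Lemma has_weight_cartan h : has_weight (fun=> 0) (cartan h).
Proof.
by move=> h'; rewrite ch_abelian /weight_val big1 ?scale0r // => i _; rewrite mul0r.
Qed.

Lemma weight_val_coroot m i :
  weight_val m (ch_coroot L i) = (\sum_j m j * c i j)%:~R.
Proof.
rewrite /weight_val rmorph_sum /=; apply: eq_bigr => j _.
by rewrite ch_pairing intrM.
Qed.

(** Right-normed brackets [e_i1, [e_i2, ...]] with their multidegree. They suffice to span the
    algebra, because ad of a bracket is a commutator of the ad of its factors ([br_triangular]). *)
Inductive mono (e : I -> L) : (I -> int) -> L -> Prop :=
| mono1 i : mono e (fun k => (k == i)%:Z) (e i)
| monoS i m x : mono e m x -> mono e (fun k => (k == i)%:Z + m k) (br (e i) x).

Lemma mono_pos e m x : mono e m x -> (forall i, 0 <= m i) /\ exists i, m i != 0.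
Proof.
elim=> [i|i {}m {}x _ [IH1 [j mj]]].
  by split; [move=> j; case: eqP | exists i; rewrite eqxx].
split=> [j'|]; first by apply: addr_ge0 => //; case: eqP.
by exists j; have := IH1 j; case: (j == i) => /=; move/eqP: mj; lia.
Qed.

(** With a single index available, the innermost bracket of a longer monomial is [e_i, e_i] = 0.
    This is why alpha_i and its opposite are the only multiples of alpha_i that are roots. *)
Lemma mono_single e i m x : mono e m x -> (forall k, k != i -> m k = 0) ->
  (m i = 1 /\ x = e i) \/ x = 0.
Proof.
elim=> [j|j {}m {}x mx IH] H.
  have [ji|ji] := eqVneq j i; first by left; rewrite ji.
  by have := H _ ji; rewrite /= eqxx.
have [pm [k mk]] := mono_pos mx.
have mz : forall k, k != i -> m k = 0.
  by move=> l li; have := H _ li => /=; have := pm l; case: (l == j) => /=; lia.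
have ji : j = i.
  apply: contrapT => /eqP ji; have := H _ ji; have := pm j.
  by rewrite /= eqxx; lia.
right; case: (IH mz) => [[_ ->]|->]; last by rewrite br0r.
by rewrite ji br_alt.
Qed.

Lemma mono_weight_e m x : mono (ch_e L) m x -> has_weight m x.
Proof.
elim=> [i|i {}m {}x _ IH]; first exact: has_weight_e.
exact: has_weight_br (has_weight_e i) IH.
Qed.

Lemma mono_weight_f m x : mono (ch_f L) m x -> has_weight (fun k => - m k) x.
Proof.
elim=> [i|i {}m {}x _ IH]; first exact: has_weight_f.
apply: has_weight_ext (has_weight_br (has_weight_f i) IH) => k.
by rewrite opprD.
Qed.

Definition triangular_basis (x : L) : Prop :=
  [\/ exists m, mono (ch_e L) m x, exists h, x = cartan h | exists m, mono (ch_f L) m x].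

Definition nonpositive_basis (x : L) : Prop :=
  (exists h, x = cartan h) \/ exists m, mono (ch_f L) m x.

Lemma br_f_nonpositive i x : lin_span nonpositive_basis x -> lin_span nonpositive_basis (br (ch_f L i) x).
Proof.
apply: span_map; first exact: br_linr.
move=> y [[h ->]|[m my]].
  rewrite brC ch_hf opprK; apply: spanZ; apply: span_in; right.
  by exists (fun k => (k == i)%:Z); exact: mono1.
by apply: span_in; right; exists (fun k => (k == i)%:Z + m k); exact: monoS.
Qed.

(** By the Leibniz rule, ad e_i meets one factor f_j at a time and turns it into 0 or a Cartan
    element, which acts on the rest of the monomial by a scalar. *)
Lemma br_e_mono_f i m x : mono (ch_f L) m x -> lin_span nonpositive_basis (br (ch_e L i) x).
Proof.
have Hc h : lin_span nonpositive_basis (cartan h) by apply: span_in; left; exists h.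
elim=> [j|j {}m {}x mx IH].
  by rewrite ch_ef; case: eqP => // _; exact: span_zero.
rewrite br_leibniz; apply: spanD; last exact: br_f_nonpositive.
rewrite ch_ef; case: eqP => // _; last by rewrite br0l; exact: span_zero.
by rewrite (mono_weight_f mx); apply: spanZ; apply: span_in; right; exists m.
Qed.

Lemma br_e_triangular i x : lin_span triangular_basis x -> lin_span triangular_basis (br (ch_e L i) x).
Proof.
apply: span_map; first exact: br_linr.
have sub y : nonpositive_basis y -> triangular_basis y by case; [constructor 2|constructor 3].
move=> y [[m my]|[h ->]|[m my]].
- by apply: span_in; constructor 1; exists (fun k => (k == i)%:Z + m k); exact: monoS.
- rewrite brC ch_he -scaleNr; apply: spanZ; apply: span_in; constructor 1.
  by exists (fun k => (k == i)%:Z); exact: mono1.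
- have := br_e_mono_f i my; apply: span_sub.
    by split=> [|a u v]; [exact: span_zero | exact: span_lin].
  by move=> z /sub; exact: span_in.
Qed.

End Weights.

(** * The opposite algebra and consequences of the triangular decomposition *)

Section Opposite.
Variables (K : numFieldType) (I : finType) (c : I -> I -> int) (d : nat).

Lemma op_cartan_linear (L : chevalley_algebra K c d) :
  linear (fun h : 'rV[K]_d => ch_cartan L (- h)).
Proof. by move=> a h h'; rewrite opprD -scalerN ch_cartan_linear. Qed.

Lemma op_ef (L : chevalley_algebra K c d) i j :
  br (ch_f L i) (ch_e L j) = if i == j then ch_cartan L (- ch_coroot L i) else 0.
Proof.
rewrite brC ch_ef eq_sym; case: eqP => [->|]; last by rewrite oppr0.
by rewrite -[in RHS]scaleN1r cartanZ scaleN1r.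
Qed.

Lemma op_he (L : chevalley_algebra K c d) h i :
  br (ch_cartan L (- h)) (ch_f L i) = pairing (ch_root L i) h *: ch_f L i.
Proof. by rewrite ch_hf pairingN scaleNr opprK. Qed.

Lemma op_hf (L : chevalley_algebra K c d) h i :
  br (ch_cartan L (- h)) (ch_e L i) = - (pairing (ch_root L i) h *: ch_e L i).
Proof. by rewrite ch_he pairingN scaleNr. Qed.

(* Exchanging the [e_i] and the [f_i] turns the weight [m] into [- m]. *)
Definition opposite (L : chevalley_algebra K c d) : chevalley_algebra K c d :=
  @ChevalleyAlgebra K I c d (ch_alg L) (@br _ _ _ _ L) (@br_linl _ _ _ _ L) (@br_linr _ _ _ _ L)
   (@br_alt _ _ _ _ L) (@br_jacobi _ _ _ _ L) (ch_root L) (ch_coroot L) (@ch_root_free _ _ _ _ L)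
   (@ch_pairing _ _ _ _ L) (fun h => ch_cartan L (- h)) (op_cartan_linear L) (ch_f L) (ch_e L)
   (fun h h' => ch_abelian L (- h) (- h')) (op_ef L) (op_he L) (op_hf L).

Variable L : chevalley_algebra K c d.

Lemma has_weight_op m x : @has_weight _ _ _ _ L m x -> @has_weight _ _ _ _ (opposite L) (fun k => - m k) x.
Proof.
move=> wx h; change (br (ch_cartan L (- h)) x = weight_val L (fun k => - m k) h *: x).
rewrite wx weight_valN; congr (_ *: _).
by rewrite /weight_val -sumrN; apply: eq_bigr => i _; rewrite pairingN mulrN.
Qed.

Lemma has_weight_opK m x : @has_weight _ _ _ _ (opposite L) m x -> @has_weight _ _ _ _ L (fun k => - m k) x.
Proof.
move=> wx h; have := wx (- h); rewrite /= opprK => ->; congr (_ *: _).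
rewrite weight_valN /weight_val -sumrN; apply: eq_bigr => i _.
by rewrite pairingN mulrN.
Qed.

Lemma triangular_basis_op x : triangular_basis (L := opposite L) x -> triangular_basis (L := L) x.
Proof.
have E e m y : mono (L := opposite L) e m y -> mono (L := L) e m y.
  by elim=> [i|i {}m {}y _ IH]; [exact: mono1 | exact: monoS].
case=> [[m /E my]|[h ->]|[m /E my]]; [constructor 3|constructor 2|constructor 1].
- by exists m.
- by exists (- h).
- by exists m.
Qed.

Lemma triangular_basis_opK x : triangular_basis (L := L) x -> triangular_basis (L := opposite L) x.
Proof.
have E e m y : mono (L := L) e m y -> mono (L := opposite L) e m y.
  by elim=> [i|i {}m {}y _ IH]; [exact: (@mono1 _ _ _ _ (opposite L)) | exact: (@monoS _ _ _ _ (opposite L))].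
case=> [[m /E my]|[h ->]|[m /E my]]; [constructor 3|constructor 2|constructor 1].
- by exists m.
- by exists (- h) => /=; rewrite opprK.
- by exists m.
Qed.

Lemma br_f_triangular i (x : L) :
  lin_span (@triangular_basis _ _ _ _ L) x -> lin_span (@triangular_basis _ _ _ _ L) (br (ch_f L i) x).
Proof.
have lin (S : L -> Prop) : lin_subspace (lin_span S) by split=> [|a u v]; [exact: span_zero | exact: span_lin].
move=> Sx; have Sx' : lin_span (@triangular_basis _ _ _ _ (opposite L)) x.
  by move: Sx; apply: span_sub => // z /triangular_basis_opK; exact: span_in.
have := br_e_triangular (L := opposite L) i Sx'.
by apply: span_sub => // z /triangular_basis_op; exact: span_in.
Qed.

(** By the Jacobi identity, the x for which ad x preserves the span form a subalgebra, so generators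
    suffice; Cartan elements preserve it because the spanning family consists of weight vectors. *)
Lemma br_triangular (x y : L) : lin_span (@triangular_basis _ _ _ _ L) x ->
  lin_span (@triangular_basis _ _ _ _ L) y -> lin_span (@triangular_basis _ _ _ _ L) (br x y).
Proof.
move=> Sx; move: x Sx y; set S := lin_span _.
have SL : lin_subspace S by split=> [|a u v]; [exact: span_zero | exact: span_lin].
pose N : set L := [set x | forall y, S y -> S (br x y)].
have NL : lin_subspace N.
  split=> [y _|a u v Nu Nv y Sy]; first by rewrite br0l; exact: span_zero.
  by rewrite brDl brZl; apply: span_lin; [exact: Nu | exact: Nv].
have NB u v : N u -> N v -> N (br u v).
  move=> Nu Nv y Sy; have -> : br (br u v) y = (-1) *: br v (br u y) + br u (br v y).
    by rewrite (br_leibniz u v y) scaleN1r addrC addrK.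
  by apply: span_lin; [apply: Nv; exact: Nu | apply: Nu; exact: Nv].
have Nmono e m x : (forall i, N (e i)) -> mono (L := L) e m x -> N x.
  by move=> Ne; elim=> // i {}m {}x _; apply: NB.
apply: span_sub => // x [[m mx]|[h ->]|[m mx]].
- by apply: (Nmono _ _ _ _ mx) => i y; exact: br_e_triangular.
- apply: span_map; first exact: br_linr.
  move=> y By; have [m' wy] : exists m', has_weight m' y.
    case: By => [[m /mono_weight_e wy]|[h' ->]|[m /mono_weight_f wy]].
    + by exists m.
    + by exists (fun=> 0); exact: has_weight_cartan.
    + by exists (fun k => - m k).
  by rewrite wy; apply: spanZ; exact: span_in.
- by apply: (Nmono _ _ _ _ mx) => i y; exact: br_f_triangular.
Qed.

(** Monomials have nonzero weight, so x is a Cartan element up to an [off_weight] part, and this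
    part is itself of weight 0. The lemma is aimed at the product algebra in [root_opp]. *)
Lemma triangular_weight0 (x : L) : lin_span (@triangular_basis _ _ _ _ L) x ->
  has_weight (L := L) (fun=> 0) x -> exists h, x = ch_cartan L h.
Proof.
move=> Sx wx.
have [h [y [xE oy]]] : exists h y, x = ch_cartan L h + y /\ off_weight (L := L) (fun=> 0) y.
  have [O0 OL] := off_weight_subspace L (fun=> 0).
  move: x Sx {wx}; apply: span_sub.
    split=> [|a u v [h [y [-> oy]]] [h' [y' [-> oy']]]].
      by exists 0, 0; rewrite addr0 cartan0.
    exists (a *: h + h'), (a *: y + y'); rewrite cartanD cartanZ scalerDr addrACA; split=> //.
    exact: OL.
  move=> x [[m mx]|[h ->]|[m mx]].
  - exists 0, x; rewrite cartan0 add0r; split=> //.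
    by apply: has_weight_off (mono_weight_e mx) (mono_pos mx).2.
  - by exists h, 0; rewrite addr0.
  - exists 0, x; rewrite cartan0 add0r; split=> //.
    apply: has_weight_off (mono_weight_f mx) _.
    by have [_ [i mi]] := mono_pos mx; exists i; rewrite oppr_eq0.
exists h; rewrite xE -[RHS]addr0; congr (_ + _).
apply: off_weight_eq0 oy.
have -> : y = (-1) *: ch_cartan L h + x by rewrite xE scaleN1r addKr.
by apply: (has_weight_lin L _).2 => //; exact: has_weight_cartan.
Qed.

Lemma triangular_weight_sign m (x : L) : lin_span (@triangular_basis _ _ _ _ L) x ->
  has_weight (L := L) m x -> x != 0 ->
  (forall i, 0 <= m i) \/ (forall i, m i <= 0).
Proof.
move=> Sx wx x0; apply: contrapT => /not_orP[] /existsNP[i ip] /existsNP[j jn].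
move/eqP: x0; apply; apply: off_weight_eq0 wx _.
move: x Sx; apply: span_sub; first exact: off_weight_subspace.
move=> x [[m' mx]|[h ->]|[m' mx]].
- apply: has_weight_off (mono_weight_e mx) _; exists i; apply/eqP => e.
  by have := (mono_pos mx).1 i; rewrite e.
- by apply: (has_weight_off (has_weight_cartan L h)); exists i; apply/eqP => e; apply: ip; rewrite -e.
- apply: has_weight_off (mono_weight_f mx) _; exists j; apply/eqP => e.
  by have := (mono_pos mx).1 j; rewrite -oppr_le0 e.
Qed.

Lemma triangular_weight_single m i (x : L) : lin_span (@triangular_basis _ _ _ _ L) x ->
  has_weight (L := L) m x -> x != 0 -> (forall k, k != i -> m k = 0) ->
  [\/ m i = 0, m i = 1 | m i = -1].
Proof.
move=> Sx wx x0 mz; apply: contrapT => ni.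
have [n0 n1 n2] : [/\ m i <> 0, m i <> 1 & m i <> -1].
  by split=> e; apply: ni; [constructor 1|constructor 2|constructor 3].
move/eqP: x0; apply; apply: off_weight_eq0 wx _.
have [O0 OL] := off_weight_subspace L m.
have dec (m1 : I -> int) : m1 =1 m \/ exists k, m1 k != m k.
  have [|/existsNP[k /eqP e]] := pselect (m1 =1 m); [by left|by right; exists k].
move: x Sx; apply: span_sub; first exact: off_weight_subspace.
move=> x [[m' mx]|[h ->]|[m' mx]].
- have [e|e] := dec m'; last exact: has_weight_off (mono_weight_e mx) e.
  case: (@mono_single _ _ _ _ _ _ i _ _ mx) => [k ki|[]|-> //]; first by rewrite e mz.
  by rewrite e => /n1.
- apply: (has_weight_off (has_weight_cartan L h)); exists i; apply/eqP => e; exact: n0.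
- have [e|e] := dec (fun k => - m' k); last exact: has_weight_off (mono_weight_f mx) e.
  case: (@mono_single _ _ _ _ _ _ i _ _ mx) => [k ki|[m1 _]|-> //].
    by apply/eqP; rewrite -oppr_eq0 e mz.
  by case: n2; rewrite -e m1.
Qed.

End Opposite.

(** * The product algebra that carries the graph of the Chevalley involution *)

Section Double.
Variables (K : numFieldType) (I : finType) (c : I -> I -> int) (d : nat).
Variable L : chevalley_algebra K c d.
Let T : lmodType K := (ch_alg L * ch_alg L)%type.
Let dbr (x y : T) : T := (br x.1 y.1, br x.2 y.2).
Let dcartan (h : 'rV[K]_d) : T := (ch_cartan L h, ch_cartan L (- h)).

Fact dbr_linl y : linear (fun x => dbr x y).
Proof. by move=> a u v; rewrite /dbr /= !br_linl. Qed.
Fact dbr_linr x : linear (dbr x).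
Proof. by move=> a u v; rewrite /dbr /= !br_linr. Qed.
Fact dbr_alt x : dbr x x = 0.
Proof. by rewrite /dbr !br_alt. Qed.
Fact dbr_jacobi x y z : dbr x (dbr y z) + dbr y (dbr z x) + dbr z (dbr x y) = 0.
Proof. by apply/pair_equal_spec; split; exact: br_jacobi. Qed.
Fact dcartan_linear : linear dcartan.
Proof. by move=> a h h'; apply/pair_equal_spec; split; [exact: ch_cartan_linear | exact: op_cartan_linear]. Qed.
Fact dcartan_abelian h h' : dbr (dcartan h) (dcartan h') = 0.
Proof. by rewrite /dbr /= !ch_abelian. Qed.
Fact d_ef i j : dbr (ch_e L i, ch_f L i) (ch_f L j, ch_e L j) = if i == j then dcartan (ch_coroot L i) else 0.
Proof. by rewrite /dbr /= ch_ef op_ef; case: eqP. Qed.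
Fact d_he h i : dbr (dcartan h) (ch_e L i, ch_f L i) = pairing (ch_root L i) h *: ((ch_e L i, ch_f L i) : T).
Proof. by rewrite /dbr /= ch_he op_he. Qed.
Fact d_hf h i : dbr (dcartan h) (ch_f L i, ch_e L i) = - (pairing (ch_root L i) h *: ((ch_f L i, ch_e L i) : T)).
Proof. by rewrite /dbr /= ch_hf op_hf. Qed.

Definition double_algebra : chevalley_algebra K c d :=
  @ChevalleyAlgebra K I c d T dbr dbr_linl dbr_linr dbr_alt dbr_jacobi
   (ch_root L) (ch_coroot L) (@ch_root_free _ _ _ _ L) (@ch_pairing _ _ _ _ L)
   dcartan dcartan_linear (fun i => (ch_e L i, ch_f L i)) (fun i => (ch_f L i, ch_e L i))
   dcartan_abelian d_ef d_he d_hf.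
End Double.

(** * Signs of roots and lowest weight vectors *)

Section KacMoody.
Variables (K : numFieldType) (I : finType) (c : I -> I -> int).
Hypothesis cP : kac_moody_matrix c.
Local Notation d := (realization_dim K c).

Definition chevalley_of (g : kac_moody_algebra K c) : chevalley_algebra K c d :=
  @ChevalleyAlgebra K I c d (km_alg g) (@km_bracket _ _ _ g) (@km_bracket_linear_l _ _ _ g)
   (@km_bracket_linear_r _ _ _ g) (@km_bracket_alt _ _ _ g) (@km_jacobi _ _ _ g)
   (km_root g) (km_coroot g) (@km_root_free _ _ _ g) (@km_pairing _ _ _ g)
   (km_cartan g) (@km_cartan_linear _ _ _ g) (km_e g) (km_f g) (@km_cartan_abelian _ _ _ g)
   (@km_ef _ _ _ g) (@km_he _ _ _ g) (@km_hf _ _ _ g).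

(** The remaining axioms of a Kac-Moody algebra, detached from the structure so that they can be
    carried over to [opposite]. *)
Record reduced (L : chevalley_algebra K c d) : Prop := Reduced {
  red_gen : forall S : set L, lin_subspace S -> (forall x y, S x -> S y -> S (br x y)) ->
    (forall h, S (ch_cartan L h)) -> (forall i, S (ch_e L i)) -> (forall i, S (ch_f L i)) -> S = setT;
  red_ideal : forall J : set L, lin_subspace J -> (forall x y, J x -> J (br x y)) ->
    J `&` range (ch_cartan L) = [set 0] -> J = [set 0];
  red_inj : injective (ch_cartan L);
  red_coroot : lin_indep (ch_coroot L)
}.

Lemma reduced_of g : reduced (chevalley_of g).
Proof.
split; [exact: km_generated | exact: km_no_ideal | exact: km_cartan_inj | exact: km_coroot_free].
Qed.

Lemma reduced_op L : reduced L -> reduced (opposite L).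
Proof.
case=> gen ideal inj cor; split=> //.
- move=> S SL SB Sh Se Sf; apply: gen => // h.
  by have := Sh (- h); rewrite /= opprK.
- move=> J JL JB JH; apply: ideal => //; rewrite -JH; congr (_ `&` _).
  by apply/seteqP; split=> _ [h _ <-]; exists (- h) => //=; rewrite opprK.
- by move=> h h' /inj/oppr_inj.
Qed.

Section Reduced.
Variable L : chevalley_algebra K c d.
Hypothesis Lred : reduced L.

Lemma span_subspace (E : lmodType K) (B : E -> Prop) : lin_subspace (lin_span B).
Proof. by split=> [|a u v]; [exact: span_zero | exact: span_lin]. Qed.

Lemma triangular_top (x : L) : lin_span (@triangular_basis _ _ _ _ L) x.
Proof.
suff -> : lin_span (@triangular_basis _ _ _ _ L) = [set: L] by [].
apply: (red_gen Lred) => [|u v||i|i]; [exact: span_subspace | exact: br_triangular | | | ].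
- by move=> h; apply: span_in; constructor 2; exists h.
- by apply: span_in; constructor 1; exists (fun k => (k == i)%:Z); exact: mono1.
- by apply: span_in; constructor 3; exists (fun k => (k == i)%:Z); exact: mono1.
Qed.

Lemma root_sign m : is_root L m -> (forall i, 0 <= m i) \/ (forall i, m i <= 0).
Proof. by case=> _ [x x0 wx]; exact: triangular_weight_sign (triangular_top x) wx x0. Qed.

Lemma root_single m i : is_root L m -> (forall k, k != i -> m k = 0) -> m i = 1 \/ m i = -1.
Proof.
case=> [[j mj]] [x x0 wx] mz.
case: (triangular_weight_single (triangular_top x) wx x0 mz) => [e|->|->]; [|by left|by right].
have [ji|ji] := eqVneq j i; first by rewrite ji e in mj.
by rewrite mz // in mj.
Qed.

Lemma ideal_of_generators (J : set L) : lin_subspace J ->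
  (forall i y, J y -> J (br (ch_e L i) y)) -> (forall i y, J y -> J (br (ch_f L i) y)) ->
  (forall h y, J y -> J (br (ch_cartan L h) y)) -> forall x y, J x -> J (br x y).
Proof.
move=> JL Je Jf Jh.
have J0 : J 0 by case: JL.
have JLin := JL.2.
have JN y : J y -> J (- y) by move=> Jy; rewrite -scaleN1r -[_ *: y]addr0; exact: JLin.
suff T : [set y | forall x, J x -> J (br y x)] = [set: L].
  move=> x y Jx; rewrite brC; apply: JN.
  by have : [set: L] y by []; rewrite -T; exact.
apply: (red_gen Lred) => //.
- split=> [x _|a u v Ju Jv x Jx]; first by rewrite br0l.
  by rewrite brDl brZl; apply: JLin; [exact: Ju | exact: Jv].
- move=> u v Ju Jv x Jx.
  have -> : br (br u v) x = (-1) *: br v (br u x) + br u (br v x).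
    by rewrite (br_leibniz u v x) scaleN1r addrC addrK.
  by apply: JLin; [apply: Jv; exact: Ju | apply: Ju; exact: Jv].
Qed.

Inductive raised (x : L) (m : I -> int) : (I -> int) -> L -> Prop :=
| raised0 : raised x m m x
| raisedS i m' y : raised x m m' y ->
    raised x m (fun k => (k == i)%:Z + m' k) (br (ch_e L i) y).

(* The ideal generated by such an [x] is obtained by applying the [e_i] only,
   hence avoids the Cartan part. *)
Lemma lowest_weight_eq0 m (x : L) : has_weight m x -> (forall i, 0 <= m i) ->
  (exists i, m i != 0) -> (forall i, br (ch_f L i) x = 0) -> x = 0.
Proof.
move=> wx m0 mn fx; pose B y := exists m', raised x m m' y; pose J : set L := lin_span B.
have BW m' y : raised x m m' y -> [/\ has_weight m' y, forall i, 0 <= m' i & exists i, m' i != 0].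
  elim=> [|i {}m' {}y _ [wy p [j jn]]]; first by split.
  split=> [|k|].
  - exact: has_weight_br (has_weight_e L i) wy.
  - by apply: addr_ge0 => //; case: (k == i).
  - by exists j; have := p j; case: (j == i) => /=; move/eqP: jn; lia.
have JL : lin_subspace J by exact: span_subspace.
have Je i y : J y -> J (br (ch_e L i) y).
  apply: span_map; first exact: br_linr.
  by move=> z [m' rz]; apply: span_in; exists (fun k => (k == i)%:Z + m' k); exact: raisedS.
have Jh h y : J y -> J (br (ch_cartan L h) y).
  apply: span_map; first exact: br_linr.
  move=> z [m' rz]; have [wz _ _] := BW _ _ rz; rewrite wz; apply: spanZ; apply: span_in.
  by exists m'.
have Jf i y : J y -> J (br (ch_f L i) y).
  apply: span_map; first exact: br_linr.
  move=> z [m' rz]; elim: rz => [|j {}m' {}z rz IH]; first by rewrite fx; exact: span_zero.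
  rewrite br_leibniz; apply: spanD; last exact: Je.
  rewrite (brC (ch_f L i)) ch_ef eq_sym; case: eqP => _; last by rewrite oppr0 br0l; exact: span_zero.
  rewrite brNl -scaleN1r; apply: spanZ; apply: Jh; apply: span_in; by exists m'.
have JB : forall y z, J y -> J (br y z) by exact: ideal_of_generators.
have Joff y : J y -> off_weight (fun=> 0) y.
  apply: span_sub; first exact: off_weight_subspace.
  by move=> z [m' /BW[wz _ nz]]; exact: has_weight_off wz nz.
have JH : J `&` range (ch_cartan L) = [set 0].
  apply/seteqP; split=> [y [Jy [h _ yE]]|_ ->].
    by apply: off_weight_eq0 (Joff _ Jy); rewrite -yE; exact: has_weight_cartan.
  by split; [exact: span_zero | exists 0 => //; exact: cartan0].
have := red_ideal Lred JL JB JH => JE.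
have : J x by apply: span_in; exists m; exact: raised0.
by rewrite JE.
Qed.

(** The sl_2 computation: e^k x has weight lam + 2k on alpha_i^vee and [f_i, e_i] = - alpha_i^vee,
    so the coefficient is minus the sum of lam + 2k over k < n. *)
Lemma f_iter_e i n (lam : int) (x : L) : br (ch_f L i) x = 0 ->
  br (ch_cartan L (ch_coroot L i)) x = lam%:~R *: x ->
  br (ch_f L i) (iter n (br (ch_e L i)) x) =
    - (n%:Z * (lam + n%:Z - 1))%:~R *: iter n.-1 (br (ch_e L i)) x.
Proof.
move=> fx hx.
have c2 : c i i = 2 by case: cP.
have hn k : br (ch_cartan L (ch_coroot L i)) (iter k (br (ch_e L i)) x) =
    (lam + 2 * k%:Z)%:~R *: iter k (br (ch_e L i)) x.
  elim: k => [|k IH]; first by rewrite mulr0 addr0.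
  rewrite iterS br_leibniz ch_he ch_pairing c2 brZl IH brZr -scalerDl -intrD.
  by congr (_%:~R *: _); lia.
elim: n => [|n IH]; first by rewrite /= fx mul0r oppr0 scale0r.
rewrite iterS br_leibniz (brC (ch_f L i) (ch_e L i)) ch_ef eqxx brNl hn IH brZr.
case: n IH => [|n] IH.
  by rewrite /= mulr0 addr0 mul0r oppr0 scale0r addr0 mul1r addrK -scaleNr.
rewrite -[n.+1.-1]/n -iterS -scaleNr -scalerDl.
congr (_ *: _); rewrite -!intrN -intrD; congr (_%:~R).
rewrite -[n.+2]addn2 -[n.+1]addn1 !PoszD; ring.
Qed.
End Reduced.
End KacMoody.

Section Strings.
Variables (K : numFieldType) (I : finType) (c : I -> I -> int) (d : nat).
Variable L : chevalley_algebra K c d.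
Local Notation ad x := (br x).

Lemma iter_ad0 (x : L) n : iter n (ad x) 0 = 0.
Proof. by elim: n => //= n ->; rewrite br0r. Qed.

Lemma has_weight_iter_e i n m (x : L) : has_weight m x ->
  has_weight (fun k => m k + n%:Z * (k == i)%:Z) (iter n (ad (ch_e L i)) x).
Proof.
move=> wx; elim: n => [|n IH]; first by apply: has_weight_ext wx => k; rewrite mul0r addr0.
apply: has_weight_ext (has_weight_br (has_weight_e L i) IH) => k.
by case: (k == i) => /=; lia.
Qed.

End Strings.

(** * Serre relations, local nilpotency and root strings *)

Section Integrability.
Variables (K : numFieldType) (I : finType) (c : I -> I -> int).
Hypothesis cP : kac_moody_matrix c.
Local Notation d := (realization_dim K c).
Variable L : chevalley_algebra K c d.
Hypothesis Lred : reduced L.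
Local Notation ad x := (br x).

(** The iterated bracket is a lowest weight vector, hence 0: f_i kills it since the coefficient of
    [f_iter_e] vanishes at n = 1 - c_ij, and f_j since it replaces e_j by a Cartan element, on which
    ad e_i vanishes after two steps. *)
Lemma serre i j : i != j -> iter `|1 - c i j|%N (ad (ch_e L i)) (ch_e L j) = 0.
Proof.
move=> ij; have cij := let: And3 _ h _ := cP in h _ _ ij.
set n := `|1 - c i j|%N; have nE : n%:Z = 1 - c i j by rewrite /n; lia.
have wx := has_weight_iter_e i n (has_weight_e L j).
apply: (lowest_weight_eq0 Lred wx) => [k||k].
- by case: (k == j); case: (k == i) => /=; lia.
- by exists j; rewrite eqxx (eq_sym j i) (negPf ij) mulr0.
have [->|ki] := eqVneq k i.
  rewrite (@f_iter_e _ _ _ cP L _ _ (c i j)); last 2 first.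
  - by rewrite brC ch_ef eq_sym (negPf ij) oppr0.
  - by rewrite ch_he ch_pairing.
  rewrite nE; have ->: c i j + (1 - c i j) - 1 = 0 :> int by lia.
  by rewrite mulr0 mulr0z oppr0 scale0r.
have comm z : ad (ch_f L k) (ad (ch_e L i) z) = ad (ch_e L i) (ad (ch_f L k) z).
  by rewrite br_leibniz (brC (ch_f L k) (ch_e L i)) ch_ef eq_sym (negPf ki) oppr0 br0l add0r.
have -> : ad (ch_f L k) (iter n (ad (ch_e L i)) (ch_e L j)) =
          iter n (ad (ch_e L i)) (ad (ch_f L k) (ch_e L j)).
  by elim: (n) => //= n' <-; rewrite comm.
rewrite (brC (ch_f L k)) ch_ef eq_sym; have [kj|kj] := eqVneq k j; last by rewrite oppr0 iter_ad0.
have n0 : (0 < n)%N by lia.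
case: n n0 nE {wx comm} => // n _ nE; rewrite iterSr brNr brC opprK ch_he ch_pairing.
case: n nE => [|n] nE; last first.
  by rewrite iterSr brZr br_alt scaler0 iter_ad0.
(* A single bracket is left only if c_ij = 0; then c_ji = 0 too, and the Cartan element acts on e_i
   by 0. *)
have [_ _ /(_ i j)[h _]] := cP.
by rewrite h ?scale0r //; move: nE; lia.
Qed.

(** By the Leibniz rule, the elements killed by a power of ad e_i form a subalgebra; it contains the
    generators e_j by the Serre relations. *)
Lemma e_nilpotent i (x : L) : exists n, iter n (ad (ch_e L i)) x = 0.
Proof.
have stable n n' y : (n <= n')%N -> iter n (ad (ch_e L i)) y = 0 -> iter n' (ad (ch_e L i)) y = 0.
  by move=> /subnK <- e; rewrite iterD e iter_ad0.
have itlin n a u v : iter n (ad (ch_e L i)) (a *: u + v) =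
    a *: iter n (ad (ch_e L i)) u + iter n (ad (ch_e L i)) v.
  by elim: n => //= n ->; rewrite brDr brZr.
suff T : [set x : L | exists n, iter n (ad (ch_e L i)) x = 0] = [set: L].
  by have : [set: L] x by []; rewrite -T.
apply: (red_gen Lred) => [|u v [a ua] [b vb]|h|j|j].
- split=> [|a u v [n un] [n' vn]]; first by exists 0%N.
  exists (n + n')%N; rewrite itlin.
  have -> : iter (n + n') (ad (ch_e L i)) u = 0 by apply: (stable n _ u _ un); exact: leq_addr.
  have -> : iter (n + n') (ad (ch_e L i)) v = 0 by apply: (stable n' _ v _ vn); exact: leq_addl.
  by rewrite scaler0 addr0.
- exists (a + b)%N; move: {-2}(a + b)%N (erefl (a + b)%N) => s.
  elim: s a b u v ua vb => [|s IH] a b u v ua vb sE.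
    have a0 : a = 0%N by lia.
    by move: ua; rewrite a0 /= => ->; rewrite br0l.
  rewrite iterSr br_leibniz -[br (br _ _) _]scale1r itlin scale1r.
  case: a ua sE => [|a] ua sE.
    by move: ua => /= ->; rewrite !(br0l, br0r) iter_ad0 addr0.
  rewrite (IH a b) ?add0r; [|by rewrite -iterSr|by []|by lia].
  case: b vb sE => [|b] vb sE.
    by move: vb => /= ->; rewrite !(br0l, br0r) iter_ad0.
  by apply: (IH a.+1 b) => //; [rewrite -iterSr | lia].
- by exists 2; rewrite /= (brC _ (ch_cartan L _)) ch_he -scaleNr brZr br_alt scaler0.
- have [<-|ij] := eqVneq i j; first by exists 1%N; rewrite /= br_alt.
  by exists `|1 - c i j|%N; exact: serre.
- have [->|ij] := eqVneq i j; last by exists 1%N; rewrite /= ch_ef (negPf ij).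
  by exists 3; rewrite /= ch_ef eqxx (brC _ (ch_cartan L _)) ch_he -scaleNr brZr br_alt scaler0.
Qed.

(** The coordinates of r_i applied to the root with coordinates m. *)
Definition reflect_coord (i : I) (m : I -> int) : I -> int :=
  fun k => m k - (k == i)%:Z * \sum_j m j * c i j.

(* Climb from the weight vector to the top of its [alpha_i]-string, then
   descend to the reflected weight. *)
Lemma root_reflect_nonneg i m : is_root L m -> 0 <= \sum_j m j * c i j ->
  is_root L (reflect_coord i m).
Proof.
case=> mn [x x0 wx]; set a := \sum_j _ => a0.
have c2 : c i i = 2 by case: cP.
split.
  apply: contrapT => H; have mz k : reflect_coord i m k = 0.
    by apply: contrapT => /eqP ?; apply: H; exists k.
  have mk k : k != i -> m k = 0.
    by move=> ki; have := mz k; rewrite /reflect_coord (negPf ki) mul0r subr0.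
  have aE : a = m i * 2.
    by rewrite /a (bigD1 i) //= c2 big1 ?addr0 // => k ki; rewrite mk ?mul0r.
  have mi : m i = 0 by have := mz i; rewrite /reflect_coord eqxx mul1r -/a aE; lia.
  case: mn => k; have [->|/mk ->] := eqVneq k i; by rewrite ?mi eqxx.
have exN : exists n, iter n (ad (ch_e L i)) x == 0 by have [n e] := e_nilpotent i x; exists n; apply/eqP.
have [N /eqP NE minN] := ex_minnP exN.
have N0 : (0 < N)%N by case: N NE {minN} => //= /eqP; rewrite (negPf x0).
case: N N0 NE minN => // t _ NE minN; pose y := iter t (ad (ch_e L i)) x.
have y0 : y != 0 by apply/negP => /minN; rewrite ltnn.
have wy : has_weight (fun k => m k + t%:Z * (k == i)%:Z) y by exact: has_weight_iter_e.
pose mu := a + 2 * t%:Z.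
have muE : \sum_j (m j + t%:Z * (j == i)%:Z) * c i j = mu.
  rewrite (eq_bigr (fun j => m j * c i j + t%:Z * (j == i)%:Z * c i j)); last by move=> j _; rewrite mulrDl.
  rewrite big_split /= -/a [X in _ + X](bigD1 i) //= eqxx mulr1 c2 big1 ?addr0.
    by rewrite /mu mulrC.
  by move=> k /negPf ->; rewrite mulr0 mul0r.
(* This is [f_iter_e] in the opposite algebra, where e_i is the lowering operator, kills y, and y
   has weight - mu. *)
have step n : ad (ch_e L i) (iter n (ad (ch_f L i)) y) =
    - (n%:Z * (- mu + n%:Z - 1))%:~R *: iter n.-1 (ad (ch_f L i)) y.
  apply: (@f_iter_e _ _ _ cP (opposite L) i n (- mu) y) => /=; first by rewrite -iterS.
  by rewrite -scaleN1r cartanZ brZl wy weight_val_coroot muE scalerA mulN1r intrN.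
have z0 n : n%:Z <= mu -> iter n (ad (ch_f L i)) y != 0.
  elim: n => // n IH nmu; apply/eqP => e; have := step n.+1; rewrite e br0r => /esym/eqP.
  rewrite scaler_eq0 (negPf (IH _)) ?orbF; last by lia.
  rewrite oppr_eq0 intr_eq0 mulf_eq0 /=; lia.
(* From m + t alpha_i, a + t steps down lead to m - a alpha_i; as a + t <= mu = a + 2t, no
   coefficient vanishes on the way. *)
pose n := (`|a| + t)%N; exists (iter n (ad (ch_f L i)) y); first by apply: z0; rewrite /mu /n; lia.
have w := has_weight_opK (has_weight_iter_e (L := opposite L) i n (has_weight_op wy)).
apply: has_weight_ext w => k; rewrite /reflect_coord -/a /n.
by case: (k == i) => /=; lia.
Qed.

End Integrability.

(** * Stability of the roots under reflections and opposition *)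

Section Roots.
Variables (K : numFieldType) (I : finType) (c : I -> I -> int).
Hypothesis cP : kac_moody_matrix c.
Local Notation d := (realization_dim K c).
Variable L : chevalley_algebra K c d.
Hypothesis Lred : reduced L.

Lemma is_root_op m : is_root L m -> is_root (opposite L) (fun k => - m k).
Proof.
case=> [[i mi] [x x0 wx]]; split; first by exists i; rewrite oppr_eq0.
by exists x => //; exact: has_weight_op.
Qed.

Lemma is_root_opK m : is_root (opposite L) m -> is_root L (fun k => - m k).
Proof.
case=> [[i mi] [x x0 wx]]; split; first by exists i; rewrite oppr_eq0.
by exists x => //; exact: has_weight_opK.
Qed.

Lemma is_root_ext (L' : chevalley_algebra K c d) m m' : m =1 m' -> is_root L' m -> is_root L' m'.
Proof. by move=> /funext ->. Qed.

Lemma root_reflect i m : is_root L m -> is_root L (reflect_coord c i m).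
Proof.
move=> rm; have [a0|a0] := leP 0 (\sum_j m j * c i j).
  exact: root_reflect_nonneg.
have := @root_reflect_nonneg _ _ _ cP _ (reduced_op Lred) i _ (is_root_op rm).
have -> : \sum_j - m j * c i j = - \sum_j m j * c i j.
  by rewrite -sumrN; apply: eq_bigr => j _; rewrite mulNr.
rewrite oppr_ge0 => /(_ (ltW a0))/is_root_opK; apply: is_root_ext => k.
rewrite /reflect_coord; have -> : \sum_j - m j * c i j = - \sum_j m j * c i j.
  by rewrite -sumrN; apply: eq_bigr => j _; rewrite mulNr.
by rewrite mulrN opprK opprD opprK.
Qed.

Lemma root_simple i : is_root L (fun k => (k == i)%:Z).
Proof.
split; first by exists i; rewrite eqxx.
exists (ch_e L i); last exact: has_weight_e.
apply/eqP => e0; have := ch_ef L i i; rewrite e0 br0l eqxx.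
rewrite -(@cartan0 _ _ _ _ L) => /(red_inj Lred) cor0.
have := red_coroot Lred (a := fun k => (k == i)%:R).
rewrite (bigD1 i) //= -cor0 scaler0 big1 ?addr0; last first.
  by move=> k /negPf ->; rewrite scale0r.
by move=> /(_ erefl i); rewrite eqxx => /eqP; rewrite oner_eq0.
Qed.

(* The subalgebra of [L * L] generated by the pairs (e_i, f_i), (f_i, e_i),
   (h, -h) is the graph of the Chevalley involution. *)
Lemma root_opp m : is_root L m -> is_root L (fun k => - m k).
Proof.
pose S : set (double_algebra L) := lin_span (@triangular_basis _ _ _ _ (double_algebra L)).
have SL : lin_subspace S by exact: span_subspace.
have SB x y : S x -> S y -> S (br x y) by exact: br_triangular.
have Sh h : S (ch_cartan (double_algebra L) h) by apply: span_in; constructor 2; exists h.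
have Se i : S (ch_e (double_algebra L) i).
  by apply: span_in; constructor 1; exists (fun k => (k == i)%:Z); exact: mono1.
have Sf i : S (ch_f (double_algebra L) i).
  by apply: span_in; constructor 3; exists (fun k => (k == i)%:Z); exact: mono1.
have onto1 x : exists y, S (x, y).
  suff T : [set x : L | exists y, S (x, y)] = [set: L] by have : [set: L] x by []; rewrite -T.
  apply: (red_gen Lred) => [|u v [y Su] [z Sv]|h|i|i].
  - split=> [|a u v [y Su] [z Sv]]; first by exists 0; exact: span_zero.
    by exists (a *: y + z); exact: SL.2 Su Sv.
  - by exists (br y z); exact: SB Su Sv.
  - by exists (ch_cartan L (- h)); exact: Sh.
  - by exists (ch_f L i); exact: Se.
  - by exists (ch_e L i); exact: Sf.
have onto2 x : exists y, S (y, x).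
  suff T : [set x : L | exists y, S (y, x)] = [set: L] by have : [set: L] x by []; rewrite -T.
  apply: (red_gen Lred) => [|u v [y Su] [z Sv]|h|i|i].
  - split=> [|a u v [y Su] [z Sv]]; first by exists 0; exact: span_zero.
    by exists (a *: y + z); exact: SL.2 Su Sv.
  - by exists (br y z); exact: SB Su Sv.
  - by exists (ch_cartan L (- h)); have := Sh (- h); rewrite /= opprK.
  - by exists (ch_f L i); exact: Sf.
  - by exists (ch_e L i); exact: Se.
(* Such a p has weight 0, hence is the pair of h' and - h' for some h' by [triangular_weight0]; the
   zero component forces h' = 0. *)
have w0 (p : double_algebra L) h : S p -> p = (ch_cartan L h, 0) \/ p = (0, ch_cartan L h) -> h = 0.
  move=> Sp pE; have wp : has_weight (L := double_algebra L) (fun=> 0) p.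
    move=> h'; case: pE => ->; rewrite /weight_val big1 ?scale0r; try by move=> k _; rewrite mul0r.
      by apply/pair_equal_spec; rewrite /= ch_abelian br0r.
    by apply/pair_equal_spec; rewrite /= ch_abelian br0r.
  have [h' e] := triangular_weight0 Sp wp.
  move: e; case: pE => -> /pair_equal_spec[e1 e2].
    move: e2; rewrite -(@cartan0 _ _ _ _ L) => /(red_inj Lred)/esym/eqP; rewrite oppr_eq0 => /eqP h0.
    by move: e1; rewrite h0 => /(red_inj Lred).
  move: e1; rewrite -(@cartan0 _ _ _ _ L) => /(red_inj Lred) h0.
  by move: e2; rewrite -h0 oppr0 => /(red_inj Lred).
(* These y form an ideal because the second projection of S is onto; it avoids the Cartan part by
   [w0], so it is 0. *)
have graph1 y : S (0, y) -> y = 0.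
  suff : [set y : L | S (0, y)] = [set 0] by move=> e Sy; have : [set y : L | S (0, y)] y by []; rewrite e.
  apply: (red_ideal Lred).
  - split=> [|a u v Su Sv]; first exact: span_zero.
    by have := SL.2 a _ _ Su Sv; rewrite /= -[(a *: _ + _)%R]/(a *: 0 + 0, a *: u + v) scaler0 addr0.
  - move=> u v Su; have [z Sz] := onto2 v.
    by have := SB _ _ Su Sz; rewrite -[br _ _]/(br 0 z, br u v) br0l.
  - apply/seteqP; split=> [u [Su [h _ uE]]|_ ->].
      by have := w0 _ h Su; rewrite -uE => -> //=; [rewrite cartan0|right].
    by split; [exact: span_zero | exists 0 => //; exact: cartan0].
have graph2 y : S (y, 0) -> y = 0.
  suff : [set y : L | S (y, 0)] = [set 0] by move=> e Sy; have : [set y : L | S (y, 0)] y by []; rewrite e.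
  apply: (red_ideal Lred).
  - split=> [|a u v Su Sv]; first exact: span_zero.
    by have := SL.2 a _ _ Su Sv; rewrite /= -[(a *: _ + _)%R]/(a *: u + v, a *: 0 + 0) scaler0 addr0.
  - move=> u v Su; have [z Sz] := onto1 v.
    by have := SB _ _ Su Sz; rewrite -[br _ _]/(br u v, br 0 z) br0l.
  - apply/seteqP; split=> [u [Su [h _ uE]]|_ ->].
      by have := w0 _ h Su; rewrite -uE => -> //=; [rewrite cartan0|left].
    by split; [exact: span_zero | exists 0 => //; exact: cartan0].
case=> [mn [x x0 wx]]; have [y Sy] := onto1 x.
apply: is_root_opK; split=> //; exists y.
  by apply/eqP => y0; move/eqP: x0; apply; apply: graph2; rewrite -[in X in (_, X)]y0.
(* Acting on (x, y) and subtracting the weight kills the first component, hence the second by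
   [graph1]; so y has weight m in the opposite algebra. *)
move=> h; have S1 := SB _ _ (Sh h) Sy.
have := SL.2 (- weight_val L m h) _ _ Sy S1.
rewrite -[X in S X]/(- weight_val L m h *: x + br (ch_cartan L h) x,
                     - weight_val L m h *: y + br (ch_cartan L (- h)) y).
rewrite wx scaleNr addNr => /graph1; rewrite scaleNr addrC => /eqP.
by rewrite subr_eq0 => /eqP.
Qed.
End Roots.

(** * The Weyl group *)

Lemma common_denominator n (v : 'rV[rat]_n) :
  exists2 N : int, N != 0 & exists z : 'I_n -> int, forall j, v 0 j * N%:~R = (z j)%:~R.
Proof.
exists (\prod_j denq (v 0 j)); first by apply/prodf_neq0 => j _; exact: denq_neq0.
exists (fun j => numq (v 0 j) * \prod_(k | k != j) denq (v 0 k)) => j.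
by rewrite (bigD1 j) //= [in RHS]intrM numqE !intrM mulrA.
Qed.

(** Independence over the integers gives independence over the rationals by clearing denominators,
    and this persists over R; a right inverse of the matrix of roots supplies the dual vectors. *)
Lemma vd_dual_basis (R : realType) (D : vectorial_data) :
  exists om : vd_index D -> 'rV[R]_(vd_rank D),
    forall i j, pairing (aroot R i) (om j) = (i == j)%:R.
Proof.
set n := vd_rank D; set I := vd_index D.
pose A := \matrix_(i < #|I|, k < n) (vd_root (enum_val i) k 0)%:~R : 'M[rat]_(#|I|, n).
have Afree : row_free A.
  apply: inj_row_free => v vA.
  have [N N0 [z zE]] := common_denominator v.
  have Z : \sum_i z (enum_rank i) *: vd_root i = 0 :> 'cV[int]_n.
    apply/matrixP => k l; rewrite (ord1 l) [RHS]mxE summxE; apply/eqP.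
    rewrite -(intr_eq0 rat) rmorph_sum /=; apply/eqP.
    have := congr1 (fun M : 'rV[rat]_n => M 0 k * N%:~R) vA; rewrite !mxE mul0r => e0.
    rewrite -[RHS]e0 mulr_suml [LHS](reindex (@enum_val I predT)) /=; last first.
      by exists enum_rank => x _; [exact: enum_valK | exact: enum_rankK].
    apply: eq_bigr => i _; rewrite mxE intrM enum_valK -zE !mxE; ring.
  apply/matrixP => a j; rewrite (ord1 a) [RHS]mxE.
  have := vd_root_free Z (enum_val j); rewrite enum_valK => zj; have := zE j.
  rewrite zj => /eqP; rewrite mulf_eq0 intr_eq0 (negPf N0) orbF => /eqP; exact.
have /row_freeP[B AB] : row_free (map_mx (ratr : rat -> R) A) by rewrite row_free_map.
exists (fun j => \row_k B k (enum_rank j)) => i j.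
have := congr1 (fun M : 'M_(#|I|) => M (enum_rank i) (enum_rank j)) AB.
rewrite /pairing !mxE (inj_eq enum_rank_inj) => <-.
by apply: eq_bigr => k _; rewrite !mxE enum_rankK ratr_int mulrC.
Qed.

Section Weyl.
Variables (R : realType) (D : vectorial_data).
Local Notation I := (vd_index D).
Local Notation V := 'rV[R]_(vd_rank D).
Local Notation al := (aroot R).
Local Notation refl := (@reflection R D).
Local Notation C := (@fund_chamber R D).
Implicit Types (i j t : I) (v x : V) (w : V -> V).

Lemma root_coroot i j : pairing (al j) (acoroot R i) = (vd_matrix i j)%:~R.
Proof.
rewrite -(vd_pairing i j) /pairing !mxE rmorph_sum.
by apply: eq_bigr => k _; rewrite !mxE /= intrM.
Qed.

Lemma root_coroot2 i : pairing (al i) (acoroot R i) = 2.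
Proof. by rewrite root_coroot; case: (vd_matrixP D) => ->. Qed.

Lemma root_reflection i j v :
  pairing (al j) (refl i v) = pairing (al j) v - pairing (al i) v * (vd_matrix i j)%:~R.
Proof. by rewrite /reflection pairingB pairingZ root_coroot. Qed.

Lemma root_reflection_same i v : pairing (al i) (refl i v) = - pairing (al i) v.
Proof. by rewrite /reflection pairingB pairingZ root_coroot2; ring. Qed.

Lemma reflectionK i : involutive (refl i).
Proof.
by move=> v; rewrite {1}/reflection root_reflection_same scaleNr opprK /reflection subrK.
Qed.

Lemma reflection_lin i : linear (refl i).
Proof.
move=> a u v; rewrite /reflection pairingD pairingZ scalerDl scalerBr scalerA.
by rewrite opprD addrACA.
Qed.

Lemma weyl_lin w : weyl w -> linear w.
Proof. by elim=> [|i {}w _ IH] a u v //=; rewrite IH reflection_lin. Qed.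

Lemma weyl_comp w w' : weyl w -> weyl w' -> weyl (w \o w').
Proof.
move=> ww ww'; elim: ww => [//|i {}w _ IH].
exact: (weyl_refl i IH).
Qed.

Lemma weyl_reflection i : weyl (refl i).
Proof. exact: (weyl_refl i (weyl_id _ _)). Qed.

Lemma weyl_inv w : weyl w -> exists w', [/\ weyl w', cancel w w' & cancel w' w].
Proof.
elim=> [|i {}w _ [w' [ww' k k']]]; first by exists id; split=> //; exact: weyl_id.
exists (w' \o refl i); split=> [|x|x] /=.
- exact: weyl_comp (weyl_reflection i).
- by rewrite reflectionK k.
- by rewrite k' reflectionK.
Qed.

Definition word (s : seq I) : V -> V := foldr (fun i w => refl i \o w) id s.

Lemma word_cat s s' : word (s ++ s') = word s \o word s'.
Proof. by elim: s => //= i s ->. Qed.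

Definition has_length w n := exists2 s, size s = n & w = word s.

Lemma weyl_has_length w : weyl w -> exists n, has_length w n.
Proof.
elim=> [|i {}w _ [n [s sn ->]]]; first by exists 0%N, [::].
by exists n.+1, (i :: s); rewrite /= ?sn.
Qed.

Lemma has_length_refl w n i : has_length w n -> has_length (refl i \o w) n.+1.
Proof. by case=> s <- ->; exists (i :: s). Qed.

Lemma refl_reflK i w : refl i \o (refl i \o w) = w.
Proof. by apply/funext => x /=; rewrite reflectionK. Qed.

Definition min_length w n := has_length w n /\ forall m, has_length w m -> (n <= m)%N.

Lemma weyl_min_length w : weyl w -> exists n, min_length w n.
Proof.
move=> /weyl_has_length[n wn].
have ex : exists n, `[< has_length w n >] by exists n; apply/asboolP.
have [m /asboolP wm mm] := ex_minnP ex; exists m; split=> // k wk.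
by apply: mm; apply/asboolP.
Qed.

Fixpoint alt k i j : seq I := if k is k'.+1 then i :: alt k' j i else [::].

Lemma size_alt k i j : size (alt k i j) = k.
Proof. by elim: k i j => //= k IH i j; rewrite IH. Qed.

Lemma alt_add k l i j : exists2 s, size s = l & alt (k + l) i j = alt k i j ++ s.
Proof.
elim: k i j => [|k IH] i j; first by exists (alt l i j); rewrite ?size_alt.
by have [s sl e] := IH j i; exists s; rewrite //= e.
Qed.

Lemma alt_rcons k i j : alt k.+1 i j = rcons (alt k i j) (if odd k then j else i).
Proof.
elim: k i j => [//|k IH] i j.
by rewrite -[LHS]/(i :: alt k.+1 j i) IH /=; case: (odd k).
Qed.

Lemma functional_reflection i t p q z :
  p * pairing (al i) (refl t z) + q * pairing (al t) (refl t z) =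
  (- (vd_matrix t i)%:~R * p - q) * pairing (al t) z + p * pairing (al i) z.
Proof. by rewrite root_reflection root_reflection_same; ring. Qed.

(** The word is moved onto the functional p alpha_i + q alpha_t. The invariant 2p + c_it q >= 0 says
    that it is nonnegative on alpha_i^vee; c_it c_ti >= 4 lets the invariant survive the exchange of
    i and t, and keeps both coefficients nonnegative. *)
Lemma rank2_infinite i t k p q z : i != t ->
  4 <= vd_matrix i t * vd_matrix t i -> 0 <= p -> 0 <= q ->
  0 <= 2 * p + (vd_matrix i t)%:~R * q ->
  0 <= pairing (al i) z -> 0 <= pairing (al t) z ->
  0 <= p * pairing (al i) (word (alt k t i) z) + q * pairing (al t) (word (alt k t i) z).
Proof.
have [_ neg _] := vd_matrixP D.
elim: k i t p q => [|k IH] i t p q it c4 p0 q0 inv zi zt.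
  by rewrite /= addr_ge0 // mulr_ge0.
rewrite /= functional_reflection.
have a0 : 0 <= - (vd_matrix i t)%:~R :> R by rewrite oppr_ge0 -[0]/(0%:~R) ler_int neg.
have b0 : 0 <= - (vd_matrix t i)%:~R :> R.
  by rewrite oppr_ge0 -[0]/(0%:~R) ler_int neg // eq_sym.
have c4' : 4 <= - (vd_matrix i t)%:~R * - (vd_matrix t i)%:~R :> R.
  by rewrite mulrNN -intrM -[4]/(4%:~R) ler_int.
have key : 0 <= - (vd_matrix t i)%:~R * p - 2 * q.
  have h1 : 0 <= - (vd_matrix t i)%:~R * (2 * p + (vd_matrix i t)%:~R * q) by exact: mulr_ge0.
  have h2 : 0 <= (- (vd_matrix i t)%:~R * - (vd_matrix t i)%:~R - 4) * q.
    by apply: mulr_ge0 => //; rewrite subr_ge0.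
  nra.
apply: IH => //; first by rewrite eq_sym.
- by rewrite mulrC.
- have := mulr_ge0 b0 p0; lra.
- lra.
Qed.

(** The orbit of v under r_i and r_t stays in v plus the span of the two coroots; in the coordinates
    P and Q the braid relations become polynomial identities. *)
Definition word_state i t v P Q := v - P *: acoroot R i - Q *: acoroot R t.

Lemma word_state_l i t v P Q : refl i (word_state i t v P Q) =
  word_state i t v (pairing (al i) v - P - (vd_matrix t i)%:~R * Q) Q.
Proof.
rewrite /word_state {1}/reflection !pairingB !pairingZ root_coroot2 root_coroot.
by apply/matrixP => a b; rewrite !mxE; ring.
Qed.

Lemma word_state_r i t v P Q : refl t (word_state i t v P Q) =
  word_state i t v P (pairing (al t) v - Q - (vd_matrix i t)%:~R * P).
Proof.
rewrite /word_state {1}/reflection !pairingB !pairingZ root_coroot2 root_coroot.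
by apply/matrixP => a b; rewrite !mxE; ring.
Qed.

(* The order of [r_i r_t], read off [c_it c_ti]. *)
Definition dihedral_order (c : int) : nat :=
  if c == 0 then 2 else if c == 1 then 3 else if c == 2 then 4 else 6.

Lemma small_products (a b : int) : a <= 0 -> b <= 0 -> (a = 0 <-> b = 0) -> a * b < 4 ->
  [\/ a = 0 /\ b = 0, a = -1 /\ b = -1, (a = -1 /\ b = -2) \/ (a = -2 /\ b = -1)
    | (a = -1 /\ b = -3) \/ (a = -3 /\ b = -1)].
Proof.
move=> a0 b0 [ab ba] h.
have [a1|a1] := eqVneq a 0; first by constructor 1; split=> //; exact: ab.
have b1 : b <> 0 by move/ba => e; rewrite e eqxx in a1.
have al3 : -3 <= a by move/eqP: a1 => a1; nia.
have bl3 : -3 <= b by move/eqP: a1 => a1; nia.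
have : a = -1 \/ a = -2 \/ a = -3 by move/eqP: a1; lia.
have : b = -1 \/ b = -2 \/ b = -3 by lia.
case=> [a2|[a2|a2]] [b2|[b2|b2]]; move: h; rewrite a2 b2 => h; try lia.
- by apply: Or42.
- by apply: Or43; right.
- by apply: Or44; right.
- by apply: Or43; left.
- by apply: Or44; left.
Qed.

Lemma braid i t v : i != t -> vd_matrix i t * vd_matrix t i < 4 ->
  let m := dihedral_order (vd_matrix i t * vd_matrix t i) in
  word (alt m t i) v = word (alt m i t) v.
Proof.
have [_ neg sym] := vd_matrixP D.
move=> it c4; have ti : t != i by rewrite eq_sym.
have v0 : v = word_state i t v 0 0 by rewrite /word_state !scale0r !subr0.
case: (small_products (neg _ _ it) (neg _ _ ti) (sym i t) c4) => [[e f]|[e f]|[[e f]|[e f]]|[[e f]|[e f]]];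
  rewrite /dihedral_order e f /= {1 2}v0 !(word_state_l, word_state_r) e f;
  congr (_ - _ *: _ - _ *: _); ring.
Qed.

Lemma rank2_finite i t k z : i != t -> vd_matrix i t * vd_matrix t i < 4 ->
  (k < dihedral_order (vd_matrix i t * vd_matrix t i))%N ->
  0 <= pairing (al i) z -> 0 <= pairing (al t) z ->
  0 <= pairing (al i) (word (alt k t i) z).
Proof.
have [_ neg sym] := vd_matrixP D.
move=> it c4 km zi zt; have ti : t != i by rewrite eq_sym.
case: (small_products (neg _ _ it) (neg _ _ ti) (sym i t) c4) => [[e f]|[e f]|[[e f]|[e f]]|[[e f]|[e f]]];
  move: km; rewrite /dihedral_order e f /=;
  do 6?[case: k => [|k] //]; move=> _ /=;
  rewrite ?(root_reflection_same, root_reflection) ?e ?f; lra.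
Qed.

(* Tits' argument: write [w] as a longest possible alternating word in [r_i]
   and [r_t] followed by some [v]; by induction [v C] lies on the positive side
   of both walls, and the rest is a computation in rank 2. *)
Lemma weyl_chamber_side n w i : min_length w n ->
  (forall m, has_length (refl i \o w) m -> (n <= m)%N) ->
  forall x, C x -> 0 <= pairing (al i) (w x).
Proof.
have [n0 lt_n] := ubnP n; elim: n0 n lt_n w i => // n0 IH n lt_n w i [wn wmin] riw x Cx.
case: n lt_n wn wmin riw => [|n] lt_n wn wmin riw.
  by case: wn => -[|//] _ ->; exact/ltW/Cx.
have [[//|t s1] /= [ss] wE] := wn.
have it : i != t.
  apply/eqP => it; have := riw n; rewrite wE it refl_reflK ltnn => H.
  by have : false by apply: H; exists s1.
pose P k := (k <= n.+1)%N /\ exists2 v, has_length v (n.+1 - k) & w = word (alt k t i) \o v.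
have P1 : `[< P 1%N >].
  apply/asboolP; split=> //; exists (word s1); first by exists s1 => //; rewrite subn1.
  by rewrite wE.
have exP : exists k, `[< P k >] by exists 1%N.
have [k /asboolP[kn [v vn wEv]] kmax] : {k | `[< P k >] & forall k1, `[< P k1 >] -> (k1 <= k)%N}.
  have [|k Pk kmax] := ex_maxnP exP (m := n.+1); last by exists k.
  by move=> j /asboolP[].
have k1 : (0 < k)%N by exact: kmax.
have lenw m u s : has_length u m -> w = word s \o u -> (n.+1 <= size s + m)%N.
  by case=> s' <- -> e; apply: wmin; exists (s ++ s'); rewrite ?size_cat // word_cat.
have vmin : min_length v (n.+1 - k).
  split=> // m vm; have := lenw _ _ _ vm wEv; rewrite size_alt; lia.
(* Here l continues the alternation: if r_l v were shorter than v, the prefix could be lengthened,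
   against the maximality of k. *)
have next l : l = (if odd k then i else t) -> forall m, has_length (refl l \o v) m -> (n.+1 - k <= m)%N.
  move=> lE m lm; rewrite leqNgt; apply/negP => mlt.
  have wE' : w = word (alt k.+1 t i) \o (refl l \o v).
    rewrite alt_rcons -cats1 word_cat wEv; apply/funext => y /=.
    by rewrite lE reflectionK.
  have := lenw _ _ _ lm wE'; rewrite size_alt => h.
  have : (k.+1 <= k)%N by apply: kmax; apply/asboolP; split; [lia | exists (refl l \o v) => //; have -> : (n.+1 - k.+1 = m)%N by lia].
  by rewrite ltnn.
(* Here l is the last letter of the prefix: if r_l v were shorter than v, absorbing this letter into
   v would give w a word below its length. *)
have prev l : l = (if odd k then t else i) -> forall m, has_length (refl l \o v) m -> (n.+1 - k <= m)%N.
  move=> lE m lm.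
  have wE' : w = word (alt k.-1 t i) \o (refl l \o v).
    rewrite wEv -{1}(prednK k1) alt_rcons -cats1 word_cat; apply/funext => y /=.
    by rewrite lE -[in odd k](prednK k1) /=; case: (odd k.-1).
  by have := lenw _ _ _ lm wE'; rewrite size_alt; lia.
have vi : 0 <= pairing (al i) (v x).
  apply: (IH (n.+1 - k)%N) => //; first by lia.
  by case: (boolP (odd k)) => ok; [apply: next | apply: prev]; rewrite ?ok ?(negPf ok).
have vt : 0 <= pairing (al t) (v x).
  apply: (IH (n.+1 - k)%N) => //; first by lia.
  by case: (boolP (odd k)) => ok; [apply: prev | apply: next]; rewrite ?ok ?(negPf ok).
rewrite wEv /=; have [c4|c4] := leP 4 (vd_matrix i t * vd_matrix t i).
  have := @rank2_infinite i t k 1 0 (v x) it c4.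
  by rewrite !mulr0 addr0 !mul1r mul0r addr0; apply; rewrite ?mulr1.
have [km|km] := ltnP k (dihedral_order (vd_matrix i t * vd_matrix t i)); first by exact: (@rank2_finite i t k (v x) it c4 km vi vt).
(* A prefix at least as long as the order m can be rewritten by the braid relation to begin with
   r_i; then r_i w is shorter than w, against [riw]. *)
exfalso; set m := dihedral_order _ in km.
have [m' mE] : exists m', m = m'.+1 by exists m.-1; rewrite /m /dihedral_order; do !case: ifP.
have [s sl sE] := alt_add m (k - m) t i.
rewrite subnKC // in sE.
have : (n.+1 <= n)%N; last by rewrite ltnn.
case: (vn) => s' s'n vE.
apply: leq_trans (riw (m' + ((k - m) + (n.+1 - k)))%N _) _; last by lia.
exists (alt m' t i ++ (s ++ s')); first by rewrite !size_cat size_alt sl s'n.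
rewrite wEv sE vE; apply/funext => y; rewrite !word_cat /= braid // -/m mE /=.
by rewrite reflectionK.
Qed.

Lemma weyl_neq1_side w : weyl w -> w <> id ->
  exists t, forall x, C x -> pairing (al t) (w x) <= 0.
Proof.
move=> ww w1; have [n [wn wmin]] := weyl_min_length ww.
case: n wn wmin => [|n] [[|t s] //= sn wE] wmin.
case: sn => sn; exists t => x Cx; rewrite wE /= root_reflection_same oppr_le0.
apply: (@weyl_chamber_side n) => //.
  split; first by exists s.
  by move=> m sm; apply: (wmin m.+1); rewrite wE; exact: has_length_refl.
by move=> m; rewrite -[_ \o _]/(word (t :: s)) -[word (t :: s)]wE => /wmin /ltnW.
Qed.

Lemma weyl_free w x : weyl w -> C x -> C (w x) -> w = id.
Proof.
move=> ww Cx Cwx; apply: contrapT => /(weyl_neq1_side ww)[t /(_ x Cx)].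
by rewrite leNgt Cwx.
Qed.

End Weyl.

(** * Faces and enclosures of the model apartment *)

Section PairingTopology.
Variables (R : realType) (n : nat).
Implicit Types (a : 'cV[R]_n) (x v : 'rV[R]_n).

Lemma pairing_continuous a : continuous (fun x : 'rV[R]_n => pairing a x).
Proof.
have -> : (fun x : 'rV[R]_n => pairing a x) = (fun x => \sum_k x 0 k * a k 0).
  by apply/funext => x; rewrite /pairing mxE.
move: (index_enum _) => s; elim: s => [|k s IH].
  have -> : (fun x : 'rV[R]_n => \sum_(k <- [::]) x 0 k * a k 0) = cst 0.
    by apply/funext => x; rewrite big_nil.
  exact: cst_continuous.
have -> : (fun x : 'rV[R]_n => \sum_(l <- k :: s) x 0 l * a l 0) =
    ((fun M : 'rV[R]_n => M 0 k) \* (fun=> a k 0)) \+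
    (fun x : 'rV[R]_n => \sum_(l <- s) x 0 l * a l 0).
  by apply/funext => x; rewrite big_cons.
move=> x; apply: (@continuousD R R^o); last exact: IH.
by apply: (@continuousM R); [exact: coord_continuous | exact: cst_continuous].
Qed.

Lemma pairing_inj a b : (forall v, pairing a v = pairing b v) -> a = b.
Proof.
move=> ab; apply/matrixP => k l; rewrite (ord1 l).
by have := ab (delta_mx 0 k); rewrite /pairing -!rowE !mxE.
Qed.

Lemma nbhs_pairing_lt a x c : pairing a x < c -> nbhs x [set y | pairing a y < c].
Proof.
move=> xc; apply: (@pairing_continuous a x [set t | t < c]).
exact: (@open_nbhs_nbhs _ _ _ (conj (@open_lt R c) xc)).
Qed.

Lemma nbhs_pairing_gt a x c : c < pairing a x -> nbhs x [set y | c < pairing a y].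
Proof.
move=> xc; apply: (@pairing_continuous a x [set t | c < t]).
exact: (@open_nbhs_nbhs _ _ _ (conj (@open_gt R c) xc)).
Qed.

Lemma nbhs_along x v (O : set 'rV[R]_n) : nbhs x O ->
  exists2 e, 0 < e & forall t, `|t| <= e -> O (x + t *: v).
Proof.
move=> xO.
have c : {for 0, continuous (fun t : R => x + t *: v)}.
  apply: cvgD; first exact: cvg_cst.
  by apply: cvgZr_tmp; exact: cvg_id.
have : nbhs (0 : R) [set t | O (x + t *: v)].
  by apply: c; rewrite scale0r addr0.
move=> /nbhs_ballP[e /= e0 H]; exists (e / 2); first by rewrite divr_gt0.
move=> t te; apply: H; rewrite /ball /= sub0r normrN.
by apply: le_lt_trans te _; rewrite gtr_pMr // invf_lt1 // ltr1n.
Qed.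

Lemma closure_pairing_ge (S : set 'rV[R]_n) a c x : closure S x ->
  (forall y, S y -> c <= pairing a y) -> c <= pairing a x.
Proof.
move=> Sx H; rewrite leNgt; apply/negP => /nbhs_pairing_lt/Sx[y [/H cy /=]].
by rewrite ltNge cy.
Qed.

End PairingTopology.

(** * Roots as linear forms and the affine Weyl group *)

Section ModelRoots.
Variables (R : realType) (D : vectorial_data).
Variable g : kac_moody_algebra R[i] (@vd_matrix D).
Local Notation I := (vd_index D).
Local Notation V := 'rV[R]_(vd_rank D).
Local Notation Vd := 'cV[R]_(vd_rank D).
Local Notation al := (aroot R).
Local Notation refl := (@reflection R D).
Implicit Types (i j : I) (v x y : V) (w h : V -> V) (m : I -> int) (a : Vd).

Definition fund_coweight : I -> V := projT1 (cid (vd_dual_basis R D)).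
Local Notation om := fund_coweight.

Lemma root_coweight i j : pairing (al i) (om j) = (i == j)%:R.
Proof. exact: (projT2 (cid (vd_dual_basis R D))). Qed.

Definition coweight_sum (b : I -> R) : V := \sum_j b j *: om j.

Lemma root_coweight_sum i b : pairing (al i) (coweight_sum b) = b i.
Proof.
rewrite /coweight_sum pairing_sum (bigD1 i) //= pairingZ root_coweight eqxx mulr1.
by rewrite big1 ?addr0 // => j /negPf ji; rewrite pairingZ root_coweight eq_sym ji mulr0.
Qed.

Definition root_form m : Vd := \sum_j (m j)%:~R *: al j.

Lemma root_formE m v : pairing (root_form m) v = \sum_j (m j)%:~R * pairing (al j) v.
Proof. exact: pairing_suml. Qed.

Definition root_coord m := is_root (chevalley_of g) m.

Lemma root_coord_sign m : root_coord m -> (forall j, 0 <= m j) \/ (forall j, m j <= 0).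
Proof. exact/root_sign/reduced_of. Qed.

Lemma root_coord_neq0 m : root_coord m -> exists j, m j != 0.
Proof. by case. Qed.

Lemma root_coord_opp m : root_coord m -> root_coord (fun j => - m j).
Proof. by apply: root_opp; exact: reduced_of. Qed.

Lemma root_coord_reflect i m : root_coord m -> root_coord (reflect_coord (@vd_matrix D) i m).
Proof. by apply: root_reflect; [exact: vd_matrixP | exact: reduced_of]. Qed.

Lemma root_coord_simple i : root_coord (fun j => (j == i)%:Z).
Proof. exact/root_simple/reduced_of. Qed.

Lemma root_coord_single i m : root_coord m -> (forall j, j != i -> m j = 0) -> m i = 1 \/ m i = -1.
Proof. exact/root_single/reduced_of. Qed.

Lemma all_rootsP a : all_roots g a <-> exists2 m, root_coord m & a = root_form m.
Proof. by []. Qed.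

Lemma root_formN m : root_form (fun j => - m j) = - root_form m.
Proof. by rewrite /root_form -sumrN; apply: eq_bigr => j _; rewrite intrN scaleNr. Qed.

Lemma root_form_simple i : root_form (fun j => (j == i)%:Z) = al i.
Proof.
rewrite /root_form (bigD1 i) //= eqxx scale1r big1 ?addr0 // => j /negPf ->.
by rewrite scale0r.
Qed.

Lemma root_form_reflect i m v :
  pairing (root_form (reflect_coord (@vd_matrix D) i m)) v = pairing (root_form m) (refl i v).
Proof.
rewrite !root_formE /reflect_coord.
under [RHS]eq_bigr do rewrite root_reflection mulrBr.
under [LHS]eq_bigr do rewrite intrB mulrBl.
rewrite !sumrB; congr (_ - _).
rewrite [LHS](bigD1 i) //= eqxx mul1r [X in _ + X]big1 ?addr0; last first.
  by move=> j /negPf ->; rewrite mul0r mul0r.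
rewrite rmorph_sum mulr_suml /=; apply: eq_bigr => j _; rewrite intrM; ring.
Qed.

Lemma all_roots_simple i : all_roots g (al i).
Proof. by apply/all_rootsP; exists (fun j => (j == i)%:Z); [exact: root_coord_simple | rewrite root_form_simple]. Qed.

Lemma all_roots_opp a : all_roots g a -> all_roots g (- a).
Proof.
case/all_rootsP=> m rm ->; apply/all_rootsP; exists (fun j => - m j); first exact: root_coord_opp.
by rewrite root_formN.
Qed.

Lemma pairingNl a v : pairing (- a) v = - pairing a v.
Proof. by rewrite /pairing mulmxN mxE. Qed.

Lemma all_roots_weyl w a : weyl w -> all_roots g a ->
  exists2 a', all_roots g a' & forall v, pairing a' v = pairing a (w v).
Proof.
move=> ww; elim: ww a => [|i {}w _ IH] a Da; first by exists a.
case/all_rootsP: Da => m rm ->.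
have [|a' Da' a'E] := IH (root_form (reflect_coord (@vd_matrix D) i m)).
  by apply/all_rootsP; exists (reflect_coord (@vd_matrix D) i m) => //; exact: root_coord_reflect.
by exists a' => // v; rewrite a'E root_form_reflect.
Qed.

Lemma all_roots_coroot a i : all_roots g a -> exists k : int, pairing a (acoroot R i) = k%:~R.
Proof.
case/all_rootsP=> m rm ->; exists (\sum_j m j * vd_matrix i j).
rewrite root_formE rmorph_sum /=; apply: eq_bigr => j _.
by rewrite root_coroot intrM.
Qed.

Lemma coroot_lattice0 : coroot_lattice (R := R) (D := D) 0.
Proof. by exists (fun=> 0) => //; rewrite big1 // => i _; rewrite scale0r. Qed.

Lemma coroot_latticeD u v : coroot_lattice u -> coroot_lattice v ->
  coroot_lattice (R := R) (D := D) (u + v).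
Proof.
move=> [b _ <-] [b' _ <-]; exists (fun i => b i + b' i) => //.
by rewrite -big_split; apply: eq_bigr => i _; rewrite intrD scalerDl.
Qed.

Lemma coroot_latticeN u : coroot_lattice u -> coroot_lattice (R := R) (D := D) (- u).
Proof.
move=> [b _ <-]; exists (fun i => - b i) => //.
by rewrite -sumrN; apply: eq_bigr => i _; rewrite intrN scaleNr.
Qed.

Lemma coroot_lattice_coroot i k : coroot_lattice (R := R) (D := D) (k%:~R *: acoroot R i).
Proof.
exists (fun j => (j == i)%:Z * k) => //.
rewrite (bigD1 i) //= eqxx mul1r big1 ?addr0 // => j /negPf ->.
by rewrite mul0r scale0r.
Qed.

Lemma coroot_lattice_integral a u : all_roots g a -> coroot_lattice u ->
  exists k : int, pairing a u = k%:~R.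
Proof.
move=> Da [b _ <-]; rewrite pairing_sum.
elim: (index_enum _) => [|i s [k IH]]; first by exists 0; rewrite big_nil.
have [k' e] := all_roots_coroot i Da; exists (b i * k' + k).
by rewrite big_cons IH pairingZ e intrD intrM.
Qed.

Lemma coroot_lattice_weyl w u : weyl w -> coroot_lattice u -> coroot_lattice (R := R) (D := D) (w u).
Proof.
elim=> [//|i {}w _ IH] Lu; have Lw := IH Lu; rewrite /= /reflection.
have [k ->] := coroot_lattice_integral (all_roots_simple i) Lw.
by apply: coroot_latticeD => //; apply: coroot_latticeN; exact: coroot_lattice_coroot.
Qed.

Section Semidirect.
Variable T : set V.
Hypotheses (T0 : T 0) (TD : forall u v, T u -> T v -> T (u + v)) (TN : forall u, T u -> T (- u)).
Hypothesis Tw : forall w u, weyl w -> T u -> T (w u).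

Lemma semidirect_comp h h' : semidirect T h -> semidirect T h' -> semidirect T (h \o h').
Proof.
move=> [w [t [ww Tt ->]]] [w' [t' [ww' Tt' ->]]].
exists (w \o w'), (w t' + t); split; [exact: weyl_comp | by apply: TD => //; exact: Tw |].
apply/funext => x /=; have := weyl_lin ww 1 (w' x) t'; rewrite !scale1r => ->.
by rewrite addrA.
Qed.

Lemma semidirect_inv h : semidirect T h ->
  exists h', [/\ semidirect T h', cancel h h' & cancel h' h].
Proof.
move=> [w [t [ww Tt ->]]]; have [w' [ww' k k']] := weyl_inv ww.
have w'D x y : w' (x + y) = w' x + w' y.
  by have := weyl_lin ww' 1 x y; rewrite !scale1r.
exists (fun x => w' x + w' (- t)); split.
- by exists w', (w' (- t)); split=> //; apply: Tw => //; exact: TN.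
- by move=> x; rewrite w'D k -addrA -w'D subrr (linear_map0 (weyl_lin ww')) addr0.
- by move=> x; rewrite -w'D k' subrK.
Qed.

Lemma semidirect_id : semidirect T id.
Proof. by exists id, 0; split=> //; [exact: weyl_id | apply/funext => x; rewrite addr0]. Qed.

Lemma semidirect_weyl w : weyl w -> semidirect T w.
Proof. by move=> ww; exists w, 0; split=> //; apply/funext => x; rewrite addr0. Qed.

End Semidirect.

Lemma affine_weyl_comp h h' : affine_weyl h -> affine_weyl h' -> affine_weyl (R := R) (D := D) (h \o h').
Proof. by apply: semidirect_comp; [exact: coroot_latticeD | exact: coroot_lattice_weyl]. Qed.

Lemma affine_weyl_inv h : affine_weyl h ->
  exists h', [/\ affine_weyl (R := R) (D := D) h', cancel h h' & cancel h' h].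
Proof. by apply: semidirect_inv; [exact: coroot_latticeN | exact: coroot_lattice_weyl]. Qed.

Lemma affine_weyl_id : affine_weyl (R := R) (D := D) id.
Proof. exact/semidirect_id/coroot_lattice0. Qed.

Lemma affine_weyl_weyl w : weyl w -> affine_weyl (R := R) (D := D) w.
Proof. exact/semidirect_weyl/coroot_lattice0. Qed.

(* The reflection in the wall [alpha_i = 1]. *)
Definition wall_reflection i v : V := refl i v + acoroot R i.

Lemma affine_weyl_wall_reflection i : affine_weyl (R := R) (D := D) (wall_reflection i).
Proof.
exists (refl i), (acoroot R i); split=> //; first exact: weyl_reflection.
by have := coroot_lattice_coroot i 1; rewrite scale1r.
Qed.

Lemma wall_reflectionK i : involutive (wall_reflection i).
Proof.
move=> v; rewrite /wall_reflection.
have E : refl i (acoroot R i) = - acoroot R i.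
  by rewrite /reflection root_coroot2; apply/matrixP => k l; rewrite !mxE; ring.
by have := reflection_lin i 1 (refl i v) (acoroot R i); rewrite !scale1r => ->; rewrite E reflectionK subrK.
Qed.

Lemma root_wall_reflection i v : pairing (al i) (wall_reflection i v) = 2 - pairing (al i) v.
Proof. by rewrite /wall_reflection pairingD root_reflection_same root_coroot2 addrC. Qed.

Lemma wall_reflection_fix i v : pairing (al i) v = 1 -> wall_reflection i v = v.
Proof. by rewrite /wall_reflection /reflection => ->; rewrite scale1r subrK. Qed.

End ModelRoots.

(** * Enclosed sets and their stability properties *)

Section Enclosed.
Variables (R : realType) (D : vectorial_data).
Variable g : kac_moody_algebra R[i] (@vd_matrix D).
Local Notation I := (vd_index D).
Local Notation V := 'rV[R]_(vd_rank D).
Local Notation Vd := 'cV[R]_(vd_rank D).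
Local Notation al := (aroot R).
Local Notation refl := (@reflection R D).
Local Notation Delta := (all_roots g).
Implicit Types (i : I) (v x y : V) (w h : V -> V) (a b : Vd).
Implicit Types (E Q : set V) (k : Vd -> option int).

Lemma reflection_continuous i : continuous (refl i).
Proof.
move=> x; apply: (@continuousB R V V (id : V -> V)); first exact: cvg_id.
exact: (@cvgZr_tmp R V _ _ _ _ _ (acoroot R i) (@pairing_continuous R _ (al i) x)).
Qed.

Lemma weyl_continuous w : weyl w -> continuous w.
Proof.
elim=> [x|i {}w _ IH x]; first exact: cvg_id.
by apply: continuous_comp; [exact: IH | exact: reflection_continuous].
Qed.

Lemma semidirect_continuous (T : set V) h : semidirect T h -> continuous h.
Proof.
move=> [w [t [ww _ ->]]] x; apply: (@continuousD R V V w (cst t)).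
  exact: weyl_continuous.
exact: cst_continuous.
Qed.

Definition cell k k' : set V :=
  \bigcap_(a in Delta) (half_space a (k a) `&` open_half_space a (k' a)).

Definition enclosed Q := exists k, Q = \bigcap_(a in Delta) half_space a (k a).

Lemma cell_none k : cell k (fun=> None) = \bigcap_(a in Delta) half_space a (k a).
Proof. by apply: eq_bigcapr => a _ /=; rewrite setIT. Qed.

Definition omin (o o' : option int) : option int :=
  match o, o' with
  | Some p, Some q => Some (Num.min p q)
  | Some p, None => Some p
  | None, _ => o'
  end.

Lemma half_space_omin a o o' : half_space a (omin o o') = half_space a o `&` half_space a o' :> set V.
Proof.
case: o o' => [p|] [q|] /=; rewrite ?setTI ?setIT //.
apply/seteqP; split=> x /=.
  move=> H; split; apply: le_trans H _; rewrite lerD2l ler_int ge_min lexx ?orbT //.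
by case=> ? ?; rewrite /Num.min; case: ifP.
Qed.

Lemma open_half_space_omin a o o' :
  open_half_space a (omin o o') = open_half_space a o `&` open_half_space a o' :> set V.
Proof.
case: o o' => [p|] [q|] /=; rewrite ?setTI ?setIT //.
apply/seteqP; split=> x /=.
  move=> H; split; apply: lt_le_trans H _; rewrite lerD2l ler_int ge_min lexx ?orbT //.
by case=> ? ?; rewrite /Num.min; case: ifP.
Qed.

Lemma cellI k1 k1' k2 k2' : cell k1 k1' `&` cell k2 k2' =
  cell (fun a => omin (k1 a) (k2 a)) (fun a => omin (k1' a) (k2' a)).
Proof.
rewrite /cell -bigcapI; apply: eq_bigcapr => a _.
by rewrite half_space_omin open_half_space_omin setIACA.
Qed.

Lemma enclosedI Q Q' : enclosed Q -> enclosed Q' -> enclosed (Q `&` Q').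
Proof.
move=> [k ->] [k' ->]; exists (fun a => omin (k a) (k' a)).
by rewrite -bigcapI; apply: eq_bigcapr => a _; rewrite half_space_omin.
Qed.

Lemma enclosed_half a (k : int) : Delta a -> enclosed [set x | 0 <= pairing a x + k%:~R].
Proof.
move=> Da; exists (fun b => if b == a then Some k else None).
apply/seteqP; split=> [x Hx b _|x /(_ a Da)]; last by rewrite /= eqxx.
by case: eqP => [->|].
Qed.

Lemma enclosedT : enclosed setT.
Proof. by exists (fun=> None); rewrite bigcapT. Qed.

Lemma enclosed_all (J : finType) (F : J -> set V) :
  (forall p, enclosed (F p)) -> enclosed [set x | forall p, F p x].
Proof.
move=> H; have E (s : seq J) : enclosed [set x | forall p, p \in s -> F p x].
  elim: s => [|p s IH]; first by rewrite (_ : mkset _ = setT); [exact: enclosedT | exact/seteqP].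
  have -> : [set x | forall q, q \in p :: s -> F q x] = F p `&` [set x | forall p, p \in s -> F p x].
    apply/seteqP; split=> x.
      by move=> Hx; split=> [|q ls]; apply: Hx; rewrite inE ?eqxx // ls orbT.
    by case=> Fj Fs q; rewrite inE => /orP[/eqP ->//|]; exact: Fs.
  exact: enclosedI.
have := E (enum J); congr enclosed; apply/seteqP; split=> x Hx p; last by move=> _; exact: Hx.
by apply: Hx; rewrite mem_enum.
Qed.

Lemma enclosed_convex Q x y t : enclosed Q -> Q x -> Q y -> 0 <= t <= 1 -> Q ((1 - t) *: x + t *: y).
Proof.
move=> [k ->] Qx Qy /andP[t0 t1] a Da; have := Qx a Da; have := Qy a Da.
case: (k a) => //= m hy hx; rewrite pairingD !pairingZ.
have -> : (1 - t) * pairing a x + t * pairing a y + m%:~R =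
  (1 - t) * (pairing a x + m%:~R) + t * (pairing a y + m%:~R) by ring.
by rewrite addr_ge0 // mulr_ge0 // subr_ge0.
Qed.

Lemma affine_limit (c d : R) : (forall t, 0 < t <= 1 -> 0 <= c + t * d) -> 0 <= c.
Proof.
move=> H; rewrite leNgt; apply/negP => c0.
have d0 : 0 < d by have := H 1; rewrite mul1r lexx ltr01 => /(_ isT); lra.
have : 0 < Num.min 1 (- c / (2 * d)) <= 1.
  rewrite lt_min ltr01 ge_min lexx /= andbT divr_gt0 //; lra.
move/H; apply/negP; rewrite -ltNge.
have : Num.min 1 (- c / (2 * d)) * d <= - c / (2 * d) * d by rewrite ler_wpM2r ?ge_min ?lexx ?orbT // ltW.
have -> : - c / (2 * d) * d = - c / 2 by field; lra.
lra.
Qed.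

Lemma enclosed_limit Q x v : enclosed Q -> (forall t, 0 < t <= 1 -> Q (x + t *: v)) -> Q x.
Proof.
move=> [k ->] H a Da; case E: (k a) => [m|//] /=.
apply: (@affine_limit _ (pairing a v)) => t /H /(_ a Da).
by rewrite E /= pairingD pairingZ addrAC.
Qed.

Lemma enclosed_closure Q x : enclosed Q -> closure Q x -> Q x.
Proof.
move=> [k ->] Qx a Da; case E: (k a) => [m|//] /=.
rewrite -[m%:~R]opprK subr_ge0; apply: closure_pairing_ge Qx _ => y /(_ a Da).
by rewrite E /= -[m%:~R in X in X -> _]opprK subr_ge0.
Qed.

Definition pull_form w a : Vd := \col_k pairing a (w (delta_mx 0 k)).

Lemma pairing_pull w a v : linear w -> pairing (pull_form w a) v = pairing a (w v).
Proof.
move=> lw; have wZ c u : w (c *: u) = c *: w u.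
  by have := lw c u 0; rewrite !addr0 (linear_map0 lw) addr0.
have wD x y : w (x + y) = w x + w y by have := lw 1 x y; rewrite !scale1r.
have wS (s : seq 'I_(vd_rank D)) (F : 'I_(vd_rank D) -> V) : w (\sum_(i <- s) F i) = \sum_(i <- s) w (F i).
  by elim: s => [|i s IH]; rewrite ?big_nil ?(linear_map0 lw) // !big_cons wD IH.
rewrite [in RHS](matrix_sum_delta v) big_ord1 wS pairing_sum [LHS]/pairing mxE.
by apply: eq_bigr => q _; rewrite wZ pairingZ mxE.
Qed.

Lemma pull_form_root w a : weyl w -> Delta a -> Delta (pull_form w a).
Proof.
move=> ww Da; have [a' Da' a'E] := all_roots_weyl ww Da.
suff -> : pull_form w a = a' by [].
by apply: pairing_inj => v; rewrite a'E pairing_pull //; exact: weyl_lin.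
Qed.

(** A translation in the coroot lattice shifts the level of each root by an integer, which
    [Num.floor] merely reads off. The clause on [None] is kept so that preimages of cells without
    strict conditions are again such cells. *)
Lemma cell_preimage h : affine_weyl h ->
  exists K : (Vd -> option int) -> (Vd -> option int),
    K (fun=> None) = (fun=> None) /\ forall k k', h @^-1` (cell k k') = cell (K k) (K k').
Proof.
move=> [w [t [ww Lt ->]]]; have [w' [ww' kw kw']] := weyl_inv ww.
have lw := weyl_lin ww; have lw' := weyl_lin ww'.
exists (fun k a => omap (fun p => p + Num.floor (pairing (pull_form w' a) t)) (k (pull_form w' a))).
split=> // k k'.
have P a : Delta a -> [/\ Delta (pull_form w' a),
    forall v, pairing (pull_form w' a) (w v) = pairing a v &
    (Num.floor (pairing (pull_form w' a) t))%:~R = pairing (pull_form w' a) t].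
  move=> Da; have Da' := pull_form_root ww' Da; split=> //.
    by move=> v; rewrite pairing_pull // kw.
  by have [n ->] := coroot_lattice_integral Da' Lt; rewrite intrKfloor.
apply/seteqP; split=> v /= Hv a Da.
  have [Da' aw fl] := P _ Da; have [] := Hv _ Da'.
  case: (k _) => [p|] /=; case: (k' _) => [q|] /=; rewrite ?pairingD ?aw ?intrD ?fl => h1 h2; split=> //.
  - by rewrite [p%:~R + _]addrC addrA.
  - by rewrite [q%:~R + _]addrC addrA.
  - by rewrite [p%:~R + _]addrC addrA.
  - by rewrite [q%:~R + _]addrC addrA.
have Da' := pull_form_root ww Da; have [_ aw fl] := P _ Da'.
have E : pull_form w' (pull_form w a) = a.
  by apply: pairing_inj => u; rewrite !pairing_pull // kw'.
rewrite E in fl aw; have := Hv _ Da'; rewrite E => -[].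
rewrite /setI /=; case: (k _) => [p|] /=; case: (k' _) => [q|] /=;
  rewrite ?pairingD ?aw ?intrD ?fl => h1 h2; split=> //.
- by rewrite -addrA [pairing a t + _]addrC.
- by rewrite -addrA [pairing a t + _]addrC.
- by rewrite -addrA [pairing a t + _]addrC.
- by rewrite -addrA [pairing a t + _]addrC.
Qed.

Lemma enclosed_preimage h Q : affine_weyl h -> enclosed Q -> enclosed (h @^-1` Q).
Proof.
move=> hw [k ->]; have [K [K0 KE]] := cell_preimage hw.
by exists (K k); rewrite -cell_none KE K0 cell_none.
Qed.

End Enclosed.

(** * Faces as filters, signs and heights of roots *)

Section Faces.
Variables (R : realType) (D : vectorial_data).
Variable g : kac_moody_algebra R[i] (@vd_matrix D).
Local Notation I := (vd_index D).
Local Notation V := 'rV[R]_(vd_rank D).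
Local Notation Vd := 'cV[R]_(vd_rank D).
Local Notation al := (aroot R).
Local Notation C := (@fund_chamber R D).
Local Notation om := (fund_coweight R (D := D)).
Local Notation Delta := (all_roots g).
Local Notation face := (face g).
Local Notation cell := (cell g).
Local Notation enclosed := (enclosed g).
Implicit Types (i j : I) (v x y z c : V) (w h : V -> V) (a : Vd) (b : bool).
Implicit Types (E Q O Fv : set V) (k : Vd -> option int).

Lemma face_intro z Fv E k k' O : nbhs z O -> cell k k' `<=` E ->
  (forall v, Fv v -> O (z + v) -> cell k k' (z + v)) -> face z Fv E.
Proof. by move=> zO kE H; exists k, k', O; split=> // y [Oy [v Fvv yE]]; move: Oy; rewrite -yE; exact: H. Qed.

Lemma face_sub z Fv E E' : E `<=` E' -> face z Fv E -> face z Fv E'.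
Proof. by move=> EE' [k [k' [O [zO kE Ok]]]]; exists k, k', O; split=> //; exact: subset_trans EE'. Qed.

Lemma face_setI z Fv E E' : face z Fv E -> face z Fv E' -> face z Fv (E `&` E').
Proof.
move=> [k1 [k1' [O1 [zO1 kE1 Ok1]]]] [k2 [k2' [O2 [zO2 kE2 Ok2]]]].
apply: (@face_intro _ _ _ (fun a => omin (k1 a) (k2 a)) (fun a => omin (k1' a) (k2' a)) (O1 `&` O2)).
- exact: filterI.
- by rewrite -cellI; exact: setISS.
- move=> v Fvv [O1y O2y]; rewrite -cellI; split; [apply: Ok1 | apply: Ok2];
    by split=> //; exists v.
Qed.

Lemma face_enclosed z Fv O Q : enclosed Q -> nbhs z O ->
  (forall v, Fv v -> O (z + v) -> Q (z + v)) -> face z Fv Q.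
Proof.
by move=> [k ->] zO H; apply: (@face_intro _ _ _ k (fun=> None) O); rewrite ?cell_none.
Qed.

Lemma faceP z Fv E : face z Fv E ->
  exists2 O, nbhs z O & forall v, Fv v -> O (z + v) -> E (z + v).
Proof.
move=> [k [k' [O [zO kE Ok]]]]; exists O => // v Fvv Ozv.
by apply/kE/Ok; split=> //; exists v.
Qed.

Lemma affine_shift w t : weyl w -> forall x v, w (x + v) + t = w x + t + w v.
Proof.
move=> ww x v; have := weyl_lin ww 1 x v; rewrite !scale1r => ->.
by rewrite addrAC.
Qed.

Lemma face_affine w t z Fv : weyl w -> coroot_lattice t ->
  let h := fun x => w x + t in
  fmap h (face z Fv) = face (h z) [set w v | v in Fv].
Proof.
move=> ww Lt h; have hw : affine_weyl h by exists w, t.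
have [h' [hw' kh kh']] := affine_weyl_inv g hw.
have hc := semidirect_continuous hw; have hc' := semidirect_continuous hw'.
have [K [_ KE]] := cell_preimage g hw; have [K' [_ KE']] := cell_preimage g hw'.
apply/seteqP; split=> E.
  move=> [k [k' [O [zO kE Ok]]]]; apply: (@face_intro _ _ _ (K' k) (K' k') (h' @^-1` O)); rewrite -?KE'.
  - by apply: hc'; rewrite kh.
  - by move=> y /= /kE /=; rewrite kh'.
  - move=> _ [v Fvv <-] /=; rewrite -affine_shift // -/(h _) kh => Oy.
    by apply: Ok; split=> //; exists v.
move=> [k [k' [O [zO kE Ok]]]]; apply: (@face_intro _ _ _ (K k) (K k') (h @^-1` O)); rewrite -?KE; first exact: hc.
  by move=> y /= /kE.
move=> v Fvv /= Oy; apply: Ok; split=> //; exists (w v); first by exists v.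
by rewrite /h affine_shift.
Qed.

Lemma fund_face0 : fund_face (R := R) (D := D) (finset.set0) = C.
Proof. by apply/seteqP; split=> v H i; have := H i; rewrite finset.in_set0. Qed.

Lemma is_vface_fund J : is_vface (fund_face (R := R) (D := D) J).
Proof.
exists true, id, J; split; first exact: weyl_id.
by rewrite /sgn image_id.
Qed.

Lemma is_vface_sgn b w : weyl w -> is_vface (R := R) (D := D) [set sgn b (w v) | v in C].
Proof. by move=> ww; exists b, w, finset.set0; rewrite fund_face0. Qed.

Lemma sgn_weyl b w v : weyl w -> sgn b (w v) = w (sgn b v).
Proof.
move=> ww; case: b => //=; have := weyl_lin ww (-1) v 0.
by rewrite !addr0 !scaleN1r (linear_map0 (weyl_lin ww)) addr0 => ->.
Qed.

Lemma is_vface_image w Fv : weyl w -> is_vface Fv -> is_vface [set w v | v in Fv].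
Proof.
move=> ww [b [w' [J [ww' ->]]]]; exists b, (w \o w'), J; split; first exact: weyl_comp.
by rewrite image_comp; congr image; apply/funext => v /=; rewrite (sgn_weyl b _ ww).
Qed.

Definition coweight_rho : V := coweight_sum (R := R) (fun=> 1).
Local Notation rho := coweight_rho.

Lemma root_rho i : pairing (al i) rho = 1.
Proof. exact: root_coweight_sum. Qed.

Lemma fund_chamber_rho s : 0 < s -> C (s *: rho).
Proof. by move=> s0 i; rewrite pairingZ root_rho mulr1. Qed.

(** rho minus the i-th fundamental coweight: a vector of the vectorial panel on which alpha_i alone
    vanishes. *)
Definition coweight_off i : V := coweight_sum (R := R) (fun j => (j != i)%:R).

Lemma root_off i j : pairing (al j) (coweight_off i) = (j != i)%:R.
Proof. exact: root_coweight_sum. Qed.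

Lemma fund_face_off i s : 0 < s -> fund_face (finset.set1 i) (s *: coweight_off i).
Proof.
move=> s0 j; rewrite finset.in_set1 pairingZ root_off.
by case: eqP => _; rewrite ?mulr0 ?mulr1.
Qed.

Lemma vface_scale Fv v s : is_vface Fv -> Fv v -> 0 < s -> Fv (s *: v).
Proof.
move=> [b [w [J [ww ->]]]] [u Ju <-] s0; exists (s *: u).
  move=> i; have := Ju i; case: ifP => _; rewrite pairingZ; last by move=> ?; exact: mulr_gt0.
  by move=> ->; rewrite mulr0.
have := weyl_lin ww s u 0; rewrite !addr0 (linear_map0 (weyl_lin ww)) addr0 => ->.
by case: b => //=; rewrite scalerN.
Qed.

Lemma vface_nonempty Fv : is_vface Fv -> exists v, Fv v.
Proof.
move=> [b [w [J [ww ->]]]].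
exists (sgn b (w (coweight_sum (R := R) (fun j => (j \notin J)%:R)))).
apply: imageP => i; rewrite root_coweight_sum.
by case: (i \in J).
Qed.

Lemma root_pos_or_neg m v : root_coord g m -> (forall j, 0 < pairing (al j) v) ->
  ((forall j, 0 <= m j) /\ 0 < pairing (root_form R m) v) \/
  ((forall j, m j <= 0) /\ pairing (root_form R m) v < 0).
Proof.
have pos m' : (forall j, 0 <= m' j) -> (exists j, m' j != 0) ->
    (forall j, 0 < pairing (al j) v) -> 0 < pairing (root_form R m') v.
  move=> m0 [j mj] v0; rewrite root_formE (bigD1 j) //= ltr_pwDl //.
    by rewrite mulr_gt0 // ltr0z lt_def mj m0.
  by apply: sumr_ge0 => l _; rewrite mulr_ge0 ?ler0z // ltW.
move=> rm v0; case: (root_coord_sign rm) => s; [left|right]; split=> //.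
  exact: pos (root_coord_neq0 rm) v0.
rewrite -oppr_gt0 -pairingNl -root_formN; apply: pos => //.
  by move=> j; rewrite oppr_ge0.
by have [j mj] := root_coord_neq0 rm; exists j; rewrite oppr_eq0.
Qed.

Lemma root_chamber_sign a : Delta a ->
  (forall c, C c -> 0 < pairing a c) \/ (forall c, C c -> pairing a c < 0).
Proof.
case/all_rootsP=> m rm ->.
have rho0 j : 0 < pairing (al j) rho by rewrite root_rho.
case: (root_pos_or_neg rm rho0) => [[s _]|[s _]]; [left|right] => c Cc;
  case: (root_pos_or_neg rm Cc) => [[s' p]|[s' p]] //.
all: by exfalso; have [j mj] := root_coord_neq0 rm; have := s j; have := s' j; move/eqP: mj; lia.
Qed.

(** Since the coefficients of a root share one sign, its sign on F^v(J) depends only on whether it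
    involves a simple root outside J. *)
Lemma root_vface_sign a Fv : Delta a -> is_vface Fv ->
  [\/ forall v, Fv v -> 0 < pairing a v, forall v, Fv v -> pairing a v = 0
    | forall v, Fv v -> pairing a v < 0].
Proof.
move=> Da [b [w [J [ww ->]]]].
have core a' : Delta a' -> [\/ forall v, fund_face J v -> 0 < pairing a' v,
    forall v, fund_face J v -> pairing a' v = 0 | forall v, fund_face J v -> pairing a' v < 0].
  case/all_rootsP=> m rm ->.
  have pos m' v : (forall j, 0 <= m' j) -> (exists2 j, m' j != 0 & j \notin J) ->
      fund_face J v -> 0 < pairing (root_form R m') v.
    move=> m0 [j mj jJ] v0; rewrite root_formE (bigD1 j) //= ltr_pwDl //.
      by have := v0 j; rewrite (negPf jJ) => vj; rewrite mulr_gt0 // ltr0z lt_def mj m0.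
    apply: sumr_ge0 => l _; have := v0 l; case: ifP => _; first by move=> ->; rewrite mulr0.
    by move=> vl; rewrite mulr_ge0 ?ler0z // ltW.
  have [[j mj jJ]|N] := pselect (exists2 j, m j != 0 & j \notin J).
    case: (root_coord_sign rm) => s; [constructor 1|constructor 3] => v Jv.
      by apply: pos => //; exists j.
    rewrite -oppr_gt0 -pairingNl -root_formN; apply: pos => //.
      by move=> l; rewrite oppr_ge0.
    by exists j; rewrite ?oppr_eq0.
  constructor 2 => v Jv; rewrite root_formE big1 // => j _.
  have := Jv j; case: ifP => [_ ->|/negbT jJ _]; first by rewrite mulr0.
  have -> : m j = 0 by apply/eqP; apply: contrapT => /negP mj; apply: N; exists j.
  by rewrite mul0r.
have [a' Da' a'E] := all_roots_weyl ww Da.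
have E v : pairing a (sgn b (w v)) = (if b then 1 else -1) * pairing a' v.
  by case: b; rewrite /= ?pairingN a'E ?mul1r ?mulN1r.
case: (core _ Da') => s; case: b E => E.
- by constructor 1 => _ [v Jv <-]; rewrite E mul1r; exact: s.
- by constructor 3 => _ [v Jv <-]; rewrite E mulN1r oppr_lt0; exact: s.
- by constructor 2 => _ [v Jv <-]; rewrite E s ?mulr0.
- by constructor 2 => _ [v Jv <-]; rewrite E s ?mulr0.
- by constructor 3 => _ [v Jv <-]; rewrite E mul1r; exact: s.
- by constructor 1 => _ [v Jv <-]; rewrite E mulN1r oppr_gt0; exact: s.
Qed.

Lemma near_all_roots_lt x (f : I -> R) : (forall j, pairing (al j) x < f j) ->
  nbhs x [set y | forall j, pairing (al j) y < f j].
Proof.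
move=> H; apply: (@filter_forall V I (fun j y => pairing (al j) y < f j) (nbhs x)) => j.
exact: nbhs_pairing_lt.
Qed.

(** The coefficients having one sign, |a(rho)| is the sum of their absolute values, that is, the
    height of a. *)
Lemma root_bound a v M : Delta a -> 0 <= M -> (forall j, `|pairing (al j) v| <= M) ->
  `|pairing a v| <= `|pairing a rho| * M.
Proof.
case/all_rootsP=> m rm -> M0 H.
have E : pairing (root_form R m) rho = \sum_j (m j)%:~R.
  by rewrite root_formE; apply: eq_bigr => j _; rewrite root_rho mulr1.
have -> : `|pairing (root_form R m) rho| = \sum_j `|(m j)%:~R|.
  rewrite E; case: (root_coord_sign rm) => s.
    rewrite ger0_norm; last by apply: sumr_ge0 => j _; rewrite ler0z.
    by apply: eq_bigr => j _; rewrite ger0_norm // ler0z.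
  rewrite ler0_norm; last by apply: sumr_le0 => j _; rewrite lerz0.
  by rewrite -sumrN; apply: eq_bigr => j _; rewrite ler0_norm // lerz0.
rewrite root_formE mulr_suml; apply: le_trans (ler_norm_sum _ _ _) _.
by apply: ler_sum => j _; rewrite normrM ler_wpM2l.
Qed.

(** The finite type is a box of integer vectors; its forms cover the roots of bounded height without
    all being roots. *)
Lemma bounded_height_finite H : exists (T : finType) (form : T -> Vd),
  forall a, Delta a -> `|pairing a rho| <= H -> exists f, form f = a.
Proof.
pose N := Num.bound H.
exists {ffun I -> 'I_(N + N).+1}, (fun f : {ffun I -> 'I_(N + N).+1} => root_form R (fun j => (f j)%:Z - N%:Z)).
move=> a Da; case/all_rootsP: (Da) => m rm aE aH.
have mN j : `|m j| <= N%:Z.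
  have h1 : `|(m j)%:~R : R| <= H.
    have B : `|pairing a (om j)| <= `|pairing a rho|.
      rewrite -[leRHS]mulr1; apply: root_bound => // l.
      by rewrite root_coweight; case: eqP; rewrite ?normr1 ?normr0.
    suff -> : (m j)%:~R = pairing a (om j) by exact: le_trans B aH.
    rewrite aE root_formE (bigD1 j) //= root_coweight eqxx mulr1 big1 ?addr0 // => l /negPf lj.
    by rewrite root_coweight lj mulr0.
  have : `|(m j)%:~R : R| < N%:R by apply: (le_lt_trans h1); apply: archi_boundP; exact: le_trans (normr_ge0 _) h1.
  by rewrite -intr_norm -[N%:R]/(N%:Z%:~R) ltr_int => /ltW.
have lt j : (absz (m j + N%:Z)%R < (N + N).+1)%N by have := mN j; lia.
exists [ffun j => Ordinal (lt j)].
by rewrite aE; congr root_form; apply/funext => j; rewrite ffunE /=; have := mN j; lia.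
Qed.

(** One neighbourhood serves all roots of bounded height at once. The infinitely many others need a
    uniform estimate, as in [strict_near_face]. *)
Lemma near_bounded_height z H (P : Vd -> V -> Prop) :
  (forall a, Delta a -> \forall y \near z, P a y) ->
  \forall y \near z, forall a, Delta a -> `|pairing a rho| <= H -> P a y.
Proof.
move=> HP; have [T [form formP]] := bounded_height_finite H.
have : nbhs z [set y | forall f : T, Delta (form f) -> P (form f) y].
  apply: (@filter_forall V T (fun f : T => [set y | Delta (form f) -> P (form f) y]) (nbhs z)) => f.
  have [Df|nDf] := pselect (Delta (form f)); last by apply: nearW => y /nDf.
  by apply: filterS (HP _ Df) => y Py _.
by apply: filterS => y Hy a Da /(formP a Da)[f fE]; have := Hy f; rewrite fE; exact.
Qed.

End Faces.

(** * A chamber whose closure contains the panel is determined by its side *)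

Section ChamberIdentification.
Variables (R : realType) (D : vectorial_data).
Variable g : kac_moody_algebra R[i] (@vd_matrix D).
Local Notation I := (vd_index D).
Local Notation V := 'rV[R]_(vd_rank D).
Local Notation Vd := 'cV[R]_(vd_rank D).
Local Notation al := (aroot R).
Local Notation C := (@fund_chamber R D).
Local Notation rho := (coweight_rho R D).
Local Notation Delta := (all_roots g).
Local Notation face := (face g).
Local Notation cell := (cell g).
Implicit Types (i j : I) (v x y z : V) (h : V -> V) (a : Vd).
Implicit Types (E O Fv : set V) (k : Vd -> option int).

Lemma segment_pointE x y (t : R) : x + t *: (y - x) = (1 - t) *: x + t *: y.
Proof. by apply/matrixP => r s; rewrite !mxE; ring. Qed.

Lemma near_along z v (P : V -> Prop) : (\forall y \near z, P y) ->
  exists2 t, 0 < t <= 1 & P (z + t *: v).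
Proof.
move=> /nbhs_along - /(_ v)[e e0 He]; exists (Num.min e 1).
  by rewrite lt_min e0 ltr01 ge_min lexx orbT.
by apply: He; rewrite ger0_norm ?ge_min ?lexx // le_min ler01 ltW.
Qed.

Lemma near_translate z Fv (P : V -> Prop) : (exists2 O, nbhs z O & forall v, Fv v -> O (z + v) -> P (z + v)) <->
  \forall y \near z, Fv (y - z) -> P y.
Proof.
split=> [[O zO H]|H].
  by apply: filterS zO => y Oy Fvy; have := H _ Fvy; rewrite addrC subrK; exact.
by exists [set y | Fv (y - z) -> P y] => // v Fvv /=; apply; rewrite addrAC subrr add0r.
Qed.

Section PositiveSide.
Variables (i : I) (x z : V) (Fv : set V).
Hypotheses (xi : pairing (al i) x = 1) (Fvf : is_vface Fv).
Hypothesis near_panel : forall E, face z Fv E -> face x (fund_face (finset.set1 i)) (closure E).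
Hypothesis positive_side : \forall y \near z, Fv (y - z) -> 1 < pairing (al i) y.

(** The conditions of the cell hold weakly at x, which is a limit of points of the panel, and at a
    point q reached from the panel towards the chamber, where every simple root exceeds its value at
    x. A point y of x + C close to x lies strictly between x and q for all simple roots; so a root
    positive on C is larger at y than at x, one negative on C larger at y than at q, and all
    conditions hold strictly at y, infinitely many as they are. *)
Lemma face_sub_chamber E : face z Fv E -> face x C E.
Proof.
move=> [k [k' [O [zO kE Ok]]]].
(* The level -1 on alpha_i adds the strict condition alpha_i > 1 to the cell. *)
pose ki a : option int := if a == al i then Some (-1) else None.
pose k1 a := omin (k' a) (ki a).
have k1E : cell k k1 = cell k k' `&` [set y | 1 < pairing (al i) y].
  apply/seteqP; split=> y.
    move=> H; split=> [a Da|].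
      by have [h1] := H a Da; rewrite /k1 open_half_space_omin => -[].
    have [_] := H _ (all_roots_simple g i); rewrite /k1 open_half_space_omin /ki eqxx => -[_] /=.
    by rewrite -[(-1)%:~R]/(- 1 : R) subr_gt0.
  move=> [H yi] a Da; have [h1 h2] := H a Da; split=> //; rewrite /k1 open_half_space_omin; split=> //.
  by rewrite /ki; case: eqP => // -> /=; rewrite -[(-1)%:~R]/(- 1 : R) subr_gt0.
have F1 : face z Fv (cell k k1).
  have /near_translate[O' zO' H'] := positive_side.
  apply: (@face_intro _ _ _ _ _ _ k k1 (O `&` O')) => //; first exact: filterI.
  move=> v Fvv [Ov O'v]; rewrite k1E; split; last exact: H'.
  by apply: Ok; split=> //; exists v.
have [O3 xO3 H3] := faceP (near_panel F1).
have [e e0 He] := nbhs_along (coweight_off R i) xO3.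
pose weak y := forall a p, Delta a -> k a = Some p \/ k1 a = Some p -> 0 <= pairing a y + p%:~R.
have clweak y : closure (cell k k1) y -> weak y.
  move=> cy a p Da kp; rewrite -[p%:~R]opprK subr_ge0; apply: closure_pairing_ge cy _ => u /(_ a Da)[h1 h2].
  rewrite -subr_ge0 opprK; case: kp => kp; first by move: h1; rewrite kp.
  by move: h2; rewrite kp => /ltW.
have weakt t : 0 < t <= e -> weak (x + t *: coweight_off R i).
  move=> /andP[t0 te]; apply/clweak/H3; first exact: fund_face_off.
  by apply: He; rewrite ger0_norm // ltW.
have weakx : weak x.
  move=> a p Da kp; apply: (@affine_limit _ _ (e * pairing a (coweight_off R i))) => t /andP[t0 t1].
  have te : 0 < t * e <= e by rewrite mulr_gt0 //= ger_pMl.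
  by have := weakt _ te a p Da kp; rewrite pairingD pairingZ mulrA addrAC.
pose q0 := x + e *: coweight_off R i.
have [O' zO' H'] := faceP F1.
have [v0 Fv0] := vface_nonempty Fvf.
have [t1 /andP[t10 _] O't] := near_along v0 zO'.
pose q1 := z + t1 *: v0.
have Pq1 : cell k k1 q1 by apply: H' => //; exact: vface_scale.
have q1i : 1 < pairing (al i) q1 by move: Pq1; rewrite k1E => -[].
have weakq1 : weak q1.
  move=> a p Da; have [h1 h2] := Pq1 a Da; case=> e1; first by move: h1; rewrite e1.
  by move: h2; rewrite e1 => /ltW.
have : \forall y \near q0, forall j, j != i -> pairing (al j) x < pairing (al j) y.
  have : nbhs q0 [set y | forall j, j != i -> pairing (al j) x < pairing (al j) y].
    apply: (@filter_forall V I (fun j y => j != i -> pairing (al j) x < pairing (al j) y) (nbhs q0)) => j.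
    have [->|ji] := eqVneq j i; first by apply: filterE.
    apply: filterS (@nbhs_pairing_gt R _ (al j) q0 (pairing (al j) x) _) => //.
    by rewrite /q0 pairingD pairingZ root_off ji mulr1 ltrDl.
  by [].
move=> /near_along - /(_ (q1 - q0))[t /andP[t0 t1'] qx].
pose q := q0 + t *: (q1 - q0).
have qE : q = (1 - t) *: q0 + t *: q1.
  exact: segment_pointE.
have weakq : weak q.
  move=> a p Da kp; rewrite qE pairingD !pairingZ.
  have h0 := weakt e _ a p Da kp; have h1 := weakq1 a p Da kp.
  have -> : (1 - t) * pairing a q0 + t * pairing a q1 + p%:~R =
    (1 - t) * (pairing a q0 + p%:~R) + t * (pairing a q1 + p%:~R) by ring.
  rewrite addr_ge0 // mulr_ge0 ?subr_ge0 //; last exact: ltW.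
  by apply: h0; rewrite e0 lexx.
have q0i : pairing (al i) q0 = 1 by rewrite /q0 pairingD pairingZ xi root_off eqxx mulr0 addr0.
have xq j : pairing (al j) x < pairing (al j) q.
  have [->|/qx //] := eqVneq j i.
  rewrite xi /q pairingD pairingZ pairingB q0i ltrDl mulr_gt0 // subr_gt0 //.
apply: face_sub kE _.
apply: (@face_intro _ _ _ _ _ _ k k' [set y | forall j, pairing (al j) y < pairing (al j) q]) => //.
  exact: near_all_roots_lt.
move=> c Cc /= cq a Da.
have pos p : k a = Some p \/ k1 a = Some p -> 0 < pairing a (x + c) + p%:~R.
  move=> kp; case: (root_chamber_sign Da) => s.
    have := weakx a p Da kp; have := s c Cc; rewrite pairingD; lra.
  have := weakq a p Da kp; have : pairing a (q - (x + c)) < 0.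
    by apply: s => j; rewrite pairingB subr_gt0.
  rewrite pairingB; lra.
split; first by case E1: (k a) => [p|//]; apply: ltW; apply: pos; left.
case E1: (k' a) => [p|//]; rewrite /=; case E2: (ki a) => [p'|]; last first.
  by apply: pos; right; rewrite /k1 E1 E2.
have := pos (Num.min p p'); rewrite /k1 E1 E2 => /(_ (or_intror erefl)) h.
by apply: lt_le_trans h _; rewrite lerD2l ler_int ge_min lexx.
Qed.

(** A root has a constant sign on F^v, so failing the conclusion means that the opposite weak
    inequality holds on the whole germ at z; by [face_sub_chamber] it would pass to x + C and
    contradict the assumption there. *)
Lemma root_transfer a (p : int) : Delta a ->
  (\forall y \near x, C (y - x) -> 0 < pairing a y + p%:~R) ->
  \forall y \near z, Fv (y - z) -> 0 < pairing a y + p%:~R.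
Proof.
move=> Da near_x; apply: contrapT => H.
have split_pairing y : pairing a y = pairing a z + pairing a (y - z).
  by rewrite pairingB addrC subrK.
have neg : \forall y \near z, Fv (y - z) -> pairing a y + p%:~R <= 0.
  have [zp|zp|zp] := ltgtP (pairing a z + p%:~R) 0.
  - have Hn : nbhs z [set y | pairing a y < - p%:~R] by apply: nbhs_pairing_lt; lra.
    by apply: filterS Hn => y /= yp _; lra.
  - case: H; have Hn : nbhs z [set y | - p%:~R < pairing a y] by apply: nbhs_pairing_gt; lra.
    by apply: filterS Hn => y /= yp _; lra.
  - case: (root_vface_sign Da Fvf) => s.
    + case: H; apply: filterE => y Fy; rewrite split_pairing addrAC zp add0r; exact: s.
    + by apply: filterE => y Fy; rewrite split_pairing addrAC zp add0r s.
    + by apply: filterE => y Fy; rewrite split_pairing addrAC zp add0r ltW ?s.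
have /face_sub_chamber/faceP/near_translate near_x' : face z Fv [set y | 0 <= pairing (- a) y + (- p)%:~R].
  have /near_translate[O zO HO] := neg; apply: (@face_enclosed _ _ _ _ _ O) => //.
    exact/enclosed_half/all_roots_opp.
  by move=> v Fvv Ov /=; rewrite pairingNl intrN -opprD oppr_ge0 HO.
have : \forall y \near x, C (y - x) -> False.
  apply: filterS2 near_x near_x' => y h1 h2 Cy; have := h1 Cy; have := h2 Cy.
  by rewrite /= pairingNl intrN -opprD oppr_ge0 => /le_lt_trans/[apply]; rewrite ltxx.
move=> /near_along - /(_ rho)[t /andP[t0 _]]; apply.
by rewrite addrAC subrr add0r; exact: fund_chamber_rho.
Qed.

(** With n the ceiling of a(x), the condition a > n - 1 holds near x on x + C, passes to z, and
    gives a(z) >= n - 1 >= a(x) - 1 up to rounding. The bound does not depend on the height of a. *)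
Lemma root_distance a : Delta a -> `|pairing a z - pairing a x| <= 1.
Proof.
have lower a' : Delta a' -> pairing a' x - 1 <= pairing a' z.
  move=> Da; set n := Num.ceil (pairing a' x).
  have nx : pairing a' x <= n%:~R by exact: ceil_ge.
  have xn : n%:~R - 1 < pairing a' x by have := ceilB1_lt (pairing a' x); rewrite intrB.
  have near_x : \forall y \near x, C (y - x) -> 0 < pairing a' y + (1 - n)%:~R.
    by apply: filterS (nbhs_pairing_gt xn) => y /=; rewrite intrB -subr_gt0 => h _; lra.
  have /near_translate[O zO H] := root_transfer Da near_x.
  have [v0 Fv0] := vface_nonempty Fvf.
  have [e e0 He] := nbhs_along v0 zO.
  have : 0 <= pairing a' z + (1 - n)%:~R.
    apply: (@affine_limit _ _ (e * pairing a' v0)) => t /andP[t0 t1].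
    have te : 0 < t * e by exact: mulr_gt0.
    have := H _ (vface_scale Fvf Fv0 te); rewrite pairingD pairingZ mulrA addrAC => /(_ _)/ltW; apply.
    by apply: He; rewrite ger0_norm ?(ltW te) // ger_pMl.
  rewrite intrB; lra.
move=> Da; have h1 := lower _ Da; have := lower _ (all_roots_opp Da); rewrite !pairingNl => h2.
by rewrite ler_norml; apply/andP; split; lra.
Qed.

Lemma negative_height_bound : exists H : R, forall a, Delta a -> 0 < pairing a rho ->
  (forall v, Fv v -> pairing a v < 0) -> pairing a rho <= H.
Proof.
pose k a := if `[< forall v, Fv v -> 0 < pairing a v >] then Some (- Num.floor (pairing a z)) else None.
have : face z Fv (\bigcap_(a in Delta) half_space a (k a)).
  apply: (@face_enclosed _ _ _ _ _ setT); [by exists k | exact: filterT |].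
  move=> v Fvv _ a Da; rewrite /k; case: asboolP => //= s.
  rewrite pairingD intrN; have := s v Fvv; have := floor_le (pairing a z); lra.
move=> /face_sub_chamber/faceP[O xO HO].
have [e /andP[e0 _] He] := near_along rho xO.
(* At x + e rho the opposite root - a satisfies the condition with level floor(- a(z)), so e a(rho)
   < a(z) - a(x) + 1 <= 2. *)
exists (2 / e) => a Da a0 aneg; rewrite ler_pdivlMr //.
have := HO _ (fund_chamber_rho e0) He _ (all_roots_opp Da).
rewrite /k asboolT; last by move=> v Fvv; rewrite pairingNl oppr_gt0; exact: aneg.
rewrite /= intrN !pairingNl pairingD pairingZ.
have := root_distance Da; rewrite ler_norml => /andP[_ h1].
have := floorD1_gt (- pairing a z); rewrite intrD; lra.
Qed.

(** Roots of bounded height are treated together. For a root nonnegative on F^v, the inequality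
    close to z propagates outwards along rays. A root negative on F^v of large height must be
    negative on C, and then the slack of the condition at x + s rho beats both the discrepancy 1
    between x and z and the variation near z. *)
Lemma strict_near_face (K : Vd -> option int) (s : R) : 0 < s ->
  (forall a p t, Delta a -> K a = Some p -> 0 < t <= s -> 0 <= pairing a x + t * pairing a rho + p%:~R) ->
  \forall y \near z, Fv (y - z) -> forall a p, Delta a -> K a = Some p -> 0 < pairing a y + p%:~R.
Proof.
move=> s0 HK.
have near_x a p : Delta a -> K a = Some p ->
    \forall y \near x, C (y - x) -> 0 < pairing a y + p%:~R.
  move=> Da Kp.
  have : \forall y \near x, forall j, pairing (al j) y < pairing (al j) x + s.
    by apply: near_all_roots_lt => j; rewrite ltrDl.
  apply: filterS => y ys Cy; case: (root_chamber_sign Da) => sg.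
    have h0 : 0 <= pairing a x + p%:~R.
      apply: (@affine_limit _ _ (s * pairing a rho)) => t /andP[t0 t1].
      rewrite addrAC mulrA; apply: HK => //; by rewrite mulr_gt0 //= ger_pMl.
    have := sg _ Cy; rewrite pairingB; lra.
  have := HK a p s Da Kp; rewrite s0 lexx => /(_ isT).
  have : pairing a (x + s *: rho - y) < 0.
    by apply: sg => j; rewrite pairingB subr_gt0 pairingD pairingZ root_rho mulr1.
  rewrite pairingB pairingD pairingZ; lra.
have germ a : Delta a -> \forall y \near z, Fv (y - z) -> forall p, K a = Some p -> 0 < pairing a y + p%:~R.
  move=> Da; case E: (K a) => [p|]; last by apply: filterE.
  by apply: filterS (root_transfer Da (near_x a p Da E)) => y Hy Fy _ [<-]; exact: Hy.
have [H1 H1P] := negative_height_bound.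
(* Beyond height 2 / s, half of the slack s |a(rho)| exceeds the 1 of [root_distance]; the other
   half bounds the variation on a neighbourhood of radius s / 2. *)
pose H := Num.max H1 (2 / s).
have near1 : \forall y \near z, forall a, Delta a -> `|pairing a rho| <= H ->
    Fv (y - z) -> forall p, K a = Some p -> 0 < pairing a y + p%:~R.
  exact: (@near_bounded_height _ _ g z H (fun a y => Fv (y - z) -> forall p, K a = Some p -> 0 < pairing a y + p%:~R)).
have near2 : \forall y \near z, forall j, pairing (al j) y < pairing (al j) z + s / 2.
  by apply: near_all_roots_lt => j; rewrite ltrDl divr_gt0.
have near3 : nbhs z [set y | forall j, pairing (al j) z - s / 2 < pairing (al j) y].
  apply: (@filter_forall V I (fun j y => pairing (al j) z - s / 2 < pairing (al j) y) (nbhs z)) => j.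
  by apply: nbhs_pairing_gt; rewrite gtrBl divr_gt0.
apply: filterS3 near1 near2 near3 => y Hy y2 y3 Fy a p Da Kp.
have [small|big] := leP `|pairing a rho| H; first exact: (Hy a Da small Fy p Kp).
have yE : pairing a y = pairing a z + pairing a (y - z) by rewrite pairingB addrC subrK.
have nonneg : 0 <= pairing a (y - z) -> 0 < pairing a y + p%:~R.
  move=> a0; have /near_translate[O zO HO] := germ a Da.
  have [t /andP[t0 t1] Ot] := near_along (y - z) zO.
  have := HO _ (vface_scale Fvf Fy t0) Ot p Kp; rewrite yE pairingD pairingZ.
  have : t * pairing a (y - z) <= pairing a (y - z) by rewrite ler_piMl.
  lra.
case: (root_vface_sign Da Fvf) => sg; [by apply/nonneg/ltW/sg | by apply: nonneg; rewrite sg |].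
have rho1 j : 0 < pairing (al j) rho by rewrite root_rho.
have Crho : C rho by [].
case: (root_chamber_sign Da) => sgC; have := sgC _ Crho => ar.
  have := H1P a Da ar sg; have : H1 < pairing a rho.
    by move: big; rewrite gtr0_norm // /H gt_max => /andP[].
  lra.
have hs : 2 / s < - pairing a rho.
  by move: big; rewrite ltr0_norm // /H gt_max => /andP[].
have := HK a p s Da Kp; rewrite s0 lexx => /(_ isT) h1.
have := root_distance Da; rewrite ler_norml => /andP[h2 _].
have s20 : 0 <= s / 2 by rewrite divr_ge0 // ltW.
have := @root_bound _ _ g a (y - z) (s / 2) Da s20 => h3.
have h4 : `|pairing a (y - z)| <= `|pairing a rho| * (s / 2).
  apply: h3 => j; rewrite pairingB ler_norml; have := y2 j; have := y3 j => h5 h6.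
  by apply/andP; split; lra.
move: h4; rewrite (ltr0_norm ar) ler_norml => /andP[h4 _].
move: hs; rewrite ltr_pdivrMr // => hs.
rewrite yE; lra.
Qed.

Lemma chamber_sub_face E : face x C E -> face z Fv E.
Proof.
move=> [k [k' [O [xO kE Ok]]]].
have [s s0 Hs] := nbhs_along rho xO.
have cellt t : 0 < t <= s -> cell k k' (x + t *: rho).
  move=> /andP[t0 ts]; apply: Ok; split; first by apply: Hs; rewrite ger0_norm // ltW.
  by exists (t *: rho) => //; exact: fund_chamber_rho.
have near1 : \forall y \near z, Fv (y - z) -> forall a p, Delta a -> k a = Some p -> 0 < pairing a y + p%:~R.
  apply: (strict_near_face s0) => a p t Da kp /cellt/(_ a Da)[]; rewrite kp /= pairingD pairingZ //.
have near2 : \forall y \near z, Fv (y - z) -> forall a p, Delta a -> k' a = Some p -> 0 < pairing a y + p%:~R.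
  apply: (strict_near_face s0) => a p t Da kp /cellt/(_ a Da)[_]; rewrite kp /= pairingD pairingZ.
  exact: ltW.
have /near_translate[O1 zO1 H1] := near1; have /near_translate[O2 zO2 H2] := near2.
apply: face_sub kE _; apply: (@face_intro _ _ _ _ _ _ k k' (O1 `&` O2)) => //; first exact: filterI.
move=> v Fvv [O1v O2v] a Da; split.
  by case E1: (k a) => [p|//]; apply: ltW; exact: H1 E1.
by case E1: (k' a) => [p|//]; exact: H2 E1.
Qed.

Lemma face_eq_chamber : face z Fv = face x C.
Proof. by apply/seteqP; split=> E; [exact: face_sub_chamber | exact: chamber_sub_face]. Qed.

End PositiveSide.
End ChamberIdentification.

(** * Panels and germs of chimneys *)

Section Panels.
Variables (R : realType) (D : vectorial_data).
Variable g : kac_moody_algebra R[i] (@vd_matrix D).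
Local Notation I := (vd_index D).
Local Notation V := 'rV[R]_(vd_rank D).
Local Notation Vd := 'cV[R]_(vd_rank D).
Local Notation al := (aroot R).
Local Notation refl := (@reflection R D).
Local Notation C := (@fund_chamber R D).
Local Notation Delta := (all_roots g).
Local Notation face := (face g).
Local Notation enclosed := (enclosed g).
Implicit Types (i j : I) (v x y z c : V) (a : Vd).
Implicit Types (E Q O Fv : set V) (k : Vd -> option int).
Local Notation F i := (fund_face (R := R) (D := D) (finset.set1 i)).
Local Notation rC i := [set refl i c | c in C].

Lemma affine_subspace_wall a (c : R) x : pairing a x = c ->
  affine_subspace (R := R) (D := D) [set y | pairing a y = c].
Proof.
move=> xc; exists x, (lker (linfun (mulmxr a))); apply/seteqP; split=> y /=.
  move=> yc; rewrite memv_ker lfunE /= -[_ *m _]/((y - x) *m a); apply/eqP/matrixP => r s.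
  by rewrite !ord1 [RHS]mxE -[LHS]/(pairing a (y - x)) pairingB yc xc subrr.
rewrite memv_ker lfunE /= => /eqP/matrixP/(_ 0 0); rewrite [RHS]mxE -[LHS]/(pairing a (y - x)).
by rewrite pairingB xc => /eqP; rewrite subr_eq0 => /eqP.
Qed.

Lemma enclosed_wall i : enclosed [set y | pairing (al i) y = 1].
Proof.
have -> : [set y | pairing (al i) y = 1] = [set y | 0 <= pairing (al i) y + (-1)%:~R] `&`
    [set y | 0 <= pairing (- al i) y + (1 : int)%:~R].
  apply/seteqP; split=> y /=; rewrite pairingNl.
    by move=> ->; rewrite -[(-1)%:~R]/(-1 : R) subrr addNr.
  by case; rewrite -[(-1)%:~R]/(-1 : R) -[1%:~R]/(1 : R) => ? ?; lra.
by apply: enclosedI; apply: enclosed_half; [exact: all_roots_simple | exact/all_roots_opp/all_roots_simple].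
Qed.

Lemma enclosed_le i : enclosed [set y | pairing (al i) y <= 1].
Proof.
have := enclosed_half 1 (all_roots_opp (all_roots_simple g i)); congr enclosed.
by apply/seteqP; split=> y /=; rewrite pairingNl -[1%:~R]/(1 : R) addrC subr_ge0.
Qed.

Lemma fund_face_root i v : F i v -> pairing (al i) v = 0.
Proof. by move=> /(_ i); rewrite finset.in_set1 eqxx. Qed.

Lemma reflection_fund_face i v : F i v -> refl i v = v.
Proof. by move=> /fund_face_root e; rewrite /reflection e scale0r subr0. Qed.

Lemma image_reflection_fund_face i : [set refl i v | v in F i] = F i.
Proof.
apply/seteqP; split=> [_ [v Fv <-]|v Fv]; first by rewrite reflection_fund_face.
by exists v => //; exact: reflection_fund_face.
Qed.

Lemma face_wall_reflection_gen i z Fv :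
  fmap (wall_reflection i) (face z Fv) = face (wall_reflection i z) [set refl i v | v in Fv].
Proof.
have L := coroot_lattice_coroot R i 1; rewrite scale1r in L.
exact: (face_affine g z Fv (weyl_reflection R i) L).
Qed.

Lemma face_wall_reflection i x Fv : pairing (al i) x = 1 ->
  fmap (wall_reflection i) (face x Fv) = face x [set refl i v | v in Fv].
Proof. by move=> xi; rewrite face_wall_reflection_gen wall_reflection_fix. Qed.

Lemma near_vface_sign i z Fv : is_vface Fv ->
  [\/ \forall y \near z, Fv (y - z) -> 1 < pairing (al i) y,
      \forall y \near z, Fv (y - z) -> pairing (al i) y = 1
    | \forall y \near z, Fv (y - z) -> pairing (al i) y < 1].
Proof.
move=> Fvf.
have split_pairing y : pairing (al i) y = pairing (al i) z + pairing (al i) (y - z).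
  by rewrite pairingB addrC subrK.
have [zi|zi|zi] := ltgtP (pairing (al i) z) 1.
- by constructor 3; apply: filterS (nbhs_pairing_lt zi) => y.
- by constructor 1; apply: filterS (nbhs_pairing_gt zi) => y.
case: (root_vface_sign (all_roots_simple g i) Fvf) => s; [constructor 1|constructor 2|constructor 3];
  apply: filterE => y Fy; rewrite split_pairing zi.
- by rewrite ltrDl s.
- by rewrite s ?addr0.
- by rewrite gtrDl s.
Qed.

(** Near z the face lies on one side of the wall or inside it; the latter is excluded, and the
    negative side reduces to the positive one by the reflection in the wall. *)
Lemma chamber_at_panel i x z Fv : pairing (al i) x = 1 -> is_vface Fv ->
  ~ face z Fv [set y | pairing (al i) y = 1] ->
  (forall E, face z Fv E -> face x (F i) (closure E)) ->
  face z Fv = face x C \/ face z Fv = face x (rC i).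
Proof.
move=> xi Fvf nwall clo; case: (near_vface_sign i z Fvf) => near_z.
- by left; exact: face_eq_chamber xi Fvf clo near_z.
- have /near_translate[O zO HO] := near_z.
  by case: nwall; apply: face_enclosed zO HO; exact: enclosed_wall.
right; set r := wall_reflection (R := R) i.
have rK : involutive r := @wall_reflectionK _ _ i.
have rc : continuous r := semidirect_continuous (affine_weyl_wall_reflection R i).
have fE : face (r z) [set refl i v | v in Fv] = fmap r (face z Fv) by rewrite face_wall_reflection_gen.
have : face (r z) [set refl i v | v in Fv] = face x C.
  apply: (face_eq_chamber xi (is_vface_image (weyl_reflection R i) Fvf)).
    move=> E; rewrite fE => /clo H.
    rewrite -[F i](image_reflection_fund_face i) -face_wall_reflection //=.
    apply: face_sub H => y cy B yB.
    have [u [Eu Bu]] := cy _ (rc y _ yB).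
    by exists (r u); split.
  have /near_translate[O zO HO] := near_z.
  apply/near_translate; exists (r @^-1` O); first by apply: rc; rewrite rK.
  move=> _ [v Fvv <-]; have -> : r z + refl i v = r (z + v).
    by rewrite /r /wall_reflection affine_shift //; exact: weyl_reflection.
  by rewrite /= rK => /(HO _ Fvv); rewrite root_wall_reflection; lra.
rewrite fE => e; rewrite -face_wall_reflection // -e.
apply/seteqP; split=> E /=; rewrite /fmap /=; have -> : r @^-1` (r @^-1` E) = E => //;
  by apply/seteqP; split=> y /=; rewrite rK.
Qed.

Lemma is_support_panel i x : pairing (al i) x = 1 ->
  is_support (face x (F i)) [set y | pairing (al i) y = 1].
Proof.
move=> xi; split; first exact: affine_subspace_wall xi.
  apply: (@face_enclosed _ _ _ _ _ setT) => //; [exact: enclosed_wall | exact: filterT |].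
  by move=> v /fund_face_root vi _ /=; rewrite pairingD xi vi addr0.
move=> Z [y0 [U ->]] /faceP[O xO HO] y /= yi.
have /nbhs_interior xO' := xO.
have [e e0 He] := nbhs_along (coweight_off R i) xO'.
have pt t : 0 < t <= e -> x + t *: coweight_off R i - y0 \in U.
  move=> /andP[t0 te]; apply: (HO _ (fund_face_off i t0)).
  by apply: (interior_subset (He _ _)); rewrite ger0_norm // ltW.
have e2 : 0 < e / 2 <= e by rewrite divr_gt0 //= ler_pdivrMr // ler_peMr ?ler1n // ltW.
have offU : (e / 2) *: coweight_off R i \in U.
  have ee : 0 < e <= e by rewrite e0 lexx.
  have := rpredB (pt _ ee) (pt _ e2).
  by congr (_ \in U); apply/matrixP => r s; rewrite !mxE; lra.
have xU : x - y0 \in U.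
  have := rpredB (pt _ e2) offU.
  by congr (_ \in U); rewrite addrAC addrK.
set p := x + (e / 2) *: coweight_off R i.
have pO : nbhs p O by apply: He; case/andP: e2 => e20 e2e; rewrite ger0_norm // ltW.
have p_off : nbhs p [set q | forall j, j != i -> pairing (al j) x < pairing (al j) q].
  apply: (@filter_forall V I (fun j q => j != i -> pairing (al j) x < pairing (al j) q) (nbhs p)) => j.
  have [->|ji] := eqVneq j i; first by apply: filterE.
  apply: filterS (@nbhs_pairing_gt R _ (al j) p (pairing (al j) x) _) => //.
  by rewrite /p pairingD pairingZ root_off ji mulr1 ltrDl divr_gt0.
have [t /andP[t0 _] [Ot offt]] := near_along (y - x) (filterI pO p_off).
have : p + t *: (y - x) - y0 \in U.
  have -> : p + t *: (y - x) = x + (p - x + t *: (y - x)) by rewrite addrA [x + _]addrC subrK.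
  apply: HO; last by rewrite addrA [x + _]addrC subrK.
  move=> j; rewrite finset.in_set1; case: eqP => [->|/eqP ji].
    rewrite /p !(pairingD, pairingN, pairingZ) root_off eqxx yi xi /=; lra.
  by have := offt j ji; rewrite /p !(pairingD, pairingN, pairingZ) => ?; lra.
have pU : p - y0 \in U by exact: pt.
move=> /rpredB/(_ pU).
have -> : p + t *: (y - x) - y0 - (p - y0) = t *: (y - x) by rewrite opprB addrA subrK addrAC subrr add0r.
move=> /(memvZ t^-1); rewrite scalerA mulVf ?scale1r ?gt_eqF // => yxU.
by have := rpredD yxU xU; rewrite addrA subrK.
Qed.

Lemma chimney_germP (G : set_system V) Fv Q : chimney_germ g G Fv Q ->
  exists Q' u E, [/\ enclosed Q', Q' `<=` Q, closure Fv u, G E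
    & forall y v, E y -> Fv v -> Q' (y + u + v)].
Proof.
move=> [u Fu [k [[E' GE' HE'] kQ]]].
exists (\bigcap_(a in Delta) half_space a (k a)), u, ((fun y => y + u) @^-1` E').
split=> //; first by exists k.
by move=> y v Ey Fvv; apply: HE'; exists (y + u) => //; exists v.
Qed.

Lemma chimney_germ_intro (G : set_system V) Fv Q Q' u E : (forall E E', E `<=` E' -> G E -> G E') ->
  enclosed Q' -> Q' `<=` Q -> closure Fv u -> G E ->
  (forall y v, E y -> Fv v -> Q' (y + u + v)) -> chimney_germ g G Fv Q.
Proof.
move=> Gup [k QE] QQ Fu GE H; exists u => //; exists k; rewrite -QE; split=> //.
exists [set y + u | y in E]; first by apply: Gup GE => y Ey; exists y.
by move=> _ [_ [y Ey <-] [v Fvv <-]]; exact: H.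
Qed.

Lemma chimney_germ_sub (G : set_system V) Fv Q Q' : Q `<=` Q' -> chimney_germ g G Fv Q -> chimney_germ g G Fv Q'.
Proof. by move=> QQ [u Fu [k [kE kQ]]]; exists u => //; exists k; split=> //; exact: subset_trans QQ. Qed.

Lemma closure_fund_face J u v : closure (fund_face J) u -> fund_face J v ->
  fund_face (R := R) (D := D) J (u + v).
Proof.
move=> Fu Fv j; have := Fv j; rewrite pairingD; case: ifP => jJ vj.
  rewrite vj addr0; apply/eqP; rewrite eq_le; apply/andP; split.
    rewrite -oppr_ge0 -pairingNl; apply: closure_pairing_ge Fu _ => y /(_ j).
    by rewrite jJ pairingNl => ->; rewrite oppr0.
  by apply: closure_pairing_ge Fu _ => y /(_ j); rewrite jJ => ->.
suff : 0 <= pairing (al j) u by lra.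
by apply: closure_pairing_ge Fu _ => y /(_ j); rewrite jJ => /ltW.
Qed.

Lemma closure_fund_face_root i u : closure (F i) u -> pairing (al i) u = 0.
Proof.
move=> Fu; have := fund_face_root (closure_fund_face Fu (fund_face_off i ltr01)).
by rewrite pairingD pairingZ root_off eqxx mulr0 addr0.
Qed.

Lemma closure_fund_faceD J u v : closure (fund_face J) u -> closure (fund_face J) v ->
  closure (fund_face (R := R) (D := D) J) (u + v).
Proof.
move=> Fu Fv B uvB.
have : nbhs v [set y | B (u + y)].
  have c : {for v, continuous (fun y : V => u + y)}.
    by apply: (@continuousD R V V (cst u) id); [exact: cst_continuous | exact: cvg_id].
  exact: c.
by move=> /Fv[y [Fy By]]; exists (u + y); split=> //; exact: closure_fund_face.
Qed.

Lemma chimney_germI (G : set_system V) J Q Q' : (forall E E', E `<=` E' -> G E -> G E') ->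
  (forall E E', G E -> G E' -> G (E `&` E')) ->
  chimney_germ g G (fund_face J) Q -> chimney_germ g G (fund_face J) Q' ->
  chimney_germ g G (fund_face (R := R) (D := D) J) (Q `&` Q').
Proof.
move=> Gup GI /chimney_germP[Q1 [u1 [E1 [Q1e Q1Q u1F GE1 H1]]]] /chimney_germP[Q2 [u2 [E2 [Q2e Q2Q u2F GE2 H2]]]].
apply: (@chimney_germ_intro _ _ _ (Q1 `&` Q2) (u1 + u2) (E1 `&` E2)) => //.
- exact: enclosedI.
- exact: setISS.
- exact: closure_fund_faceD.
- exact: GI.
move=> y v [E1y E2y] Fv; split.
  by have := H1 y (u2 + v) E1y (closure_fund_face u2F Fv); rewrite !addrA.
by have := H2 y (u1 + v) E2y (closure_fund_face u1F Fv); rewrite !addrA [y + u2 + u1]addrAC.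
Qed.

End Panels.

(** * Enclosed sets forced by germs; sector-germs as chimney germs *)

Section Sectors.
Variables (R : realType) (D : vectorial_data).
Variable g : kac_moody_algebra R[i] (@vd_matrix D).
Local Notation I := (vd_index D).
Local Notation V := 'rV[R]_(vd_rank D).
Local Notation Vd := 'cV[R]_(vd_rank D).
Local Notation al := (aroot R).
Local Notation refl := (@reflection R D).
Local Notation C := (@fund_chamber R D).
Local Notation rho := (coweight_rho R D).
Local Notation Delta := (all_roots g).
Local Notation face := (face g).
Local Notation enclosed := (enclosed g).
Implicit Types (i j l : I) (v x y z c : V) (w h : V -> V) (b : bool).
Implicit Types (E Q O : set V) (k : Vd -> option int).
Local Notation F i := (fund_face (R := R) (D := D) (finset.set1 i)).
Local Notation rC i := [set refl i c | c in C].
Local Notation Fmin := (fund_face (R := R) (D := D) finset.setT).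
Local Notation dir b w := [set sgn b (w c) | c in C].

(** A root involving some alpha_j with j other than i is bounded below along the panel, so it is
    positive and so is its image under r_i; hence it is no smaller at v than at y. The remaining
    roots are alpha_i and its opposite, and their integral levels cannot cut the strip between the
    walls alpha_i = 0 and alpha_i = 1. *)
Lemma strip_enclosed i x y Q v : enclosed Q -> pairing (al i) x = 1 ->
  chimney_germ g (face x (rC i)) (F i) Q -> Q y -> pairing (al i) y = 1 ->
  0 <= pairing (al i) v -> pairing (al i) v <= 1 ->
  (forall j, 0 <= pairing (al j) (refl i (v - y))) -> Q v.
Proof.
move=> [k QE] xi /chimney_germP[Q' [u [E [_ Q'Q Fu Ex H]]]] Qy yi v0 v1 vy.
have [O xO HO] := faceP Ex.
(* The factor 1 / 2 keeps alpha_i strictly between 0 and 1 at [p0], even for t = 1. *)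
have [t /andP[t0 t1] Ot] := near_along (refl i ((1 / 2) *: rho)) xO.
pose c := t *: ((1 / 2) *: rho).
have cE : t *: refl i ((1 / 2) *: rho) = refl i c.
  have := reflection_lin i t ((1 / 2) *: rho) 0.
  by rewrite !addr0 (linear_map0 (reflection_lin i)) addr0.
have Cc : C c by rewrite /c scalerA; apply: fund_chamber_rho; rewrite mulr_gt0 ?divr_gt0.
have Ec : E (x + refl i c) by apply: HO; [exists c | rewrite -cE].
set p0 := x + refl i c + u.
have p0i : pairing (al i) p0 < 1 /\ 0 < pairing (al i) p0.
  rewrite /p0 (pairingD _ (x + refl i c)) (pairingD _ x) (closure_fund_face_root Fu) root_reflection_same /c !pairingZ root_rho xi.
  by split; lra.
have Qp s : 0 < s -> Q (p0 + s *: coweight_off R i).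
  by move=> s0; apply/Q'Q/H => //; exact: fund_face_off.
rewrite QE => a Da; case ka: (k a) => [p|] //=.
have Qa z : Q z -> 0 <= pairing a z + p%:~R by rewrite QE => /(_ a Da); rewrite ka.
have [m rm aE] := (all_rootsP g a).1 Da.
have offE : pairing a (coweight_off R i) = \sum_(l | l != i) (m l)%:~R.
  rewrite aE root_formE [RHS]big_mkcond /=; apply: eq_bigr => l _; rewrite root_off.
  by case: (l != i); rewrite ?mulr1 ?mulr0.
have [[j ji mj]|N] := pselect (exists2 j, j != i & m j != 0).
  have mpos : forall l, 0 <= m l.
    case: (root_coord_sign rm) => // mneg; exfalso.
    have off0 : pairing a (coweight_off R i) < 0.
      rewrite offE (bigD1 j) //= -oppr_gt0 opprD ltr_pwDl //.
        by rewrite oppr_gt0 ltrz0 lt_neqAle mj mneg.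
      by rewrite oppr_ge0; apply: sumr_le0 => l _; rewrite lerz0.
    have s0 : 0 < (`|pairing a p0 + p%:~R| + 1) / - pairing a (coweight_off R i).
      by rewrite divr_gt0 ?oppr_gt0 // ltr_wpDl.
    have := Qa _ (Qp _ s0); rewrite pairingD pairingZ invrN mulrN mulNr divfK ?lt_eqF //.
    by have := ler_norm (pairing a p0 + p%:~R); lra.
  (* r_i changes only the i-th coefficient, so the positive j-th one fixes the sign of the reflected
     root. *)
  have rpos : forall l, 0 <= reflect_coord (@vd_matrix D) i m l.
    case: (root_coord_sign (root_coord_reflect i rm)) => // mneg; exfalso.
    have := mneg j; have := mpos j; rewrite /reflect_coord (negPf ji) mul0r subr0.
    by move/eqP: mj; lia.
  have avy : 0 <= pairing a (v - y).
    rewrite aE -[v - y](@reflectionK R D i) -root_form_reflect root_formE.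
    by apply: sumr_ge0 => l _; rewrite mulr_ge0 ?ler0z.
  by have := Qa _ Qy; move: avy; rewrite pairingB; lra.
have mz l : l != i -> m l = 0 by move=> li; apply/eqP/negPn/negP => ml; apply: N; exists l.
have aiE z : pairing a z = (m i)%:~R * pairing (al i) z.
  rewrite aE root_formE (bigD1 i) //= big1 ?addr0 // => l li.
  by rewrite mz ?mul0r.
case: (root_coord_single rm mz) => mi; rewrite mi in aiE.
  have := Qa _ (Qp _ ltr01); rewrite aiE mul1r pairingD pairingZ root_off eqxx mulr0 addr0 => h.
  (* Integrality of the level: alpha_i + p >= 0 at a point with alpha_i < 1 gives p > -1, hence p >=
     0. *)
  have : (- 1)%:~R < p%:~R :> R by rewrite intrN; case: p0i; lra.
  rewrite ltr_int => p1; have : 0%:~R <= p%:~R :> R by rewrite ler_int; lia.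
  by rewrite aiE mul1r; lra.
have := Qa _ Qy; rewrite !aiE yi intrN; lra.
Qed.

Lemma chamber_enclosed i x Q : enclosed Q -> pairing (al i) x = 1 -> Q x ->
  chimney_germ g (face x (rC i)) (F i) Q -> face x (rC i) Q.
Proof.
move=> Qe xi Qx HQ.
have x0 : 0 < pairing (al i) x by rewrite xi.
apply: (face_enclosed Qe (nbhs_pairing_gt x0)) => _ [c Cc <-] /= h.
apply: (strip_enclosed Qe xi HQ Qx xi); first exact: ltW.
  by rewrite pairingD xi root_reflection_same; have := Cc i; lra.
by move=> j; rewrite addrAC subrr add0r reflectionK ltW.
Qed.

(** By convexity: a point beyond the wall is a combination of a far point of p + F^v({i}) and a
    point of the sector q - r_i C. The wall itself is reached as a limit. *)
Lemma halfspace_enclosed i p q Q : enclosed Q -> pairing (al i) p = 1 ->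
  (forall n, F i n -> Q (p + n)) -> (forall c, C c -> Q (q - refl i c)) ->
  forall y, 1 <= pairing (al i) y -> Q y.
Proof.
move=> Qe pi Qp Qq.
suff gt1 y : 1 < pairing (al i) y -> Q y.
  move=> y yi; apply: (enclosed_limit (v := acoroot R i) Qe) => t /andP[t0 _].
  by apply: gt1; rewrite pairingD pairingZ root_coroot2; lra.
move=> y1; pose d := pairing (al i) y - 1.
have d0 : 0 < d by rewrite subr_gt0.
(* Chosen so that t (alpha_i(q) - 1) < alpha_i(y) - 1, which leaves the remainder e below a positive
   alpha_i-component. *)
pose t := d / (2 * (d + `|pairing (al i) q - 1|)).
have dq : 0 < d + `|pairing (al i) q - 1| by rewrite ltr_pwDl.
have t0 : 0 < t by rewrite divr_gt0 // mulr_gt0.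
have t1 : t < 1.
  rewrite ltr_pdivrMr ?mulr_gt0 // mul1r; have := normr_ge0 (pairing (al i) q - 1); lra.
have tq : t * (pairing (al i) q - 1) < d.
  have h1 : t * (pairing (al i) q - 1) <= t * (d + `|pairing (al i) q - 1|).
    by rewrite ler_wpM2l ?ltW //; have := ler_norm (pairing (al i) q - 1); lra.
  have h2 : t * (d + `|pairing (al i) q - 1|) = d / 2 by rewrite /t; field; rewrite gt_eqF.
  lra.
(* y = (1 - t)(p + n) + t(q - r_i c) with n far along the face *)
have [e eE] : exists e, e = y - (1 - t) *: p - t *: q by exists (y - (1 - t) *: p - t *: q).
have ei : 0 < pairing (al i) e.
  by move: tq; rewrite eE !pairingB !pairingZ pi /d; lra.
pose L := 1 + \sum_j (`|pairing (al j) e| + `|pairing (al i) e * (vd_matrix i j)%:~R|).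
have Lj j : `|pairing (al j) e| + `|pairing (al i) e * (vd_matrix i j)%:~R| < L.
  rewrite /L (bigD1 j) //= addrCA ltrDl ltr_pwDl // sumr_ge0 // => l _.
  by rewrite addr_ge0.
have L0 : 0 < L by apply: le_lt_trans (Lj i); rewrite addr_ge0.
pose n := (L / (1 - t)) *: coweight_off R i.
have Fn : F i n by apply: fund_face_off; rewrite divr_gt0 // subr_gt0.
pose c := t^-1 *: refl i (L *: coweight_off R i - e).
have Cc : C c.
  move=> j; rewrite /c pairingZ mulr_gt0 ?invr_gt0 //.
  have [->|ji] := eqVneq j i.
    by rewrite root_reflection_same pairingB pairingZ root_off eqxx mulr0 sub0r opprK.
  rewrite root_reflection !pairingB !pairingZ !root_off eqxx ji mulr0 mulr1 sub0r mulNr opprK.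
  have := Lj j; have := ler_norm (pairing (al j) e); have := lerNnormlW (lexx `|pairing (al i) e * (vd_matrix i j)%:~R|).
  lra.
have -> : y = (1 - t) *: (p + n) + t *: (q - refl i c).
  have -> : t *: (q - refl i c) = t *: q - (L *: coweight_off R i - e).
    rewrite scalerBr; congr (_ - _); rewrite /c.
    have := reflection_lin i t^-1 (refl i (L *: coweight_off R i - e)) 0.
    rewrite !addr0 (linear_map0 (reflection_lin i)) addr0 => ->.
    by rewrite reflectionK scalerA mulfV ?scale1r // gt_eqF.
  rewrite scalerDr /n scalerA mulrCA mulfV ?mulr1 ?subr_eq0 ?gt_eqF //.
  by rewrite eE; apply/matrixP => r s; rewrite !mxE; ring.
apply: (enclosed_convex Qe); [exact: Qp | exact: Qq | by rewrite (ltW t0) (ltW t1)].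
Qed.

Lemma halfspace_enclosed_opp i p q Q : enclosed Q -> pairing (al i) p = 1 ->
  (forall n, F i n -> Q (p + n)) -> (forall c, C c -> Q (q - c)) ->
  forall y, pairing (al i) y <= 1 -> Q y.
Proof.
move=> Qe pi Qp Qq y yi.
have aw := affine_weyl_wall_reflection R i.
rewrite -[y](@wall_reflectionK _ _ i) -[Q _]/((wall_reflection i @^-1` Q) _).
apply: (@halfspace_enclosed i p (wall_reflection i q)); [exact: enclosed_preimage| by [] | | |].
- move=> n Fn /=; rewrite wall_reflection_fix; first exact: Qp.
  by rewrite pairingD pi (fund_face_root Fn) addr0.
- move=> c Cc /=; rewrite /wall_reflection.
  have -> : refl i (refl i q + acoroot R i - refl i c) + acoroot R i = wall_reflection i (wall_reflection i q) - c.
    have rD u v : refl i (u + v) = refl i u + refl i v.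
      by have := reflection_lin i 1 u v; rewrite !scale1r.
    have rN v : refl i (- v) = - refl i v.
      by have := reflection_lin i (-1) v 0; rewrite !addr0 !scaleN1r (linear_map0 (reflection_lin i)) addr0.
    by rewrite /wall_reflection !rD rN (reflectionK i c) addrAC.
  by rewrite wall_reflectionK; exact: Qq.
- by rewrite root_wall_reflection; lra.
Qed.

Lemma directionP b w : weyl w -> exists f : I -> Vd,
  [/\ forall j, Delta (f j), forall v, dir b w v <-> forall j, 0 < pairing (f j) v
    & forall r : I -> R, exists v, forall j, pairing (f j) v = r j].
Proof.
move=> ww; have [w' [ww' k k']] := weyl_inv ww.
pose f j := if b then pull_form w' (al j) else - pull_form w' (al j).
have fE j v : pairing (f j) v = pairing (al j) (w' (sgn b v)).
  rewrite -(sgn_weyl _ _ ww') /f; case: b {f} => /=; rewrite ?pairingNl pairing_pull ?pairingN //; exact: weyl_lin.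
have sK v : sgn b (sgn b v) = v by case: b {f fE}; rewrite //= opprK.
exists f; split.
- move=> j; have := pull_form_root ww' (all_roots_simple g j).
  by rewrite /f; case: b {f fE sK} => // /all_roots_opp.
- move=> v; split=> [[c Cc <-] j|H]; first by rewrite fE sK k; exact: Cc.
  by exists (w' (sgn b v)); [move=> j; rewrite -fE | rewrite k' sK].
- move=> r; exists (sgn b (w (coweight_sum r))) => j.
  by rewrite fE sK k root_coweight_sum.
Qed.

Lemma sector_face_germP b w x E : weyl w ->
  sector_face_germ x (dir b w) E <-> exists p, forall d, dir b w d -> E (p + d).
Proof.
move=> ww; have [f [_ fP fs]] := directionP b ww; split.
  by move=> [u _ H]; exists (x + u) => d dd; apply: H; exists d.
move=> [p H]; have [u uE] := fs (fun j => `|pairing (f j) (p - x)| + 1).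
exists u; first by apply: subset_closure; apply/fP => j; rewrite uE ltr_wpDl.
move=> _ [d dd <-]; have -> : x + u + d = p + (x + u - p + d) by rewrite addrA [p + _]addrC subrK.
apply/H/fP => j; have := (fP d).1 dd j; rewrite !(pairingD, pairingN) uE => dj.
by have := ler_norm (pairing (f j) (p - x)); rewrite pairingB; lra.
Qed.

(** [Fmin] is the minimal vectorial face, so [face y Fmin] stands in for the point y where the
    axioms ask for a face. Sector-germs thereby become chimney germs, to which the masure axioms
    apply. N and M round p and y to integers because enclosed sets only have integral levels. *)
Lemma chimney_germ_sector b w y E : weyl w ->
  chimney_germ g (face y Fmin) (dir b w) E <-> exists p, forall d, dir b w d -> E (p + d).
Proof.
move=> ww; have [f [fD fP fs]] := directionP b ww; split.
  move=> /chimney_germP[Q [u [E' [_ QE _ /faceP[O yO HO] H]]]]; exists (y + u) => d dd.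
  apply/QE/H => //; have F0 : Fmin 0 by move=> j; rewrite finset.in_setT pairing0.
  by have := HO 0 F0; rewrite addr0; apply; exact: nbhs_singleton.
move=> [p H]; pose N j := Num.floor (pairing (f j) p) + 1.
pose M j := Num.floor (pairing (f j) y).
have encl (K : I -> int) : enclosed [set v | forall j, 0 <= pairing (f j) v + (- K j)%:~R].
  by apply: (@enclosed_all _ _ g I (fun j => [set v | 0 <= pairing (f j) v + (- K j)%:~R])) => j; exact: enclosed_half.
have [u uE] := fs (fun j => `|(N j - M j)%:~R| + 1).
apply: (@chimney_germ_intro _ _ _ _ _ _ [set v | forall j, 0 <= pairing (f j) v + (- N j)%:~R] u
   [set v | forall j, 0 <= pairing (f j) v + (- M j)%:~R]).
- by move=> E1 E2; exact: face_sub.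
- exact: encl.
- move=> v /= vN; have -> : v = p + (v - p) by rewrite addrC subrK.
  apply/H/fP => j; have := vN j; rewrite pairingB intrN /N.
  by have := floorD1_gt (pairing (f j) p); lra.
- by apply: subset_closure; apply/fP => j; rewrite uE ltr_wpDl.
- apply: (@face_enclosed _ _ _ _ _ setT); [exact: encl | exact: filterT |].
  move=> v Fv _ j /=; rewrite pairingD intrN.
  have -> : pairing (f j) v = 0.
    have [m _ ->] := (all_rootsP g _).1 (fD j).
    rewrite root_formE big1 // => l _.
    by have := Fv l; rewrite finset.in_setT => ->; rewrite mulr0.
  by have := floor_le (pairing (f j) y); rewrite -/(M j); lra.
- move=> v d vM /fP dd j; have := vM j; have := dd j; rewrite !pairingD uE !intrN.
  by have := ler_norm ((N j - M j)%:~R : R); rewrite intrB; lra.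
Qed.

Lemma sector_germ_chimney b w x y : weyl w ->
  sector_face_germ x (dir b w) = chimney_germ g (face y Fmin) (dir b w).
Proof.
move=> ww; apply/seteqP; split=> E.
  by move=> /(sector_face_germP b x E ww)/(chimney_germ_sector b y E ww).
by move=> /(chimney_germ_sector b y E ww)/(sector_face_germP b x E ww).
Qed.

Lemma sector_infty_affine b w t : weyl w ->
  fmap (fun x => w x + t) (sector_infty b) = sector_face_germ 0 (dir b w) :> set_system V.
Proof.
move=> ww; have E0 : @sector_infty R D b = sector_face_germ 0 (dir b id) by [].
rewrite E0; apply/seteqP; split=> E.
  move=> /(sector_face_germP b 0 _ (weyl_id R D))[p H]; apply/(sector_face_germP b 0 _ ww).
  exists (w p + t) => _ [c Cc <-]; rewrite sgn_weyl // -affine_shift //; apply: H; by exists c.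
move=> /(sector_face_germP b 0 _ ww)[p H]; apply/(sector_face_germP b 0 _ (weyl_id R D)).
have [w' [ww' k k']] := weyl_inv ww.
exists (w' (p - t)) => _ [c Cc <-] /=; rewrite affine_shift // k' subrK -sgn_weyl //.
by apply: H; exists c.
Qed.

(** Differences of vectors of F^v({i}) span the direction of the wall, so w fixes it pointwise. For
    a vector c of C far along the wall, w c or r_i w c is again in C, and the freeness of the action
    of W on chambers concludes. *)
Lemma wall_fixer (T : set V) i p h : semidirect T h -> pairing (al i) p = 1 ->
  (forall n, F i n -> h (p + n) = p + n) -> h = id \/ h = wall_reflection i.
Proof.
move=> [w [t [ww _ ->]]] pi fixn.
have lw := weyl_lin ww.
have wD u v : w (u + v) = w u + w v by have := lw 1 u v; rewrite !scale1r.
have wZ s v : w (s *: v) = s *: w v by have := lw s v 0; rewrite !addr0 (linear_map0 lw) addr0.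
have wN v : w (- v) = - w v by rewrite -scaleN1r wZ scaleN1r.
have wF n n' : F i n -> F i n' -> w (n - n') = n - n'.
  move=> Fn Fn'; have e1 := canRL (addrK t) (fixn _ Fn); have e2 := canRL (addrK t) (fixn _ Fn').
  have -> : n - n' = (p + n) - (p + n') by rewrite opprD addrACA subrr add0r.
  by rewrite wD wN e1 e2 opprB addrA subrK.
have big v : exists2 L, 0 < L & forall j, - L < pairing (al j) v.
  exists (1 + \sum_j `|pairing (al j) v|).
    by rewrite ltr_pwDl // sumr_ge0.
  move=> j; rewrite ltrNl (bigD1 j) //=; have := lerNnormlW (lexx `|pairing (al j) v|).
  by have : 0 <= \sum_(l | l != j) `|pairing (al l) v| by [exact: sumr_ge0]; lra.
have woff s : 0 < s -> w (s *: coweight_off R i) = s *: coweight_off R i.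
  move=> s0; have -> : s *: coweight_off R i = (s + s) *: coweight_off R i - s *: coweight_off R i.
    by rewrite scalerDl addrK.
  by apply: wF; apply: fund_face_off; rewrite ?addr_gt0.
have wker v : pairing (al i) v = 0 -> w v = v.
  move=> vi; have [L L0 HL] := big v.
  have -> : v = (L *: coweight_off R i + v) - L *: coweight_off R i by rewrite addrAC subrr add0r.
  apply: wF; last exact: fund_face_off.
  move=> j; rewrite finset.in_set1 pairingD pairingZ root_off; have := HL j.
  by case: eqP => [->|_] /= ?; rewrite ?mulr1 ?mulr0 ?vi ?addr0 //; lra.
set av := acoroot R i; set be := pairing (al i) (w av).
have be0 : be != 0.
  apply/eqP => be0; have [w' [_ k _]] := weyl_inv ww.
  have := wker _ be0 => /(congr1 w'); rewrite !k => e.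
  by move: be0; rewrite /be e /av root_coroot2 => /eqP; rewrite pnatr_eq0.
have id_or : w = id \/ w = refl i.
  have [L1 L10 H1] := big (w av); have [L2 L20 H2] := big av.
  have [L3 L30 H3] := big (refl i (w av)).
  pose c := (L1 + L2 + L3) *: coweight_off R i + av.
  have L0 : 0 < L1 + L2 + L3 by rewrite !addr_gt0.
  have Cc : C c.
    move=> j; rewrite pairingD pairingZ root_off; have := H2 j.
    by case: eqP => [->|_] /=; rewrite ?mulr1 ?mulr0 ?root_coroot2; lra.
  have wc : w c = (L1 + L2 + L3) *: coweight_off R i + w av by rewrite wD woff.
  have [b0|b0|b0] := ltgtP be 0; last by rewrite b0 eqxx in be0.
    right; have e : refl i \o w = id.
      apply: (weyl_free (x := c)) => //; first exact: weyl_comp (weyl_reflection R i) ww.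
      move=> j /=; rewrite wc.
      have -> : refl i ((L1 + L2 + L3) *: coweight_off R i + w av) = (L1 + L2 + L3) *: coweight_off R i + refl i (w av).
        have := reflection_lin i 1 ((L1 + L2 + L3) *: coweight_off R i) (w av); rewrite !scale1r => ->.
        by rewrite (reflection_fund_face (fund_face_off i L0)).
      rewrite pairingD pairingZ root_off; have := H3 j.
      by case: eqP => [->|_] /=; rewrite ?mulr1 ?mulr0 ?root_reflection_same -/be; lra.
    apply/funext => v; have := congr1 (fun f : V -> V => refl i (f v)) e.
    by rewrite /= reflectionK.
  left; apply: (weyl_free (x := c)) => // j; rewrite wc pairingD pairingZ root_off; have := H1 j.
  by case: eqP => [->|_] /=; rewrite ?mulr1 ?mulr0 -/be; lra.
have Fo := fund_face_off (R := R) i ltr01.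
have := fixn _ Fo; set q := p + _ => qE.
have qi : pairing (al i) q = 1 by rewrite /q pairingD pi (fund_face_root Fo) addr0.
case: id_or => wE; move: qE; rewrite wE /=.
  by move=> e; left; apply/funext => v; move: e => /eqP; rewrite -subr_eq0 addrAC subrr add0r => /eqP ->; rewrite addr0.
rewrite /reflection qi scale1r => e; right; apply/funext => v; rewrite /wall_reflection.
by congr (_ + _); move/eqP: e; rewrite -addrA -subr_eq0 addrAC subrr add0r addrC subr_eq0 => /eqP.
Qed.

End Sectors.

(** * Branching along a wall *)

Section ModelGerms.
Variables (R : realType) (D : vectorial_data).
Variable g : kac_moody_algebra R[i] (@vd_matrix D).
Local Notation I := (vd_index D).
Local Notation V := 'rV[R]_(vd_rank D).
Local Notation Vd := 'cV[R]_(vd_rank D).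
Local Notation al := (aroot R).
Local Notation refl := (@reflection R D).
Local Notation C := (@fund_chamber R D).
Local Notation rho := (coweight_rho R D).
Local Notation face := (face g).
Local Notation enclosed := (enclosed g).
Implicit Types (i j : I) (v x y z c : V) (w : V -> V) (b : bool).
Implicit Types (E Q Fv : set V) (k : Vd -> option int).
Local Notation F i := (fund_face (R := R) (D := D) (finset.set1 i)).
Local Notation Fmin := (fund_face (R := R) (D := D) finset.setT).
Local Notation dir b w := [set sgn b (w c) | c in C].

Lemma closure_fund_chamber v : (forall j, 0 <= pairing (al j) v) -> closure C v.
Proof.
move=> v0 B /near_along - /(_ rho)[t /andP[t0 _] Bt]; exists (v + t *: rho); split=> // j.
by rewrite pairingD pairingZ root_rho mulr1 ltr_wpDl.
Qed.

(** Near [coweight_off] the simple roots other than alpha_i stay positive, also after r_i; so the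
    closures of C and of r_i C cover a neighbourhood. *)
Lemma spherical_panel i : spherical (F i).
Proof.
exists (coweight_off R i).
  by have := fund_face_off (R := R) i ltr01; rewrite scale1r.
left; have near1 : nbhs (coweight_off R i) [set y | forall j, j != i ->
    0 < pairing (al j) y /\ 0 < pairing (al j) (refl i y)].
  apply: (@filter_forall V I (fun j y => j != i -> 0 < pairing (al j) y /\ 0 < pairing (al j) (refl i y))
    (nbhs (coweight_off R i))) => j.
  have [->|ji] := eqVneq j i; first by apply: filterE.
  have n1 : nbhs (coweight_off R i) [set y | 0 < pairing (al j) y].
    by apply: nbhs_pairing_gt; rewrite root_off ji.
  have n2 : nbhs (coweight_off R i) [set y | 0 < pairing (al j) (refl i y)].
    apply: (@reflection_continuous R D i _ [set y | 0 < pairing (al j) y]); apply: nbhs_pairing_gt.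
    by rewrite root_reflection !root_off eqxx mul0r subr0 ji.
  by apply: filterS2 n1 n2 => y h1 h2 _.
apply: filterS near1 => y Hy; have [yi|yi] := leP 0 (pairing (al i) y).
  exists id; first exact: weyl_id.
  exists y => //; apply: closure_fund_chamber => j.
  by have [->//|/Hy[/ltW]] := eqVneq j i.
exists (refl i); first exact: weyl_reflection.
exists (refl i y); last exact: reflectionK.
apply: closure_fund_chamber => j; have [->|/Hy[_ /ltW]//] := eqVneq j i.
by rewrite root_reflection_same oppr_ge0 ltW.
Qed.

Lemma spherical_direction b w : weyl w -> spherical (dir b w).
Proof.
move=> ww; exists (sgn b (w (1 *: rho))); first by exists (1 *: rho) => //; exact: fund_chamber_rho.
have [w' [ww' k k']] := weyl_inv ww.
have T : (@tits_cone R D)° (w (1 *: rho)).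
  have near1 : nbhs (1 *: rho) [set y | forall j, 0 < pairing (al j) y].
    apply: (@filter_forall V I (fun j y => 0 < pairing (al j) y) (nbhs (1 *: rho))) => j.
    by apply: nbhs_pairing_gt; exact: fund_chamber_rho.
  have near2 : nbhs (w (1 *: rho)) (w' @^-1` [set y | forall j, 0 < pairing (al j) y]).
    by apply: (weyl_continuous ww'); rewrite k.
  apply: filterS near2 => y /= Hy; exists w => //; exists (w' y); last exact: k'.
  by apply: closure_fund_chamber => j; rewrite ltW // Hy.
by case: b; [left | right; rewrite /= opprK].
Qed.

Lemma solid_full (G : set_system V) Fv : (exists E, G E) ->
  (forall Z, affine_subspace Z -> chimney g G Fv Z -> setT `<=` Z) -> solid (chimney g G Fv).
Proof.
move=> [E GE] H; exists setT.
  split=> //; first by exists 0, fullv; apply/seteqP; split=> y //= _; exact: memvf.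
  by exists (fun=> None); rewrite /= bigcapT; split=> //; exists E.
apply: (@sub_finite_set _ _ [set id]); last exact: finite_set1.
move=> w [_ Hw]; apply/funext => v; apply: Hw; exists v => //; exists 0 => //.
by rewrite subr0.
Qed.

Lemma face_nonempty z Fv : exists E, face z Fv E.
Proof. by exists setT; apply: (@face_enclosed _ _ _ _ _ setT) => //; [exact: enclosedT | exact: filterT]. Qed.

Lemma solid_chamber (G : set_system V) : is_face g G -> is_support G setT -> solid (chimney g G Fmin).
Proof.
move=> [z [Fv [_ ->]]] [_ _ sup]; apply: solid_full; first exact: face_nonempty.
move=> Z aZ [k [[E GE HE] kZ]]; apply: sup => //; apply: face_sub GE => y Ey.
apply/kZ/HE; exists y => //; exists 0; last by rewrite addr0.
by move=> j; rewrite finset.in_setT pairing0.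
Qed.

Lemma solid_sector b w x : weyl w -> solid (chimney g (face x Fmin) (dir b w)).
Proof.
move=> ww; have [f [_ fP fs]] := directionP g b ww.
apply: solid_full; first exact: face_nonempty.
move=> Z [y0 [U ->]] [k [[E /faceP[O xO HO] HE] kZ]] y _ /=.
have F0 : Fmin 0 by move=> j; rewrite finset.in_setT pairing0.
have Ex : E x by have := HO 0 F0; rewrite addr0; apply; exact: nbhs_singleton.
have HU d : dir b w d -> x + d - y0 \in U by move=> dd; apply/(kZ (x + d))/HE; exists x => //; exists d.
have allU u : u \in U.
  have [d dE] := fs (fun j => `|pairing (f j) u| + 1).
  have dd : dir b w d by apply/fP => j; rewrite dE ltr_wpDl.
  have ud : dir b w (u + d).
    by apply/fP => j; rewrite pairingD dE; have := lerNnormlW (lexx `|pairing (f j) u|); lra.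
  have := rpredB (HU _ ud) (HU _ dd).
  by congr (_ \in U); apply/matrixP => r s; rewrite !mxE; ring.
exact: allU.
Qed.

Lemma is_face_face z Fv : is_vface Fv -> is_face g (face z Fv).
Proof. by exists z, Fv. Qed.

Lemma splayed_panel i x Fv : is_vface Fv -> is_splayed_chimney_germ g (chimney_germ g (face x Fv) (F i)).
Proof.
move=> Fvf; exists (face x Fv), (F i); split=> //; first exact: is_face_face.
- exact: is_vface_fund.
- exact: spherical_panel.
Qed.

Lemma splayed_sector b w x : weyl w -> is_splayed_chimney_germ g (chimney_germ g (face x Fmin) (dir b w)).
Proof.
move=> ww; exists (face x Fmin), (dir b w); split=> //.
- exact/is_face_face/is_vface_fund.
- exact: is_vface_sgn.
- exact: spherical_direction.
Qed.

Lemma solid_germ_sector b w x : weyl w ->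
  face_or_solid_germ g (chimney_germ g (face x Fmin) (dir b w)).
Proof.
move=> ww; right; exists (face x Fmin), (dir b w); split=> //.
- exact/is_face_face/is_vface_fund.
- exact: is_vface_sgn.
- exact: solid_sector.
Qed.

Lemma face_point v Q : enclosed Q -> face v Fmin Q <-> Q v.
Proof.
move=> Qe; split.
  move=> /faceP[O vO HO]; have F0 : Fmin 0 by move=> j; rewrite finset.in_setT pairing0.
  by have := HO 0 F0; rewrite addr0; apply; exact: nbhs_singleton.
move=> Qv; apply: (@face_enclosed _ _ _ _ _ setT) => //; first exact: filterT.
move=> u Fu _; case: Qe Qv => k -> Qv a Da; have := Qv a Da; case: (k a) => //= p.
rewrite pairingD; have -> // : pairing a u = 0; last by rewrite addr0.
have [m _ ->] := (all_rootsP g _).1 Da; rewrite root_formE big1 // => j _.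
by have := Fu j; rewrite finset.in_setT => ->; rewrite mulr0.
Qed.

End ModelGerms.

(** * The masure axioms read in charts *)

Section MasureCharts.
Variables (R : realType) (D : vectorial_data).
Variable g : kac_moody_algebra R[i] (@vd_matrix D).
Variable M : apartment_system R D.
Hypothesis HM : is_masure g M.
Local Notation V := 'rV[R]_(vd_rank D).
Local Notation enclosed := (enclosed g).
Implicit Types (A B : set M) (f : V -> M) (F G : set_system V).

Lemma chart_inj A f : apartment A -> charts A f -> injective f.
Proof.
move=> aA; have [f0 [inj _ ->]] := masure_MA1 HM aA; move=> [h hw <-] u v /inj.
by have [h' [_ k _]] := affine_weyl_inv g hw; exact: (can_inj k).
Qed.

Lemma chart_range A f : apartment A -> charts A f -> range f = A.
Proof.
move=> aA; have [f0 [inj <- ->]] := masure_MA1 HM aA; move=> [h hw <-].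
have [h' [_ k k']] := affine_weyl_inv g hw.
apply/seteqP; split=> _ [v _ <-]; first by exists (h v).
by exists (h' v) => //=; rewrite k'.
Qed.

Lemma chart_mem A f v : apartment A -> charts A f -> A (f v).
Proof. by move=> aA fA; rewrite -(chart_range aA fA); exists v. Qed.

Lemma chart_comp A f h : apartment A -> charts A f -> affine_weyl h -> charts A (f \o h).
Proof.
move=> aA; have [f0 [_ _ ->]] := masure_MA1 HM aA; move=> [h0 hw0 <-] hw.
by exists (h0 \o h) => //; exact: (affine_weyl_comp g).
Qed.

Lemma chart_diff A f f' : apartment A -> charts A f -> charts A f' ->
  exists2 h, affine_weyl h & f' = f \o h.
Proof.
move=> aA; have [f0 [_ _ ->]] := masure_MA1 HM aA; move=> [h hw <-] [h1 hw1 <-].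
have [h' [hw' k k']] := affine_weyl_inv g hw.
exists (h' \o h1); first exact: (affine_weyl_comp g).
by apply/funext => v /=; rewrite k'.
Qed.

Lemma chart_exists A : apartment A -> exists f, charts A f.
Proof.
move=> aA; have [f0 [_ _ ->]] := masure_MA1 HM aA; exists f0, id => //.
exact: affine_weyl_id.
Qed.

(* [f' = phi f]; [Q] is the enclosed set of points fixed by [phi], seen in [f]. *)
Lemma fixed_chart A A' f phi (F : set_system M) : apartment A -> apartment A' -> charts A f ->
  weyl_iso A A' phi -> fixes A phi (enclosure_in g A F) ->
  exists f' Q, [/\ charts A' f', enclosed Q, forall v, Q v -> f' v = f v & F (f @` Q)].
Proof.
move=> aA aA' fA iso [E [f1 f1A [k [FP PE]]] fixE].
have [f0' f0'A'] := chart_exists aA'; have [h0 hw0 phiE] := iso _ _ fA f0'A'.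
have [h hw f1E] := chart_diff aA fA f1A; have [h' [hw' kh kh']] := affine_weyl_inv g hw.
exists (f0' \o h0), (h' @^-1` \bigcap_(a in all_roots g) half_space a (k a)); split.
- exact: chart_comp.
- by apply: enclosed_preimage => //; exists k.
- move=> v /= Pv; rewrite -phiE; apply: fixE; first exact: (chart_mem _ aA fA).
  by have := PE _ Pv; rewrite /= f1E /= kh'.
move: FP; rewrite /pullback /=; congr F; rewrite f1E.
apply/seteqP; split=> _ [v Pv <-]; first by exists (h v) => //=; rewrite kh.
by exists (h' v) => //=; rewrite kh'.
Qed.

Lemma preimage_apartment A f (S : set V) : apartment A -> charts A f -> f @^-1` (f @` S) = S.
Proof.
move=> aA fA; apply/seteqP; split=> [v [u Su /(chart_inj aA fA) <- //]|v Sv].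
by exists v.
Qed.

Lemma splayed_up F : is_splayed_chimney_germ g F -> forall E E', E `<=` E' -> F E -> F E'.
Proof. by move=> [G [Fv [_ _ _ ->]]] E E'; exact: chimney_germ_sub. Qed.

Lemma face_or_solid_up F : face_or_solid_germ g F -> forall E E', E `<=` E' -> F E -> F E'.
Proof.
move=> [[z [Fv [_ ->]]]|[G [Fv [_ _ _ ->]]]] E E'; first exact: face_sub.
exact: chimney_germ_sub.
Qed.

Lemma MA3_charts A f A' f' F G : apartment A -> charts A f -> apartment A' -> charts A' f' ->
  is_splayed_chimney_germ g F -> face_or_solid_germ g G ->
  exists B, [/\ apartment B, F (f @^-1` B) & G (f' @^-1` B)].
Proof.
move=> aA fA aA' fA' sF sG.
have [|B [aB RB FB]] := masure_MA3 HM (Rg := fmap f F) (F := fmap f' G).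
  by split; [exists A => //; exists f, F | exists A' => //; exists f', G].
by exists B.
Qed.

(** The isomorphism of the axiom composed with f is a chart b of B, and its fixed points contain an
    enclosed set Q. As F and G are closed under supersets, Q belongs to each of them. *)
Lemma MA4_charts A f B F G : apartment A -> charts A f -> apartment B ->
  is_splayed_chimney_germ g F -> face_or_solid_germ g G ->
  F (f @^-1` B) -> G (f @^-1` B) ->
  exists b Q, [/\ charts B b, enclosed Q, forall v, Q v -> b v = f v, F Q & G Q].
Proof.
move=> aA fA aB sF sG FB GB.
have subA (S : set M) : f @^-1` S `<=` f @^-1` A by move=> v _; exact: (chart_mem _ aA fA).
have prem : ma4_premise g A B (fmap f F) (fmap f G).
  split=> //.
  - by split; [exists A => //; exists f, F | exists A => //; exists f, G].
  - by split; [exact: splayed_up FB | exact: face_or_solid_up GB].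
have [phi iso fixphi] := masure_MA4 HM prem.
have [b [Q [bB Qe bf [E1 FE1 [E2 GE2 EQ]]]]] := fixed_chart aA aB fA iso fixphi.
exists b, Q; split=> //.
  apply: splayed_up FE1 => // v E1v; rewrite -(preimage_apartment Q aA fA) -EQ; by left.
apply: face_or_solid_up GE2 => // v E1v; rewrite -(preimage_apartment Q aA fA) -EQ; by right.
Qed.

Lemma MA2_charts A f B F : apartment A -> charts A f -> apartment B -> ma2_filter g F ->
  F (f @^-1` B) -> exists b Q, [/\ charts B b, enclosed Q, forall v, Q v -> b v = f v & F Q].
Proof.
move=> aA fA aB mF FB.
have prem : ma2_premise g A B (fmap f F) by split=> //; exists f, F.
have [_ [phi iso fixphi]] := masure_MA2 HM prem.
have [b [Q [bB Qe bf FQ]]] := fixed_chart aA aB fA iso fixphi.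
by exists b, Q; split=> //; move: FQ; rewrite /fmap /= (preimage_apartment Q aA fA).
Qed.

Lemma MA2_point A f B v : apartment A -> charts A f -> apartment B -> B (f v) ->
  exists b Q, [/\ charts B b, enclosed Q, forall u, Q u -> b u = f u & Q v].
Proof.
move=> aA fA aB Bv.
have mF : ma2_filter g (globally [set v]) by constructor 1; exists v.
have [|b [Q [bB Qe bf FQ]]] := MA2_charts aA fA aB mF; first by move=> _ ->.
by exists b, Q; split=> //; exact: FQ.
Qed.

End MasureCharts.

(** * Germs of a panel and of a chamber along the wall *)

Section PanelGerms.
Variables (R : realType) (D : vectorial_data).
Variable g : kac_moody_algebra R[i] (@vd_matrix D).
Local Notation I := (vd_index D).
Local Notation V := 'rV[R]_(vd_rank D).
Local Notation Vd := 'cV[R]_(vd_rank D).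
Local Notation al := (aroot R).
Local Notation refl := (@reflection R D).
Local Notation C := (@fund_chamber R D).
Local Notation face := (face g).
Local Notation enclosed := (enclosed g).
Implicit Types (i : I) (v x y z c : V).
Implicit Types E Q O Fv : set V.
Local Notation F i := (fund_face (R := R) (D := D) (finset.set1 i)).
Local Notation rC i := [set refl i c | c in C].
Variables (i : I) (x : V).
Hypothesis xi : pairing (al i) x = 1.
Local Notation P0 := (face x (F i)).
Local Notation R0 := (chimney_germ g (face x (F i)) (F i)).
Local Notation RC := (chimney_germ g (face x (rC i)) (F i)).

Lemma closure_shift E Q u : enclosed Q -> (forall y, E y -> Q (y + u)) ->
  forall y, closure E y -> Q (y + u).
Proof.
move=> [k ->] H y cy a Da; case ka: (k a) => [p|] //=.
suff : - (p%:~R + pairing a u) <= pairing a y by rewrite pairingD; lra.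
apply: closure_pairing_ge cy _ => q /H/(_ a Da); rewrite ka /= pairingD; lra.
Qed.

Lemma panel_wall : P0 [set y | pairing (al i) y = 1].
Proof. by have [] := is_support_panel g xi. Qed.

Lemma closure_cone0 J : closure (fund_face (R := R) (D := D) J) 0.
Proof.
have [v Jv] := vface_nonempty (is_vface_fund R J).
move=> B /near_along - /(_ v)[t /andP[t0 _] Bt]; exists (t *: v); split; last by rewrite add0r in Bt.
exact: vface_scale (is_vface_fund R J) Jv t0.
Qed.

Lemma panel_germ_wall : R0 [set y | pairing (al i) y = 1].
Proof.
apply: (chimney_germ_intro _ (enclosed_wall g i) _ (closure_cone0 _) panel_wall) => //.
  by move=> E E'; exact: face_sub.
by move=> y v /= yi /fund_face_root vi; rewrite addr0 pairingD yi vi addr0.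
Qed.

Lemma chamber_germ_side : RC [set y | pairing (al i) y <= 1].
Proof.
apply: (@chimney_germ_intro _ _ _ _ _ _ _ 0 [set y | pairing (al i) y <= 1] _ (enclosed_le g i)) => //.
- by move=> E E'; exact: face_sub.
- exact: closure_cone0.
- apply: (@face_enclosed _ _ _ _ _ setT); [exact: enclosed_le | exact: filterT |].
  move=> _ [c Cc <-] _ /=; rewrite pairingD xi root_reflection_same; have := Cc i; lra.
by move=> y v /= yi /fund_face_root vi; rewrite addr0 pairingD vi addr0.
Qed.

Lemma panel_germ_point Q : R0 Q -> exists2 p, pairing (al i) p = 1 & forall n, F i n -> Q (p + n).
Proof.
move=> /chimney_germP[Q' [u [E [Q'e Q'Q Fu Ex H]]]]; have [O xO HO] := faceP Ex.
have [t /andP[t0 _] Ot] := near_along (coweight_off R i) xO.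
have Ft := fund_face_off (R := R) i t0.
exists (x + t *: coweight_off R i + u).
  by rewrite !pairingD xi (fund_face_root Ft) (closure_fund_face_root Fu) !addr0.
by move=> n Fn; apply/Q'Q/H => //; exact: HO.
Qed.

Lemma face_up z Fv : forall E E', E `<=` E' -> face z Fv E -> face z Fv E'.
Proof. by move=> E E'; exact: face_sub. Qed.

Lemma panel_germI Q Q' : R0 Q -> R0 Q' -> R0 (Q `&` Q').
Proof. by apply: chimney_germI; [exact: face_up | move=> E E'; exact: face_setI]. Qed.

Lemma chamber_germI Q Q' : RC Q -> RC Q' -> RC (Q `&` Q').
Proof. by apply: chimney_germI; [exact: face_up | move=> E E'; exact: face_setI]. Qed.

Hypothesis near_panel : forall E, face x (rC i) E -> P0 (closure E).

Lemma chamber_germ_panel Q : RC Q -> R0 Q.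
Proof.
move=> /chimney_germP[Q' [u [E [Q'e Q'Q Fu /near_panel Ex H]]]].
apply: (chimney_germ_intro _ Q'e Q'Q Fu Ex); first exact: face_up.
move=> y v cy Fv; rewrite -addrA; apply: closure_shift cy => // z Ez.
by rewrite addrA; exact: H.
Qed.

Lemma enclosed_panel Q : enclosed Q -> P0 Q -> Q x.
Proof.
move=> Qe /faceP[O xO HO]; have [e e0 He] := nbhs_along (coweight_off R i) xO.
apply: (enclosed_limit (v := e *: coweight_off R i) Qe) => t /andP[t0 t1].
rewrite scalerA; apply: HO; first by apply: fund_face_off; rewrite mulr_gt0.
by apply: He; rewrite ger0_norm ?ger_pMl // ltW // mulr_gt0.
Qed.

End PanelGerms.

Lemma exists_third (T : Type) (S : set T) a b : (`I_3 #<= S)%card -> exists c, [/\ S c, c <> a & c <> b].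
Proof.
move=> /card_leP[f]; apply: contrapT => N.
pose e k (k3 : `I_3 k) : `I_3 := exist _ k (mem_set k3).
pose F k k3 : T := set_val (f (@e k k3)).
have in3 k k3 : F k k3 = a \/ F k k3 = b.
  have Sk : S (F k k3) by exact: set_valP.
  by apply: contrapT => /not_orP[na nb]; apply: N; exists (F k k3).
have inj k l k3 l3 : F k k3 = F l l3 -> k = l.
  by move=> /val_inj/(@inj _ _ _ f _ _ (mem_set Logic.I) (mem_set Logic.I))/(congr1 set_val).
have [i0 i1 i2] : [/\ `I_3 0%N, `I_3 1%N & `I_3 2%N] by [].
have h0 := in3 0%N i0; have h1 := in3 1%N i1; have h2 := in3 2%N i2.
have n01 : F 0%N i0 <> F 1%N i1 by move/inj.
have n02 : F 0%N i0 <> F 2%N i2 by move/inj.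
have n12 : F 1%N i1 <> F 2%N i2 by move/inj.
by case: h0 => h0; case: h1 => h1; case: h2 => h2; congruence.
Qed.

(** * A third half-apartment along a wall *)

Section Branching.
Variables (R : realType) (D : vectorial_data).
Variable g : kac_moody_algebra R[i] (@vd_matrix D).
Local Notation I := (vd_index D).
Local Notation V := 'rV[R]_(vd_rank D).
Local Notation Vd := 'cV[R]_(vd_rank D).
Local Notation al := (aroot R).
Local Notation refl := (@reflection R D).
Local Notation C := (@fund_chamber R D).
Local Notation face := (face g).
Local Notation enclosed := (enclosed g).
Implicit Types (i : I) (v x y z c : V) (w h : V -> V) (a : Vd).
Implicit Types (E Q Fv : set V) (k : Vd -> option int).
Local Notation F i := (fund_face (R := R) (D := D) (finset.set1 i)).
Local Notation rC i := [set refl i c | c in C].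
Local Notation Fmin := (fund_face (R := R) (D := D) finset.setT).
Local Notation dir b w := [set sgn b (w c) | c in C].

Variable M : apartment_system R D.
Hypothesis HM : is_masure g M.
Hypothesis Mthick : thick_locally_finite g M.
Variables (A : set M) (f : V -> M) (i : I).
Hypotheses (aA : apartment A) (fA : charts A f).

Local Notation x := ((1 / 2 : R) *: acoroot R i).
Local Notation P0 := (face x (F i)).
Local Notation R0 := (chimney_germ g (face x (F i)) (F i)).
Local Notation C1 := (face x C).
Local Notation C2 := (face x (rC i)).
Local Notation RC := (chimney_germ g (face x (rC i)) (F i)).

Lemma panel_basepoint : pairing (al i) x = 1.
Proof. by rewrite pairingZ root_coroot2; lra. Qed.
Local Notation xi := panel_basepoint.

Lemma is_panel_face : is_panel g P0.
Proof.
split; first by exists x, (F i); split=> //; exact: is_vface_fund.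
exists [set y | pairing (al i) y = 1]; first exact: is_support_panel xi.
exists (al i), (-1); split.
  by exists (acoroot R i), i, id; split=> //; exact: weyl_id.
by apply/seteqP; split=> y; rewrite /wall /= -[(-1)%:~R]/(-1 : R) => h; lra.
Qed.

Lemma image_rC : [set refl i c | c in rC i] = C.
Proof.
rewrite image_comp (_ : refl i \o refl i = id) ?image_id //.
by apply/funext => v /=; rewrite reflectionK.
Qed.

Lemma wall_reflection_C1 : fmap (wall_reflection i) C1 = C2.
Proof. by rewrite face_wall_reflection // xi. Qed.

Lemma wall_reflection_C2 : fmap (wall_reflection i) C2 = C1.
Proof. by rewrite face_wall_reflection ?xi // image_rC. Qed.

Lemma fmap_agree (T : Type) (u v : V -> T) (G : set_system V) Q :
  (forall E E', E `<=` E' -> G E -> G E') -> (forall E E', G E -> G E' -> G (E `&` E')) ->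
  G Q -> (forall y, Q y -> u y = v y) -> fmap u G = fmap v G.
Proof.
move=> Gup GI GQ uv; apply/seteqP; split=> E GE; apply: Gup (GI _ _ GE GQ) => y [/= Ey Qy].
  by rewrite -uv.
by rewrite uv.
Qed.

(* [fmap b C2] is a chamber other than those of [A] with the panel [fmap f P0]
   in its closure, and [B] contains the germ of this panel along the wall. *)
Record third_chamber (B : set M) (b : V -> M) (Q : set V) : Prop := ThirdChamber {
  tc_apartment : apartment B;
  tc_chart : charts B b;
  tc_enclosed : enclosed Q;
  tc_wall : forall v, Q v -> pairing (al i) v = 1;
  tc_agree : forall v, Q v -> b v = f v;
  tc_germ : R0 Q;
  tc_panel : P0 Q;
  tc_closure : forall E, C2 E -> P0 (closure E);
  tc_neq1 : fmap b C2 <> fmap f C1;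
  tc_neq2 : fmap b C2 <> fmap f C2
}.

(** Thickness gives a chamber different from the two of A, but in an unrelated apartment. Some
    apartment B contains both this chamber and the germ of the panel along the wall. Read in a chart
    of B that agrees with f near the panel, the chamber is C1 or C2 by [chamber_at_panel], and a
    wall reflection turns C1 into C2. The field [tc_closure], although a statement about the model,
    is inherited from this chamber. *)
Lemma third_chamber_exists : exists B b Q, third_chamber B b Q.
Proof.
have mP : masure_filter (is_panel g) (fmap f P0).
  by exists A => //; exists f, P0; split=> //; exact: is_panel_face.
have [_ three] := Mthick mP.
have [Ch [[A1 [f1 [C0 [aA1 f1A1 [fC0 supC0] ChE clo]]]] ne1 ne2]] :=
  exists_third (fmap f C1) (fmap f C2) three.
have [z [Fv [Fvf C0E]]] := fC0.
have C0up E E' : E `<=` E' -> C0 E -> C0 E' by rewrite C0E; exact: face_sub.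
have C0I E E' : C0 E -> C0 E' -> C0 (E `&` E') by rewrite C0E; exact: face_setI.
(* A chamber has full support, so its chimney in the minimal direction is solid: MA2 applies to it
   and MA3 to its germ. *)
have solC0 := solid_chamber fC0 supC0.
have sgC0 : face_or_solid_germ g (chimney_germ g C0 Fmin).
  by right; exists C0, Fmin; split=> //; exact: is_vface_fund.
have sR0 : is_splayed_chimney_germ g R0 by apply: splayed_panel; exact: is_vface_fund.
have [B [aB RB CB]] := MA3_charts HM aA fA aA1 f1A1 sR0 sgC0.
have [Q' [u [E [Q'e Q'B Fu CE HE]]]] := chimney_germP CB.
have Fmu : Fmin (- u).
  have F0 : Fmin 0 by move=> j; rewrite finset.in_setT pairing0.
  have := closure_fund_face Fu F0; rewrite addr0 => Fmu j.
  by have := Fmu j; rewrite !finset.in_setT pairingN => ->; rewrite oppr0.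
have EQ' y : E y -> Q' y by move=> Ey; have := HE y (- u) Ey Fmu; rewrite addrK.
have clE y : closure E y -> Q' y.
  by move=> cy; apply: enclosed_closure Q'e _ => B' yB; have [q [/EQ' ? ?]] := cy _ yB; exists q.
have PB : P0 (f @^-1` B).
  apply: face_sub (clo E CE) => y [y' /clE/Q'B /=]; by move=> By' e; rewrite /= -e.
have CB2 : chimney g C0 Fmin (f1 @^-1` B).
  case: Q'e Q'B HE => k kE Q'B HE; exists k; rewrite -kE; split=> //.
  exists E => //; move=> _ [y Ey [v Fvv <-]].
  have -> : y + v = y + u + (- u + v) by rewrite addrA addrK.
  apply: HE => // j; have := Fvv j; have := Fmu j; rewrite !finset.in_setT pairingD => -> ->.
  by rewrite addr0.
have mC0 : ma2_filter g (chimney g C0 Fmin).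
  constructor 4; exists C0, Fmin; split=> //; exact: is_vface_fund.
have [f1' [Q2 [f1'B Q2e f1'f1 [k2 [[E2 CE2 HE2] k2Q]]]]] := MA2_charts HM aA1 f1A1 aB mC0 CB2.
have E2Q2 y : E2 y -> Q2 y.
  move=> Ey; apply/k2Q/HE2; exists y => //; exists 0; last by rewrite addr0.
  by move=> j; rewrite finset.in_setT pairing0.
have sP0 : face_or_solid_germ g P0 by left; apply: is_face_face; exact: is_vface_fund.
have [b0 [Qb [b0B Qbe b0f RQb PQb]]] := MA4_charts HM aA fA aB sR0 sP0 RB PB.
have [h hw f1'E] := chart_diff HM aB b0B f1'B.
have [w [t [ww Lt hE]]] := hw; have hc := semidirect_continuous hw.
pose C0' := face (h z) [set w v | v in Fv].
have C0'E : fmap h C0 = C0' by rewrite /C0' C0E hE; exact: (face_affine g z Fv ww Lt).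
have C0'P E' : C0' E' <-> C0 (h @^-1` E') by rewrite -C0'E.
have clo' E' : C0' E' -> P0 (closure E').
  move=> /C0'P CE'; have := clo _ (C0I _ _ CE' CE2) => cl2.
  apply: face_sub (face_setI cl2 PQb) => y [[y' cy' fy] Qy].
  have y'2 : Q2 y' by apply: enclosed_closure Q2e _; apply: closure_subset cy' => q [_ /E2Q2].
  have -> : y = h y'.
    by apply: (chart_inj HM aB b0B); rewrite b0f // -fy -f1'f1 // f1'E.
  by move=> B' /hc/cy'[q [[Eq _] Bq]]; exists (h q).
(* Otherwise the preimage of the wall would be a proper affine subspace belonging to C0, against its
   full support. *)
have nwall : ~ C0' [set y | pairing (al i) y = 1].
  move=> /C0'P CW; have [h' [_ kh kh']] := affine_weyl_inv g hw.
  have WE : h @^-1` [set y | pairing (al i) y = 1] =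
      [set y | pairing (pull_form w (al i)) y = 1 - pairing (al i) t].
    apply/seteqP; split=> y /=; rewrite pairing_pull ?hE ?pairingD; [lra| |lra|]; exact: weyl_lin.
  have h'1 : pairing (pull_form w (al i)) (h' x) = 1 - pairing (al i) t.
    have : [set y | pairing (al i) y = 1] (h (h' x)) by rewrite kh' /= xi.
    by move=> Hx; have : (h @^-1` [set y | pairing (al i) y = 1]) (h' x) by []; rewrite WE.
  rewrite WE in CW; have [_ _ sup] := supC0.
  have all1 := sup _ (affine_subspace_wall h'1) CW.
  have : (h @^-1` [set y | pairing (al i) y = 1]) (h' 0) by rewrite WE; exact: all1.
  by rewrite /= kh' pairing0 => /eqP; rewrite eq_sym oner_eq0.
have f1C0 : fmap f1 C0 = fmap b0 C0'.
  rewrite -C0'E; apply/seteqP; split=> E' /= CE'; apply: C0up (C0I _ _ CE' CE2) => y [/= Ey /E2Q2 Qy].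
    by have := f1'f1 y Qy; rewrite f1'E /= => ->.
  by have := f1'f1 y Qy; rewrite f1'E /= => <-.
have QW : R0 (Qb `&` [set y | pairing (al i) y = 1]) /\ P0 (Qb `&` [set y | pairing (al i) y = 1]).
  split; first by apply: panel_germI => //; apply: panel_germ_wall; exact: xi.
  by apply: face_setI => //; apply: panel_wall; exact: xi.
have QWe : enclosed (Qb `&` [set y | pairing (al i) y = 1]) by apply: enclosedI => //; exact: enclosed_wall.
case: (chamber_at_panel xi (is_vface_image ww Fvf) nwall clo') => C0'C; rewrite -/C0' in C0'C.
- have rw := affine_weyl_wall_reflection R i.
  have rc := semidirect_continuous rw.
  have b0C : fmap (b0 \o wall_reflection i) C2 = fmap b0 C1 by rewrite -wall_reflection_C2.
  have bCh : fmap b0 C1 = Ch by rewrite -C0'C -f1C0.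
  exists B, (b0 \o wall_reflection i), (Qb `&` [set y | pairing (al i) y = 1]); split.
  + exact: aB.
  + exact: chart_comp HM _ _ _ aB b0B rw.
  + exact: QWe.
  + by move=> v [].
  + by move=> v [Qv vi] /=; rewrite wall_reflection_fix // b0f.
  + exact: QW.1.
  + exact: QW.2.
  + move=> E' CE'; have : C0' (wall_reflection i @^-1` E') by rewrite C0'C -[face _ _ _]/(fmap (wall_reflection i) C1 E') wall_reflection_C1.
    move=> /clo' cl'; apply: face_sub (face_setI cl' (panel_wall g xi)) => y [cy yi].
    by rewrite -(wall_reflection_fix yi) => B' /rc/cy[q [Eq Bq]]; exists (wall_reflection i q).
  + by rewrite b0C bCh.
  + by rewrite b0C bCh.
have bCh : fmap b0 C2 = Ch by rewrite -C0'C -f1C0.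
exists B, b0, (Qb `&` [set y | pairing (al i) y = 1]); split.
+ exact: aB.
+ exact: b0B.
+ exact: QWe.
+ by move=> v [].
+ by move=> v [Qv _]; exact: b0f.
+ exact: QW.1.
+ exact: QW.2.
+ by move=> E'; rewrite -C0'C; exact: clo'.
+ by rewrite bCh.
+ by rewrite bCh.
Qed.

Section FromThirdChamber.
Variables (B : set M) (b : V -> M) (Q : set V).
Hypothesis tc : third_chamber B b Q.
Let aB := tc_apartment tc.
Let bB := tc_chart tc.

Lemma common_wall_point Q1 : R0 Q1 ->
  exists p, pairing (al i) p = 1 /\ forall n, F i n -> Q1 (p + n) /\ Q (p + n).
Proof.
move=> R1; have [p pi H] := panel_germ_point xi (panel_germI R1 (tc_germ tc)).
by exists p.
Qed.

Lemma splayed_chamber : is_splayed_chimney_germ g RC.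
Proof.
apply: splayed_panel; apply: is_vface_image; first exact: weyl_reflection.
by rewrite -fund_face0; exact: is_vface_fund.
Qed.

Lemma face_or_solid_panel : face_or_solid_germ g P0.
Proof. by left; apply: is_face_face; exact: is_vface_fund. Qed.

(** If A contained this germ, MA4 would give a chart of A agreeing with b on C2 and on part of the
    wall. It differs from f by the identity or the wall reflection, so b would map C2 onto a chamber
    of A at the panel. *)
Lemma chamber_germ_notin : ~ RC (b @^-1` A).
Proof.
move=> RA; have PA : P0 (b @^-1` A).
  by apply: face_sub (tc_panel tc) => v Qv /=; rewrite (tc_agree tc Qv); exact: (chart_mem HM _ aA fA).
have [a [Q2 [aA' Q2e ab RQ2 PQ2]]] :=
  MA4_charts HM aB bB aA splayed_chamber face_or_solid_panel RA PA.
have CQ2 := chamber_enclosed Q2e xi (enclosed_panel Q2e PQ2) RQ2.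
have [h hw aE] := chart_diff HM aA fA aA'.
have [p [pi H]] := common_wall_point (chamber_germ_panel (tc_closure tc) RQ2).
have hfix n : F i n -> h (p + n) = p + n.
  move=> /H[Q2n Qn]; apply: (chart_inj HM aA fA).
  by rewrite -[f (h _)]/((f \o h) _) -aE ab // (tc_agree tc Qn).
have bC : fmap b C2 = fmap f (fmap h C2).
  rewrite -[RHS]/(fmap (f \o h) C2) -aE.
  apply: (@fmap_agree _ b a _ Q2); [exact: face_up | by move=> ? ?; exact: face_setI | by [] | by move=> y /ab].
case: (wall_fixer hw pi hfix) => hE.
  by apply: (tc_neq2 tc); rewrite bC hE.
by apply: (tc_neq1 tc); rewrite bC hE wall_reflection_C2.
Qed.

(* For [w = r_i] (resp. [id]) such an apartment [B'] contains the half-apartment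
   [alpha_i >= 1] (resp. [alpha_i <= 1]) of [A]. *)
Lemma half_apartment w : weyl w -> exists (B' : set M) b' Q', [/\ apartment B', charts B' b', RC (b @^-1` B'),
  [/\ enclosed Q', R0 Q' & forall v, Q' v -> b' v = f v] &
  exists q, forall d, dir false w d -> Q' (q + d)].
Proof.
move=> ww; have sw := splayed_sector g false x ww; have fw := solid_germ_sector g false x ww.
have [B' [aB' RB' SB']] := MA3_charts HM aB bB aA fA splayed_chamber fw.
have RA : R0 (f @^-1` B').
  apply: chimney_germ_sub (panel_germI (chamber_germ_panel (tc_closure tc) RB') (tc_germ tc)).
  by move=> v [/= Bv Qv]; rewrite -(tc_agree tc Qv).
have sR0 : is_splayed_chimney_germ g R0 by apply: splayed_panel; exact: is_vface_fund.
have [b' [Q' [b'B' Q'e b'f RQ' SQ']]] := MA4_charts HM aA fA aB' sR0 fw RA SB'.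
by exists B', b', Q'; split=> //; exact: (chimney_germ_sector g false x Q' ww).1 SQ'.
Qed.

(** Three half-apartments meet along the wall: the two of A and a third one through the new chamber.
    B' joins the third one to alpha_i >= 1 and A' joins it to alpha_i <= 1. Comparing b' and e on
    the third one, both being f on the wall, leaves the identity or the wall reflection. The
    identity would put the third germ into A; the reflection sends 0 to alpha_i^vee. *)
Lemma branching_core : exists (B' : set M) b' (A' : set M) e, [/\ apartment B' /\ charts B' b', apartment A' /\ charts A' e,
  forall v, 1 <= pairing (al i) v -> b' v = f v, forall v, pairing (al i) v <= 1 -> e v = f v
  & b' 0 = e (acoroot R i)].
Proof.
have [B' [b' [Q' [aB' b'B' RB' [Q'e RQ' b'f] [q Hq]]]]] := half_apartment (weyl_reflection R i).
have [A' [e [Qe' [aE eE RE [Qee RQe ef] [qe Hqe]]]]] := half_apartment (weyl_id R D).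
have [p pi Hp] := panel_germ_point xi RQ'; have [pe pei Hpe] := panel_germ_point xi RQe.
have b'D v : 1 <= pairing (al i) v -> b' v = f v.
  move=> vi; apply: b'f; apply: (halfspace_enclosed (q := q) Q'e pi Hp) vi.
  by move=> c Cc; apply: Hq; exists c.
have eD v : pairing (al i) v <= 1 -> e v = f v.
  move=> vi; apply: ef; apply: (halfspace_enclosed_opp (q := qe) Qee pei Hpe) vi.
  by move=> c Cc; apply: Hqe; exists c.
exists B', b', A', e; split=> //.
have RA_of G : RC G -> (forall v, G v -> A (b v)) -> False.
  by move=> RG H; apply: chamber_germ_notin; exact: chimney_germ_sub H RG.
have Af v : A (f v) by exact: (chart_mem HM _ aA fA).
have PB' : P0 (b @^-1` B').
  apply: face_sub (tc_panel tc) => v Qv /=; rewrite (tc_agree tc Qv) -b'D.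
    exact: (chart_mem HM _ aB' b'B').
  by rewrite (tc_wall tc Qv).
have [b1 [Q1 [b1B' Q1e b1b RQ1 PQ1]]] :=
  MA4_charts HM aB bB aB' splayed_chamber face_or_solid_panel RB' PB'.
have [h1 h1w b1E] := chart_diff HM aB' b'B' b1B'.
have [p1 [p1i H1]] := common_wall_point (chamber_germ_panel (tc_closure tc) RQ1).
have fix1 n : F i n -> h1 (p1 + n) = p1 + n.
  move=> /H1[Q1n Qn]; apply: (chart_inj HM aB' b'B').
  rewrite -[b' (h1 _)]/((b' \o h1) _) -b1E b1b // (tc_agree tc Qn) b'D //.
  by rewrite (tc_wall tc Qn).
(* If the charts differed by the wall reflection, b would send the germ below the wall into f of
   alpha_i >= 1, hence into A. *)
have bb' v : Q1 v -> b v = b' v.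
  case: (wall_fixer h1w p1i fix1) => h1E; first by move=> /b1b <-; rewrite b1E h1E.
  exfalso; apply: (RA_of _ (chamber_germI RQ1 (chamber_germ_side g xi))) => u [Q1u /= ui].
  rewrite -b1b // b1E h1E /= b'D //; by rewrite root_wall_reflection; lra.
(* L moves y so far back along the wall that - y lies in the closure of r_i C; [strip_enclosed] then
   extends the agreement from y to 0. *)
pose L := \sum_j `|pairing (al j) x|.
pose y := x - L *: coweight_off R i.
have yi : pairing (al i) y = 1 by rewrite /y pairingB xi pairingZ root_off eqxx mulr0 subr0.
have RCE : RC (b' @^-1` A').
  apply: chimney_germ_sub (chamber_germI RE RQ1) => v [/= Ev Q1v].
  by rewrite -bb'.
have FE : face y Fmin (b' @^-1` A').
  apply: face_sub ((face_point (g := g) y (enclosed_wall g i)).2 yi) => v /= vi.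
  rewrite b'D ?vi // -eD ?vi //; exact: (chart_mem HM _ aE eE).
have fy : face_or_solid_germ g (face y Fmin) by left; apply: is_face_face; exact: is_vface_fund.
have [e1 [Q7 [e1E Q7e e1b' RQ7 FQ7]]] := MA4_charts HM aB' b'B' aE splayed_chamber fy RCE FE.
have Q7y := (face_point y Q7e).1 FQ7.
have [h hw e1h] := chart_diff HM aE eE e1E.
have [p7 [p7i H7]] := common_wall_point (chamber_germ_panel (tc_closure tc) RQ7).
have fix7 n : F i n -> h (p7 + n) = p7 + n.
  move=> Fn; have [Q7n _] := H7 n Fn; apply: (chart_inj HM aE eE).
  have ni : pairing (al i) (p7 + n) = 1 by rewrite pairingD p7i (fund_face_root Fn) addr0.
  by rewrite -[e (h _)]/((e \o h) _) -e1h e1b' // b'D ?ni // eD ?ni.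
(* With h = id, b would coincide with e, hence with f, on a set of the germ below the wall, and A
   would contain this germ. *)
case: (wall_fixer hw p7i fix7) => hE.
  exfalso; apply: (RA_of _ (chamber_germI RQ7 (chamber_germI RQ1 (chamber_germ_side g xi)))).
  by move=> u [Q7u [Q1u /= ui]]; rewrite bb' // -e1b' // e1h hE /= eD.
have Q70 : Q7 0.
  apply: (strip_enclosed Q7e xi RQ7 Q7y yi); rewrite ?pairing0 ?ler01 // => j.
  have -> : refl i (0 - y) = L *: coweight_off R i + x.
    have -> : 0 - y = L *: coweight_off R i - x by rewrite sub0r /y opprB.
    by rewrite /reflection pairingB pairingZ root_off eqxx mulr0 xi sub0r;
       apply/matrixP => r s; rewrite !mxE; lra.
  rewrite pairingD pairingZ root_off; have [->|ji] := eqVneq j i.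
    by rewrite mulr0 add0r xi.
  rewrite mulr1 /L (bigD1 j) //=; have := lerNnormlW (lexx `|pairing (al j) x|).
  have : 0 <= \sum_(l | l != j) `|pairing (al l) x| by exact: sumr_ge0.
  lra.
rewrite -e1b' // e1h hE /= /wall_reflection; congr e.
by rewrite (linear_map0 (reflection_lin i)) add0r.
Qed.

End FromThirdChamber.

Lemma branching : exists (B : set M) b (A' : set M) e, [/\ apartment B /\ charts B b, apartment A' /\ charts A' e,
  forall v, 1 <= pairing (al i) v -> b v = f v, forall v, pairing (al i) v <= 1 -> e v = f v
  & b 0 = e (acoroot R i)].
Proof. by have [B [b [Q tc]]] := third_chamber_exists; exact: branching_core tc. Qed.

End Branching.

(** * Roots of large height *)

Section LargeRoots.
Variables (R : realType) (D : vectorial_data).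
Variable g : kac_moody_algebra R[i] (@vd_matrix D).
Local Notation I := (vd_index D).
Local Notation V := 'rV[R]_(vd_rank D).
Local Notation Vd := 'cV[R]_(vd_rank D).
Local Notation al := (aroot R).
Local Notation refl := (@reflection R D).
Local Notation C := (@fund_chamber R D).
Local Notation rho := (coweight_rho R D).
Local Notation Delta := (all_roots g).
Implicit Types (i j l : I) (v c : V) (w : V -> V) (a : Vd) (b : bool).
Implicit Types k : Vd -> option int.
Local Notation weyl := (@weyl R D).

Lemma root_positive_or a : Delta a ->
  (forall c, C c -> 0 < pairing a c) \/ (forall c, C c -> 0 < pairing (- a) c).
Proof.
move=> /root_chamber_sign[s|s]; [by left | right => c Cc].
by rewrite pairingNl oppr_gt0 s.
Qed.

(** r_j permutes the positive roots other than alpha_j, and alpha_j has height 1. *)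
Lemma root_inversion j a : Delta a -> (forall c, C c -> 0 < pairing a c) ->
  (forall c, C c -> 0 < pairing a (refl j c)) \/ pairing a rho = 1.
Proof.
case/all_rootsP=> m rm -> pos.
have [[l lj ml]|N] := pselect (exists2 l, l != j & m l != 0).
  left=> c Cc; rewrite -root_form_reflect.
  case: (root_pos_or_neg (root_coord_reflect j rm) Cc) => [[_ //]|[neg _]]; exfalso.
  case: (root_pos_or_neg rm Cc) => [[s _]|[_ s]]; last by have := pos c Cc; rewrite ltNge ltW.
  have := neg l; have := s l; rewrite /reflect_coord (negPf lj) mul0r subr0.
  by move/eqP: ml; lia.
have mz l : l != j -> m l = 0 by move=> lj; apply/eqP/negPn/negP => ml; apply: N; exists l.
right; have rho0 : 0 < pairing (root_form R m) rho.
  by apply: pos => l; rewrite root_rho.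
move: rho0; have -> : pairing (root_form R m) rho = (m j)%:~R.
  rewrite root_formE (bigD1 j) //= root_rho mulr1 big1 ?addr0 // => l lj.
  by rewrite mz ?mul0r.
by case: (root_coord_single rm mz) => ->; rewrite // ltr0z.
Qed.

(** Only finitely many positive roots become negative under a given Weyl element, here in the form
    of a height bound. Induction on w: r_j divides the height by at most the constant N. *)
Lemma inversion_bound w : weyl w -> exists K : R, forall a, Delta a ->
  (forall c, C c -> 0 < pairing a c) -> K < pairing a rho ->
  forall c, C c -> 0 < pairing a (w c).
Proof.
elim=> [|j {}w ww [K HK]]; first by exists 0 => a Da pos _ c; exact: pos.
pose N := \sum_l `|pairing (al l) (refl j rho)|.
have N0 : 0 <= N by apply: sumr_ge0.
have Nl l : `|pairing (al l) (refl j rho)| <= N by rewrite /N (bigD1 l) //= lerDl sumr_ge0.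
exists (Num.max 1 (`|K| * N)) => a Da pos; rewrite gt_max => /andP[a1 aK] c Cc.
have [a' Da' a'E] := all_roots_weyl (weyl_reflection R j) Da.
have pos' c' : C c' -> 0 < pairing a' c'.
  move=> Cc'; rewrite a'E; case: (root_inversion j Da pos) => [|e]; first exact.
  by rewrite e ltxx in a1.
rewrite /= -a'E; apply: (HK a' Da' pos' _ c Cc).
have arho : pairing a rho = pairing a' (refl j rho) by rewrite a'E reflectionK.
have rho'0 : 0 < pairing a' rho by apply: pos' => l; rewrite root_rho.
have b := root_bound Da' N0 Nl; rewrite (gtr0_norm rho'0) -arho in b.
rewrite ltNge; apply/negP => a'K; move: aK; apply/negP; rewrite -leNgt.
apply: le_trans (ler_norm _) (le_trans b _); rewrite ler_wpM2r //.
exact: le_trans a'K (ler_norm _).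
Qed.

(** If the heights of the roots alpha_i o w were bounded, these roots would take finitely many
    values. They determine w, since the Weyl group acts freely on chambers, so the group would be
    finite. *)
Lemma weyl_infinite_roots : ~ finite_set weyl -> forall K : R, exists i w,
  [/\ weyl w, forall c, C c -> 0 < pairing (al i) (w c) & K < pairing (al i) (w rho)].
Proof.
move=> inf K; apply: contrapT => H; apply: inf.
have bnd i w : weyl w -> `|pairing (al i) (w rho)| <= `|K|.
  move=> ww; have up w' : weyl w' -> (forall c, C c -> 0 < pairing (al i) (w' c)) -> pairing (al i) (w' rho) <= K.
    by move=> ww' pos; rewrite leNgt; apply/negP => KK; apply: H; exists i, w'.
  have rhoC : C rho by move=> l; rewrite root_rho.
  have [a Da aE] := all_roots_weyl ww (all_roots_simple g i).
  case: (root_positive_or Da) => s.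
    have pos c : C c -> 0 < pairing (al i) (w c) by rewrite -aE; exact: s.
    by rewrite gtr0_norm ?pos //; apply: le_trans (up w ww pos) (ler_norm _).
  have pos c : C c -> 0 < pairing (al i) (refl i (w c)).
    by rewrite root_reflection_same -aE -pairingNl; exact: s.
  have := up _ (weyl_comp (weyl_reflection R i) ww) pos; have := pos _ rhoC.
  rewrite /= root_reflection_same => h1 h2.
  by rewrite ltr0_norm -?oppr_gt0 //; apply: le_trans h2 (ler_norm _).
have [T [form formP]] := bounded_height_finite g `|K|.
pose P (phi : {ffun I -> T}) : set (V -> V) := [set w | weyl w /\
  forall i v, pairing (form (phi i)) v = pairing (al i) (w v)].
(* One representative for each tuple of forms; [id] is a default value for tuples that no w
   realises. *)
pose sel phi : V -> V := if pselect (exists w, P phi w) is left e then projT1 (cid e) else id.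
have selP phi w : P phi w -> P phi (sel phi).
  by rewrite /sel; case: pselect => [e _|N Pw]; [exact: (projT2 (cid e)) | case: N; exists w].
apply: (@sub_finite_set _ _ (range sel)); last exact/finite_image/finite_finset.
move=> w ww.
have coords i : exists f, forall v, pairing (form f) v = pairing (al i) (w v).
  have [a Da aE] := all_roots_weyl ww (all_roots_simple g i).
  by have [|f fE] := formP a Da; [rewrite aE bnd | exists f; rewrite fE].
pose phi : {ffun I -> T} := [ffun i => projT1 (cid (coords i))].
have Pw : P phi w by split=> // i v; rewrite ffunE; exact: (projT2 (cid (coords i))).
exists phi => //; have [wu uE] := selP _ _ Pw.
have [_ wE] := Pw; have [w' [ww' k k']] := weyl_inv ww.
have e : sel phi \o w' = id.
  apply: (weyl_free (x := rho)); first exact: weyl_comp.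
    by move=> l; rewrite root_rho.
  by move=> l; rewrite /= -uE wE k' root_rho.
by apply/funext => v; have := congr1 (@^~ (w v)) e; rewrite /= k.
Qed.

Lemma large_root w : ~ finite_set weyl -> weyl w -> forall K : R, exists i u,
  [/\ weyl u, forall c, C c -> 0 < pairing (al i) (u c),
      forall c, C c -> 0 < pairing (al i) (u (w c)) & K < pairing (al i) (u rho)].
Proof.
move=> inf ww K; have [K' HK'] := inversion_bound ww.
have [i [u [wu pos big]]] := weyl_infinite_roots inf (Num.max K K').
have [a Da aE] := all_roots_weyl wu (all_roots_simple g i).
move: big; rewrite gt_max => /andP[bK bK'].
exists i, u; split=> // c Cc; rewrite -aE; apply: HK' Cc => //; last by rewrite aE.
by move=> c' Cc'; rewrite aE; exact: pos.
Qed.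

End LargeRoots.

Lemma coord_le_norm (R : realType) n (v : 'rV[R]_n) k : `|v 0 k| <= `|v|.
Proof. by rewrite [leRHS]/Num.Def.normr /= mx_normrE; apply/bigmax_geP; right => /=; exists (0, k). Qed.

(** * Norms on the model apartment and separation of the lattice *)

Section Norms.
Variables (R : realType) (D : vectorial_data) (N : 'rV[R]_(vd_rank D) -> R).
Hypothesis normN : is_norm N.
Local Notation V := 'rV[R]_(vd_rank D).
Local Notation Lat := (@lattice R D).
Implicit Types u v l : V.

Lemma is_norm_ge0 v : 0 <= N v. Proof. by case: normN. Qed.
Lemma is_norm_eq0 v : N v = 0 -> v = 0. Proof. by case: normN => _ /(_ v). Qed.
Lemma is_normZ a v : N (a *: v) = `|a| * N v. Proof. by case: normN. Qed.
Lemma is_normD u v : N (u + v) <= N u + N v. Proof. by case: normN. Qed.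

Lemma is_norm0 : N 0 = 0.
Proof. by rewrite -(scale0r (0 : V)) is_normZ normr0 mul0r. Qed.

Lemma is_normN v : N (- v) = N v.
Proof. by rewrite -scaleN1r is_normZ normrN1 mul1r. Qed.

Lemma is_norm_sgn b v : N (sgn b v) = N v.
Proof. by case: b => //=; exact: is_normN. Qed.

Lemma is_norm_le_sup : exists2 L, 0 <= L & forall v, N v <= L * `|v|.
Proof.
exists (\sum_k N (delta_mx 0 k)); first by apply: sumr_ge0 => k _; exact: is_norm_ge0.
move=> v; rewrite {1}(row_sum_delta v) mulr_suml.
elim/big_rec2: _ => [|k s u _ IH]; first by rewrite is_norm0.
apply: le_trans (is_normD _ _) (lerD _ IH).
by rewrite is_normZ mulrC ler_wpM2l ?is_norm_ge0 // coord_le_norm.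
Qed.

Lemma is_norm_continuous : continuous N.
Proof.
have [L L0 HL] := is_norm_le_sup.
move=> v B /nbhs_normP[e /= e0 He]; have L1 : 0 < L + 1 by rewrite ltr_wpDl.
have near1 : nbhs v (ball v (e / (L + 1))) by apply: nbhsx_ballx; rewrite divr_gt0.
rewrite mx_norm_ball in near1.
apply: filterS near1 => u /= uv; apply: He => /=.
have b : `|N v - N u| <= N (v - u).
  have h1 := is_normD (v - u) u; have h2 := is_normD (u - v) v.
  rewrite subrK in h1; rewrite subrK -(opprB v u) is_normN in h2.
  by rewrite ler_norml; apply/andP; split; lra.
apply: (le_lt_trans b); apply: (le_lt_trans (HL _)).
have : (L + 1) * `|v - u| < e by rewrite mulrC -ltr_pdivlMr.
by have := normr_ge0 (v - u); lra.
Qed.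

Lemma is_norm_ge_sup : exists2 c, 0 < c & forall v, c * `|v| <= N v.
Proof.
have [N0|/existsNP[v0 /eqP v0N]] := pselect (forall v : V, v = 0).
  by exists 1 => // v; rewrite (N0 v) normr0 mulr0 is_norm_ge0.
pose S := [set v : V | `|v| = 1].
have unit v : v != 0 -> S (`|v|^-1 *: v).
  move=> vn; rewrite /S /= normrZ normfV normr_id mulVf //.
  by rewrite normr_eq0.
have cS : compact S.
  apply: bounded_closed_compact.
    by exists 1; split=> // M M1 v /= ->; exact: ltW.
  apply: (@closed_comp _ _ (fun v : V => `|v|) [set 1]); last exact: closed_eq.
  by move=> v _; exact: norm_continuous.
have [||v vS vmin] := @compact_EVT_min _ _ N S _ cS; first by exists (`|v0|^-1 *: v0); exact: unit.
  by apply: continuous_subspaceT; exact: is_norm_continuous.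
rewrite inE /S /= in vS; have Nv0 : 0 < N v.
  rewrite lt_neqAle is_norm_ge0 andbT; apply/eqP => /esym/is_norm_eq0 e.
  by move: vS; rewrite e normr0 => /eqP; rewrite eq_sym oner_eq0.
exists (N v) => // u; have [->|u0] := eqVneq u 0; first by rewrite normr0 mulr0 is_norm_ge0.
have nu : 0 < `|u| by rewrite normr_gt0.
have := vmin _ (mem_set (unit _ u0)); rewrite is_normZ normfV normr_id.
by rewrite mulrC ler_pdivlMr.
Qed.

Lemma lattice_acoroot i : Lat (acoroot R i).
Proof. by exists (vd_coroot i). Qed.

Lemma latticeB u v : Lat u -> Lat v -> Lat (u - v).
Proof. by move=> [u' _ <-] [v' _ <-]; exists (u' - v') => //; rewrite raddfB. Qed.

Lemma lattice_weyl w u : weyl w -> Lat u -> Lat (w u).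
Proof.
elim=> [//|i {}w _ IH] Lu; have [y _ yE] := IH Lu; rewrite /= /reflection -yE.
apply: latticeB; first by exists y.
exists (pairing (vd_root i) y *: vd_coroot i) => //.
by rewrite map_mxZ /pairing /aroot -map_mxM !mxE.
Qed.

(** Either a = 0, and a nonzero lattice vector has a coordinate of absolute value at least 1, or a
    has a coordinate that is not an integer and hence stays away from all integers. *)
Lemma lattice_separated a : ~ (Lat a /\ a <> 0) ->
  exists2 e, 0 < e & forall l, Lat l -> l <> 0 -> e <= N (a - l).
Proof.
have [c c0 Hc] := is_norm_ge_sup => Ha.
have small (e : R) : 0 < e ->
    (forall y : 'rV[int]_(vd_rank D), map_mx intr y <> 0 :> V -> exists k, e <= `|a 0 k - (y 0 k)%:~R|) ->
    exists2 e, 0 < e & forall l, Lat l -> l <> 0 -> e <= N (a - l).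
  move=> e0 H; exists (c * e); first by rewrite mulr_gt0.
  move=> _ [y _ <-] /H[k ek]; apply: le_trans (Hc _); rewrite ler_pM2l //.
  by apply: le_trans (coord_le_norm _ k); rewrite !mxE.
have [a0|an0] := pselect (a = 0).
  apply: (small 1) => // y; rewrite a0 => /eqP yn; have : exists k, y 0 k != 0.
    apply: contrapT => N0; case/eqP: yn; apply/rowP => k; rewrite !mxE.
    by have [->|ky] := eqVneq (y 0 k) 0; [| case: N0; exists k].
  move=> [k yk]; exists k; rewrite mxE sub0r normrN -intr_norm ler1z.
  by move: yk; case: (y 0 k) => [[|?]|?].
have [k kn] : exists k, forall m : int, a 0 k != m%:~R.
  apply: contrapT => H; apply: Ha; split=> //.
  have mk k : exists m : int, a 0 k = m%:~R.
    by apply: contrapT => H'; apply: H; exists k => m; apply/eqP => e; apply: H'; exists m.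
  exists (\row_k projT1 (cid (mk k))) => //; apply/rowP => k; rewrite !mxE.
  by rewrite -(projT2 (cid (mk k))).
pose m := Num.floor (a 0 k).
have lo : m%:~R < a 0 k by rewrite lt_neqAle eq_sym kn floor_le.
have hi : a 0 k < m%:~R + 1 by have := floorD1_gt (a 0 k); rewrite intrD.
apply: (small (Num.min (a 0 k - m%:~R) (m%:~R + 1 - a 0 k))).
  by rewrite lt_min !subr_gt0 lo.
move=> y _; exists k; rewrite ge_min.
have [ym|ym] := leP (y 0 k) m.
  have : (y 0 k)%:~R <= m%:~R :> R by rewrite ler_int.
  by move=> h; apply/orP; left; rewrite ger0_norm; lra.
have : (m + 1)%:~R <= (y 0 k)%:~R :> R by rewrite ler_int -ltzD1; lia.
by rewrite intrD => h; apply/orP; right; rewrite ler0_norm; lra.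
Qed.

End Norms.

(** * Retractions and distances *)

Section SectorInfty.
Variables (R : realType) (D : vectorial_data).
Variable g : kac_moody_algebra R[i] (@vd_matrix D).
Variable b : bool.
Local Notation V := 'rV[R]_(vd_rank D).
Local Notation al := (aroot R).
Local Notation C := (@fund_chamber R D).
Local Notation rho := (coweight_rho R D).
Local Notation S := (@sector_infty R D b).
Implicit Types (u v t p c : V) (E : set V).

Lemma sgnK : involutive (@sgn R D b).
Proof. by rewrite /sgn; case: b => v //; rewrite opprK. Qed.

Lemma sgnD u v : sgn b (u + v) = sgn b u + sgn b v :> V.
Proof. by rewrite /sgn; case: b => //; rewrite opprD. Qed.

Lemma sgnN v : sgn b (- v) = - sgn b v :> V.
Proof. by rewrite /sgn; case: b. Qed.

Lemma chamber_shift v : exists2 c, C c & C (v + c).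
Proof.
pose L := 1 + \sum_j `|pairing (al j) v|.
have L0 : 0 < L by rewrite ltr_pwDl // sumr_ge0.
exists (L *: rho); first exact: fund_chamber_rho.
move=> j; rewrite pairingD pairingZ root_rho mulr1 /L (bigD1 j) //=.
have := lerNnormlW (lexx `|pairing (al j) v|).
by have : 0 <= \sum_(l | l != j) `|pairing (al l) v| by [exact: sumr_ge0]; lra.
Qed.

Lemma sector_inftyP E : S E <-> exists p, forall c, C c -> E (p + sgn b c).
Proof.
split=> [/(sector_face_germP g b 0 _ (weyl_id R D))[p H]|[p H]].
  by exists p => c Cc; apply: H; exists c.
by apply/(sector_face_germP g b 0 _ (weyl_id R D)); exists p => _ [c Cc <-]; exact: H.
Qed.

Lemma chamber_add u v : C u -> C v -> C (u + v).
Proof. by move=> Cu Cv j; rewrite pairingD addr_gt0. Qed.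

Lemma sector_infty_sub E E' : E `<=` E' -> S E -> S E'.
Proof.
by move=> EE /sector_inftyP[p H]; apply/sector_inftyP; exists p => c Cc; exact/EE/H.
Qed.

Lemma sector_inftyI E E' : S E -> S E' -> S (E `&` E').
Proof.
move=> /sector_inftyP[p H] /sector_inftyP[p' H']; apply/sector_inftyP.
have [c Cc Cc'] := chamber_shift (sgn b (p' - p)).
exists (p' + sgn b c) => d Cd; split.
  have -> : p' + sgn b c + sgn b d = p + sgn b (sgn b (p' - p) + c + d).
    by rewrite !sgnD !sgnK; apply/matrixP => r k; rewrite !mxE; ring.
  by apply: H; exact: chamber_add.
by rewrite -addrA -sgnD; apply: H'; exact: chamber_add.
Qed.

Lemma sector_infty_nonempty E : S E -> exists v, E v.
Proof.
by move=> /sector_inftyP[p H]; exists (p + sgn b (1 *: rho)); apply/H/fund_chamber_rho.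
Qed.

Lemma sector_infty_translate t E : S E -> S [set v | E (v + t)].
Proof.
move=> /sector_inftyP[p H]; apply/sector_inftyP; exists (p - t) => c Cc /=.
by rewrite addrAC subrK; exact: H.
Qed.

Lemma sector_infty_cone p : S [set p + sgn b c | c in C].
Proof. by apply/sector_inftyP; exists p => c Cc; exists c. Qed.

Lemma sector_inftyT : S setT.
Proof. by apply/sector_inftyP; exists 0. Qed.

Lemma fmap_sector_translate (T : Type) (f : V -> T) t :
  fmap (fun v => f (v + t)) S = fmap f S.
Proof.
apply/seteqP; split=> E H; last exact: (sector_infty_translate t H).
have := sector_infty_translate (- t) H; apply: sector_infty_sub => v /=.
by rewrite subrK.
Qed.

(* The germ at infinity determines the linear part: a nontrivial [w] makes some
   [alpha_t o w] negative on [C], so the image sector leaves [alpha_t >= 0]. *)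
Lemma sector_infty_linear w t : weyl w -> S [set v | forall j, 0 <= pairing (al j) (sgn b (w v + t))] ->
  w = id.
Proof.
move=> ww /sector_inftyP[p H]; apply: contrapT => /(weyl_neq1_side ww)[j neg].
have [a Da aE] := all_roots_weyl ww (all_roots_simple g j).
have Crho : C rho by move=> l; rewrite root_rho.
have a0 : pairing (al j) (w rho) < 0.
  have := neg _ Crho; rewrite le_eqVlt => /orP[/eqP e|//].
  by case: (root_positive_or Da) => /(_ rho Crho); rewrite ?pairingNl aE e ?oppr0 ltxx.
have wD u v : w (u + v) = w u + w v.
  by have := weyl_lin ww 1 u v; rewrite !scale1r.
have wZ s v : w (s *: v) = s *: w v.
  by have := weyl_lin ww s v 0; rewrite !addr0 (linear_map0 (weyl_lin ww)) addr0.
set q := pairing (al j) (sgn b (w p + t)).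
set r := (`|q| + 1) / - pairing (al j) (w rho).
have r0 : 0 < r by rewrite divr_gt0 ?oppr_gt0 // ltr_wpDl.
have := H (r *: rho) (fund_chamber_rho r0) j.
rewrite wD addrAC sgnD (sgn_weyl _ _ ww) sgnK pairingD wZ pairingZ -/q.
have -> : r * pairing (al j) (w rho) = - (`|q| + 1).
  by rewrite /r invrN mulrN mulNr mulfVK // lt_eqF.
have := ler_norm q; lra.
Qed.

End SectorInfty.

(** * Retraction centred at a sector-germ *)

Section Retraction.
Variables (R : realType) (D : vectorial_data).
Variable g : kac_moody_algebra R[i] (@vd_matrix D).
Variable M : apartment_system R D.
Hypothesis HM : is_masure g M.
Variables (b : bool) (s : set_system M).
Local Notation V := 'rV[R]_(vd_rank D).
Local Notation al := (aroot R).
Local Notation C := (@fund_chamber R D).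
Local Notation S := (@sector_infty R D b).
Local Notation Fmin := (fund_face (R := R) (D := D) finset.setT).
Implicit Types (u v t c : V) (psi : V -> M) (y : M).

(** All translations are allowed, not only those of the coroot lattice: this covers the isomorphisms
    in [sector_add] and makes the notion stable under moving the base point. *)
Definition sector_chart psi := exists A f h, 
  [/\ apartment A, charts A f, semidirect setT h, psi = f \o h & fmap psi S = s].

Lemma semidirectT_comp h h' : semidirect setT h -> semidirect setT h' ->
  semidirect (R := R) (D := D) setT (h \o h').
Proof. exact: semidirect_comp. Qed.

Lemma sector_chart_inj psi : sector_chart psi -> injective psi.
Proof.
move=> [A [f [h [aA fA hT -> _]]]] u v /(chart_inj HM aA fA).
by have [h' [_ k _]] := semidirect_inv (fun _ _ => Logic.I) (fun _ _ _ _ => Logic.I) hT; exact: (can_inj k).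
Qed.

Lemma sector_chart_chart A f : apartment A -> charts A f -> fmap f S = s -> sector_chart f.
Proof.
move=> aA fA fS; exists A, f, id; split=> //; exists id, 0; split=> //; first exact: weyl_id.
by apply/funext => v; rewrite addr0.
Qed.

Lemma sector_chart_translate psi t : sector_chart psi -> sector_chart (fun v => psi (v + t)).
Proof.
move=> [A [f [h [aA fA hT psiE psiS]]]]; exists A, f, (h \o (fun v => v + t)); split=> //.
- apply: semidirectT_comp => //; exists id, t; split=> //; exact: weyl_id.
- by rewrite psiE.
- by rewrite (fmap_sector_translate g).
Qed.

(** MA4, applied to the germ s and the common point, compares the two charts by a Weyl element
    followed by a translation. The linear part preserves the germ at infinity, so it is trivial, and
    the common point gives the translation. *)
Lemma sector_chart_agree psi1 psi2 v1 v2 : sector_chart psi1 -> sector_chart psi2 -> psi1 v1 = psi2 v2 ->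
  S [set v | psi1 v = psi2 (v + (v2 - v1))].
Proof.
move=> good1 good2 e; have inj2 := sector_chart_inj good2.
case: good1 => [A1 [f1 [h1 [aA1 fA1 h1T psi1E psi1S]]]].
case: good2 => [A2 [f2 [h2 [aA2 fA2 h2T psi2E psi2S]]]].
have [w1 [t1 [ww1 _ h1E]]] := h1T.
pose R0 := chimney_germ g (face g 0 Fmin) [set sgn b (w1 c) | c in C].
have R0E : R0 = fmap h1 S by rewrite h1E (sector_infty_affine g) // (sector_germ_chimney g _ 0 0).
have A2y : A2 (f1 (h1 v1)).
  by rewrite -[f1 _]/((f1 \o h1) v1) -psi1E e psi2E; exact: (chart_mem HM _ aA2 fA2).
have R0A2 : R0 (f1 @^-1` A2).
  rewrite R0E; suff : fmap psi1 S A2 by rewrite psi1E.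
  rewrite psi1S -psi2S; apply: (sector_infty_sub g) (sector_inftyT g b) => v _ /=.
  by rewrite psi2E; exact: (chart_mem HM _ aA2 fA2).
have FA2 : face g (h1 v1) Fmin (f1 @^-1` A2).
  have [b' [Q [bB Qe bf Qv]]] := MA2_point HM aA1 fA1 aA2 A2y.
  apply: face_sub ((face_point (h1 v1) Qe).2 Qv) => u /bf /= <-.
  exact: (chart_mem HM _ aA2 bB).
have sF : face_or_solid_germ g (face g (h1 v1) Fmin).
  by left; apply: is_face_face; exact: is_vface_fund.
have [b' [Q [bA2 Qe bf RQ FQ]]] := MA4_charts HM aA1 fA1 aA2 (splayed_sector g b 0 ww1) sF R0A2 FA2.
have Qv1 := (face_point _ Qe).1 FQ.
have [g' hg' bE] := chart_diff HM aA2 fA2 bA2.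
have [h2' [h2'T k k']] := semidirect_inv (fun _ _ => Logic.I) (fun _ _ _ _ => Logic.I) h2T.
have g'T : semidirect setT g' by have [w [t [ww _ ->]]] := hg'; exists w, t.
have [w [t [ww _ hE]]] := semidirectT_comp h2'T (semidirectT_comp g'T h1T).
have psi12 v : Q (h1 v) -> psi1 v = psi2 (w v + t).
  move=> Qv; have /= <- := congr1 (@^~ v) hE.
  by rewrite psi1E psi2E /= k' -bf // bE.
have SQ : S [set v | Q (h1 v)] by have := RQ; rewrite -/R0 R0E.
have wid : w = id.
  apply: (sector_infty_linear g ww (b := b) (t := t)).
  pose P := [set v : V | forall j, 0 <= pairing (al j) (sgn b v)].
  have SP : S P.
    by apply/(sector_inftyP g); exists 0 => c Cc j; rewrite add0r sgnK ltW.
  have : fmap psi1 S (psi2 @` P).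
    by rewrite psi1S -psi2S; apply: (sector_infty_sub g) SP => v Pv; exists v.
  move=> H; apply: (sector_infty_sub g) (sector_inftyI g H SQ) => v [[u Pu] /= e1 Qv].
  by move: e1; rewrite psi12 // => /inj2 <-.
have tE : v2 - v1 = t.
  by have := psi12 _ Qv1; rewrite e wid => /inj2 ->; rewrite addrAC subrr add0r.
by apply: (sector_infty_sub g) SQ => v /psi12 /= ->; rewrite wid tE.
Qed.

Lemma sector_chart_move (A : set M) f B : apartment A -> charts A f -> apartment B -> S (f @^-1` B) ->
  exists f', [/\ charts B f', fmap f' S = fmap f S & S [set u | f' u = f u]].
Proof.
move=> aA fA aB SB; have SE : S = chimney_germ g (face g 0 Fmin) [set sgn b c | c in C].
  by rewrite -(sector_germ_chimney g b 0 0 (weyl_id R D)).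
have ss := splayed_sector g b 0 (weyl_id R D); have fs := solid_germ_sector g b 0 (weyl_id R D).
move: SB; rewrite SE => SB; have [f' [Q [fB Qe ff SQ _]]] := MA4_charts HM aA fA aB ss fs SB SB.
rewrite -SE in SQ *; exists f'; split=> //; last by apply: (sector_infty_sub g) SQ => ? /ff.
by apply: fmap_agree SQ ff; [exact: (sector_infty_sub g) | exact: (sector_inftyI g)].
Qed.

(* [at_position y v]: the retraction onto the image of [f0] centred at [s] sends
   [y] to [f0 v]. *)
Variables (A0 : set M) (f0 : V -> M).
Hypotheses (aA0 : apartment A0) (fA0 : charts A0 f0) (f0S : fmap f0 S = s).

Definition at_position y v := exists psi,
  [/\ sector_chart psi, S [set u | psi u = f0 u] & psi v = y].

Lemma at_position_unique y v v' : at_position y v -> at_position y v' -> v = v'.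
Proof.
move=> [psi [good agree e]] [psi' [good' agree' e']].
have H := sector_chart_agree good good' (etrans e (esym e')).
have [u [[/= h1 h2] h3]] := sector_infty_nonempty g (sector_inftyI g (sector_inftyI g H agree)
  (sector_infty_translate g (v' - v) agree')).
have : f0 u = f0 (u + (v' - v)) by rewrite -h2 h1 h3.
move/(chart_inj HM aA0 fA0)/eqP; rewrite -subr_eq0 opprD addrA subrr sub0r opprB subr_eq0.
by move/eqP.
Qed.

Lemma at_position_chart y : exists B f v,
  [/\ apartment B /\ charts B f, fmap f S = s, S [set u | f u = f0 u] & f v = y].
Proof.
have [A1 aA1 A1y] := masure_cover HM y; have [f1 fA1] := chart_exists HM aA1.
have [u _ uy] : range f1 y by rewrite (chart_range HM aA1 fA1).
have ss := splayed_sector g b 0 (weyl_id R D).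
have sF : face_or_solid_germ g (face g u Fmin).
  by left; apply: is_face_face; exact: is_vface_fund.
have [B [aB RB /faceP[O uO HO]]] := MA3_charts HM aA0 fA0 aA1 fA1 ss sF.
have By : B y.
  rewrite -uy; have F0 : Fmin 0 by move=> j; rewrite finset.in_setT pairing0.
  by have := HO 0 F0; rewrite addr0; apply; exact: nbhs_singleton.
have SB : S (f0 @^-1` B) by rewrite -(sector_germ_chimney g b 0 0 (weyl_id R D)) in RB.
have [f [fB fS agree]] := sector_chart_move aA0 fA0 aB SB.
have [v _ vy] : range f y by rewrite (chart_range HM aB fB).
by exists B, f, v; rewrite fS f0S.
Qed.

Lemma at_position_exists y : exists v, at_position y v.
Proof.
have [B [f [v [[aB fB] fS agree <-]]]] := at_position_chart y.
by exists v, f; split=> //; exact: (sector_chart_chart aB fB fS).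
Qed.

(** The retraction turns translation towards s into translation in the model: a chart used for
    [sector_add] becomes, after a translation, one that agrees with f0 near s. *)
Lemma sector_add_position y u y' v : sector_add b s y u y' -> at_position y v ->
  at_position y' (v + sgn b u).
Proof.
move=> [A [psi1 [v1 [[aA _ _] [[f [h [fA [hT _] psi1E]] psi1S e ->]]]]]] [psi [good agree e']].
have good1 : sector_chart psi1 by exists A, f, h.
have H := sector_chart_agree good1 good (etrans e (esym e')).
exists (fun z => psi1 (z + (v1 - v))); split.
- exact: sector_chart_translate.
- apply: (sector_infty_sub g) (sector_inftyI g (sector_infty_translate g (v1 - v) H) agree) => z /= [-> <-].
  by congr psi; rewrite -addrA -(opprB v) addNr addr0.
- by congr psi1; rewrite addrC addrA subrK.
Qed.

Lemma chart_sector_add B f v u : apartment B -> charts B f -> fmap f S = s ->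
  sector_add b s (f v) u (f (v + sgn b u)).
Proof.
move=> aB fB fS; exists B, f, v; split; split=> //; first exact: (chart_mem HM _ aB fB).
  by rewrite -fS; apply: (sector_infty_sub g) (sector_inftyT g b) => z _; exact: (chart_mem HM _ aB fB).
exists f, id; split=> //; split; first by exists id, 0; split=> //; [exact: weyl_id | apply/funext => z; rewrite addr0].
split; first by exists id.
  by move=> a z z'; rewrite /linear_part !subr0.
apply/seteqP; split=> [_ [[P z] H <-]|[P z] H]; first by rewrite /linear_part subr0 image_id.
by exists (P, z) => //; rewrite /linear_part subr0 image_id.
Qed.

(** Two sectors directed by s meet. This keeps the infimum in [theta_dist] from being the default
    value 0 of an empty set. *)
Lemma sector_meet_nonempty y y' : sector_meet b s y y' !=set0.
Proof.
have [B [f [v [[aB fB] fS agree <-]]]] := at_position_chart y.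
have [B' [f' [v' [[aB' fB'] fS' agree' <-]]]] := at_position_chart y'.
have [z [[[/= h1 h2] [c Cc ce]] [c' Cc' ce']]] := sector_infty_nonempty g (sector_inftyI g
  (sector_inftyI g (sector_inftyI g agree agree') (sector_infty_cone g b v)) (sector_infty_cone g b v')).
exists (c, c'); split=> /=.
- by apply: closure_fund_chamber => j; rewrite ltW.
- by apply: closure_fund_chamber => j; rewrite ltW.
exists (f z); split; first by rewrite -ce; exact: (chart_sector_add _ _ aB fB fS).
by rewrite h1 -h2 -ce'; exact: (chart_sector_add _ _ aB' fB' fS').
Qed.

End Retraction.

(** * Comparison of the two topologies *)

Section Topologies.
Variables (R : realType) (D : vectorial_data).
Variable g : kac_moody_algebra R[i] (@vd_matrix D).
Variable M : apartment_system R D.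
Hypothesis HM : is_masure g M.
Local Notation V := 'rV[R]_(vd_rank D).
Local Notation al := (aroot R).
Local Notation C := (@fund_chamber R D).
Local Notation rho := (coweight_rho R D).
Local Notation S b := (@sector_infty R D b).
Local Notation Lat := (@lattice R D).
Implicit Types (u v t p c : V) (psi : V -> M) (x y : M).

Lemma sector_germ_chart b (s : set_system M) : masure_filter (is_sector_germ (R := R) (D := D) b) s ->
  exists A f, [/\ apartment A, charts A f & fmap f (S b) = s].
Proof.
move=> [A aA [f [_ [fA [x [_ [[w ww ->] ->]]] ->]]]]; exists A, (f \o w); split=> //.
  exact: (chart_comp HM aA fA (affine_weyl_weyl ww)).
have -> : fmap (f \o w) (S b) = fmap f (fmap w (S b)) by [].
have -> : fmap w (S b) = sector_face_germ 0 [set sgn b (w c) | c in C].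
  by rewrite -(sector_infty_affine g b 0 ww) (_ : (fun v => w v + 0) = w) //; apply/funext => v; rewrite addr0.
by rewrite (sector_germ_chimney g b 0 0 ww) (sector_germ_chimney g b x 0 ww).
Qed.

Lemma twin_apartment s1 s2 : masure_filter (is_sector_germ (R := R) (D := D) true) s1 ->
  masure_filter (is_sector_germ (R := R) (D := D) false) s2 ->
  exists (A : set M) f1 f2, [/\ apartment A, charts A f1, charts A f2, fmap f1 (S true) = s1
    & fmap f2 (S false) = s2].
Proof.
move=> /sector_germ_chart[A1 [f1 [aA1 fA1 <-]]] /sector_germ_chart[A2 [f2 [aA2 fA2 <-]]].
have SE b := sector_germ_chimney g b 0 0 (weyl_id R D).
have [B [aB B1 B2]] := MA3_charts HM aA1 fA1 aA2 fA2
  (splayed_sector g true 0 (weyl_id R D)) (solid_germ_sector g false 0 (weyl_id R D)).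
rewrite -!SE in B1 B2.
have [h1 [hB1 hS1 _]] := sector_chart_move HM aA1 fA1 aB B1.
have [h2 [hB2 hS2 _]] := sector_chart_move HM aA2 fA2 aB B2.
by exists B, h1, h2.
Qed.

Section Distance.
Variables (b : bool) (th : theta M b).
Local Notation N := (theta_norm th).
Local Notation s := (theta_germ th).

Lemma theta_dist_le x y q : sector_meet b s x y q -> theta_dist th x y <= N q.1 + N q.2.
Proof.
move=> xy; apply: ge_inf; last by exists q.
by exists 0 => _ [q' _ <-]; rewrite addr_ge0 // (is_norm_ge0 (theta_normP th)).
Qed.

(** If x +_s u = y +_s u', the two positions of this point agree, so v - v' is u' - u up to sign,
    and its norm is at most the sum of the two. *)
Lemma theta_dist_position A0 f0 x y v v' e : apartment A0 -> charts A0 f0 -> fmap f0 (S b) = s ->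
  at_position b s f0 x v -> at_position b s f0 y v' -> theta_dist th x y < e -> N (v - v') < e.
Proof.
move=> aA0 fA0 f0S xv yv'.
have [q0 xyq0] := sector_meet_nonempty HM aA0 fA0 f0S x y.
move=> /inf_lt[|_ [[u u'] [/= _ _ [z [xu yu']]] <-]].
  by exists (N q0.1 + N q0.2), q0.
apply: le_lt_trans; have N1 := theta_normP th.
have := at_position_unique HM aA0 fA0 (sector_add_position HM xu xv) (sector_add_position HM yu' yv').
move=> e1; have -> : v - v' = sgn b (u' - u).
  by rewrite sgnD sgnN; apply/eqP; rewrite subr_eq addrAC eq_sym subr_eq addrC -e1 addrC.
rewrite (is_norm_sgn N1); apply: le_trans (is_normD N1 _ _) _; by rewrite (is_normN N1) addrC.
Qed.

(* The retraction centred at [s] is 1-Lipschitz. *)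
Lemma open_off_lattice A0 f0 v0 : apartment A0 -> charts A0 f0 -> fmap f0 (S b) = s ->
  theta_topology th [set y | forall v, at_position b s f0 y v -> ~ (Lat (v - v0) /\ v - v0 <> 0)].
Proof.
move=> aA0 fA0 f0S y Oy; have [v yv] := at_position_exists HM aA0 fA0 f0S y.
have [e e0 sep] := lattice_separated (theta_normP th) (Oy v yv).
exists e => // y' yy' v' yv' [L n0]; have := sep _ L n0.
have := theta_dist_position aA0 fA0 f0S yv yv' yy'.
rewrite opprB addrA subrK => h1 h2.
by have := lt_le_trans h1 h2; rewrite ltxx.
Qed.

End Distance.

Hypothesis Mthick : thick_locally_finite g M.

(** Precomposing the chart with the inverse of w moves the branching to the wall where alpha_i o w
    takes the value 1. *)
Lemma branching_weyl (A : set M) f i w : apartment A -> charts A f -> weyl w ->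
  exists (B : set M) b (A' : set M) e w',
  [/\ apartment B /\ charts B b, apartment A' /\ charts A' e, weyl w' /\ cancel w' w,
    forall v, 1 <= pairing (al i) (w v) -> b v = f v
    & (forall v, pairing (al i) (w v) <= 1 -> e v = f v) /\ b 0 = e (w' (acoroot R i))].
Proof.
move=> aA fA ww; have [w' [ww' k k']] := weyl_inv ww.
have fw := chart_comp HM aA fA (affine_weyl_weyl ww').
have [B [b [A' [e [[aB bB] [aA' eA'] bf ef be]]]]] := branching HM Mthick i aA fw.
exists B, (b \o w), A', (e \o w), w'; split=> //.
- by split=> //; exact: (chart_comp HM aB bB (affine_weyl_weyl ww)).
- by split=> //; exact: (chart_comp HM aA' eA' (affine_weyl_weyl ww)).
- by move=> v /bf /= ->; rewrite k.
split; first by move=> v /ef /= ->; rewrite k.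
by rewrite /= k' (linear_map0 (weyl_lin ww)).
Qed.

Lemma fmap_agree_sector b psi psi' p :
  (forall c, C c -> psi (p + sgn b c) = psi' (p + sgn b c)) -> fmap psi (S b) = fmap psi' (S b).
Proof.
move=> H; apply: (@fmap_agree _ _ _ _ _ _ [set v | psi v = psi' v]) => //.
- exact: (sector_infty_sub g).
- exact: (sector_inftyI g).
- by apply/(sector_inftyP g); exists p.
Qed.

Lemma theta_topology_neq (thp : theta M true) (thm : theta M false) :
  ~ is_building M -> theta_topology thp <> theta_topology thm.
Proof.
move=> inf eqT.
have [A [f [f' [aA fA fA' fS fS']]]] := twin_apartment (theta_germP thp) (theta_germP thm).
have [h hW f'E] := chart_diff HM aA fA fA'.
have [h' [_ hk hk']] := affine_weyl_inv g hW.
(* f is adapted to s_+ and f' to s_-; v0 is the coordinate of the point f 0 in f'. *)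
pose v0 := h' 0.
have := open_off_lattice (v0 := v0) aA fA' fS'.
set O := [set y | _]; rewrite -eqT => openO.
have f'v0 : f' v0 = f 0 by rewrite f'E /= hk'.
have at0 : at_position false (theta_germ thm) f' (f 0) v0.
  exists f'; split=> //; first exact: (sector_chart_chart aA fA' fS').
  by apply: (sector_infty_sub g) (sector_inftyT g false).
have [|e e0 He] := openO (f 0).
  by move=> v /(at_position_unique HM aA fA') -/(_ _ at0) ->; rewrite subrr => -[].
have [w [t [ww _ hE]]] := hW.
(* The bound 2 N(rho) / alpha(rho) on the distance is below e as soon as alpha(rho) exceeds K. *)
pose K := (theta_norm thp rho + theta_norm thp rho) / e.
have N1 := theta_normP thp.
have K0 : 0 <= K by rewrite divr_ge0 ?addr_ge0 ?(is_norm_ge0 N1) // ltW.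
have [i [u [wu posC poswC KK]]] := large_root g inf ww K.
have [B [b [A' [e' [u' [[aB bB] [aA' eA'] [wu' k'] bf [ef be]]]]]]] := branching_weyl i aA fA wu.
have uD v v' : u (v + v') = u v + u v' by have := weyl_lin wu 1 v v'; rewrite !scale1r.
have uZ r v : u (r *: v) = r *: u v.
  by have := weyl_lin wu r v 0; rewrite !addr0 (linear_map0 (weyl_lin wu)) addr0.
have uN v : u (- v) = - u v by rewrite -scaleN1r uZ scaleN1r.
set K' := pairing (al i) (u rho) in KK; have K'0 : 0 < K' by exact: le_lt_trans K0 KK.
(* The multiple of rho at which the root alpha_i o u takes the value 1: adding it to 0 reaches the
   wall, where b and f agree. *)
pose uu := K'^-1 *: rho.
have iuu : pairing (al i) (u uu) = 1 by rewrite uZ pairingZ mulVf // gt_eqF.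
have uuC : closure C uu.
  by apply: closure_fund_chamber => j; rewrite pairingZ root_rho mulr1 invr_ge0 ltW.
have bS : fmap b (S true) = theta_germ thp.
  rewrite -fS; apply: (@fmap_agree_sector _ _ _ uu) => c Cc; apply: bf.
  by rewrite uD pairingD iuu lerDl ltW // posC.
have near : theta_dist thp (f 0) (b 0) < e.
  apply: (@le_lt_trans _ _ (theta_norm thp uu + theta_norm thp uu)).
    apply: (@theta_dist_le _ _ _ _ (uu, uu)); split=> //=; exists (f uu); split.
      by have := chart_sector_add HM 0 uu aA fA fS; rewrite /= add0r.
    by have := chart_sector_add HM 0 uu aB bB bS; rewrite /= add0r (bf uu) ?iuu.
  rewrite (is_normZ N1) ger0_norm ?invr_ge0 1?ltW // -mulrDr mulrC ltr_pdivrMr //.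
  by rewrite mulrC -ltr_pdivrMr.
pose z := h' (u' (acoroot R i)).
have hz : h z = u' (acoroot R i) by rewrite hk'.
have hA' := chart_comp HM aA' eA' hW.
have hv0 : w v0 + t = 0 by have := hk' 0; rewrite -/v0 {1}hE.
(* h maps v0 - c to - w c, where the root alpha_i o u is negative; so the values of e' and f
   coincide there, and e' o h computes the retraction centred at s_-. *)
have agree c : C c -> (e' \o h) (v0 + sgn false c) = f' (v0 + sgn false c).
  move=> Cc; rewrite f'E /=; apply: ef.
  rewrite hE affine_shift // hv0 add0r /= .
  have := poswC c Cc; have := weyl_lin ww (-1) c 0.
  rewrite !addr0 !scaleN1r (linear_map0 (weyl_lin ww)) addr0 => ->.
  by rewrite uN pairingN => ?; lra.
have hS : fmap (e' \o h) (S false) = theta_germ thm.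
  by rewrite -fS'; apply: (@fmap_agree_sector _ _ _ v0).
have wz : w (z - v0) = u' (acoroot R i).
  have := affine_shift t ww v0 (z - v0); rewrite (addrC v0) subrK hv0 add0r => <-.
  by rewrite -hz hE.
(* By [near], b 0 should belong to O. But its position z differs from v0 by a Weyl image of
   alpha_i^vee, a lattice vector that is nonzero because alpha_i(alpha_i^vee) = 2. *)
apply: (He _ near z).
  exists (e' \o h); split; first exact: (sector_chart_chart aA' hA' hS).
    apply/(sector_inftyP g); exists v0; exact: agree.
  by rewrite /= hz.
have [w' [ww' kw kw']] := weyl_inv ww; split.
  rewrite -(kw (z - v0)) wz; apply: (lattice_weyl ww'); apply: (lattice_weyl wu').
  exact: lattice_acoroot.
move=> z0; move: wz; rewrite z0 (linear_map0 (weyl_lin ww)) => /(congr1 u).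
rewrite k' (linear_map0 (weyl_lin wu)) => /(congr1 (pairing (al i))).
rewrite pairing0 root_coroot2; lra.
Qed.

End Topologies.

Theorem corollary45 (R : realType) (D : vectorial_data)
    (g : kac_moody_algebra R[i] (@vd_matrix D))
    (M : apartment_system R D) (M_masure : is_masure g M)
    (M_thick : thick_locally_finite g M)
    (G : groupType) (act : G -> M -> M)
    (G_strong : strongly_transitive g act)
    (A0 : set M) (iota : 'rV[R]_(vd_rank D) -> M)
    (A0_apartment : apartment A0) (iota_chart : charts A0 iota)
    (G_stabilizer : stabilizer_action act iota = semidirect (@lattice R D)) :
  ~ is_building M ->
  forall (thp : theta M true) (thm : theta M false),
    theta_topology thp <> theta_topology thm.
Proof. by move=> nb thp thm; exact: theta_topology_neq M_masure M_thick _ _ nb. Qed.
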